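(* Let $D$ be a $\mathbb C$-convex domain in $\mathbb C^n$ not containing a complex line. Then $D$ is biholomorphic to a bounded domain and is $c$-finite compact, hence also $c$-complete. In particular, $D$ is hyperconvex, so it is a taut domain.
   Context: A domain $D\subset\mathbb C^n$ is $\mathbb C$-convex if each of its nonempty intersections with complex lines is connected and simply connected. Let $p_{\mathbb D}$ be the Poincaré distance on the open unit disc $\mathbb D$, i.e. $p_{\mathbb D}(a,b)=\tanh^{-1}\left|\frac{a-b}{1-\overline a b}\right|$. The Carathéodory (pseudo)distance of $D$ is $c_D(z,w)=\sup\{p_{\mathbb D}(f(z),f(w)):f\in\mathcal O(D,\mathbb D)\}$. $D$ is $c$-finite compact if all balls with respect to $c_D$ (of finite radius) are relatively compact in $D$; $D$ is $c$-complete if $c_D$ is a distance and $(D,c_D)$ is complete. $D$ is hyperconvex if it has a negative plurisubharmonic exhaustion function. $D$ is taut if the family $\mathcal O(\mathbb D,D)$ is normal. *)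

(* Defs.v *)
(* C is R[i] for an arbitrary R : realType. Its normed topology is carried by
   the alias R[i]^o, so C^n is the space of row vectors over R[i]^o, with the
   sup norm. *)
From HB Require Import structures.
From mathcomp Require Import all_boot all_order all_algebra.
From mathcomp Require Import complex.
From mathcomp Require Import all_classical all_reals all_analysis.

Set Implicit Arguments.
Unset Strict Implicit.
Unset Printing Implicit Defensive.

Import Order.TTheory GRing.Theory Num.Theory numFieldNormedType.Exports.

Local Open Scope classical_set_scope.
Local Open Scope ring_scope.
Local Open Scope complex_scope.

Section Domains.
Context {R : realType} {n : nat}.
Implicit Types (D G A : set 'rV[R[i]^o]_n) (a b : 'rV[R[i]^o]_n).

Definition domain D := [/\ open D, connected D & D !=set0].

(* The complex line through a in the direction b; a line only if b != 0. *)
Definition complex_line a b : set 'rV[R[i]^o]_n :=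
  [set a + l *: b | l in [set: R[i]]].

Definition contains_complex_line D :=
  exists a b, b != 0 /\ complex_line a b `<=` D.

(* Every loop in A contracts in A, relative to its base point. Path
   connectedness is not included. *)
Definition simply_connected A :=
  forall gamma : R -> 'rV[R[i]^o]_n,
    {within `[0, 1], continuous gamma} ->
    (forall t, t \in `[0, 1] -> A (gamma t)) ->
    gamma 0 = gamma 1 ->
    exists H : R * R -> 'rV[R[i]^o]_n,
      [/\ {within `[0, 1] `*` `[0, 1], continuous H},
          (forall s t, s \in `[0, 1] -> t \in `[0, 1] -> A (H (s, t))),
          (forall t, t \in `[0, 1] -> H (0, t) = gamma t),
          (forall t, t \in `[0, 1] -> H (1, t) = gamma 0) &
          (forall s, s \in `[0, 1] ->
             H (s, 0) = gamma 0 /\ H (s, 1) = gamma 0)].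

Definition C_convex D :=
  forall a b, b != 0 -> D `&` complex_line a b !=set0 ->
    connected (D `&` complex_line a b) /\
    simply_connected (D `&` complex_line a b).

Definition relatively_compact A D := compact (closure A) /\ closure A `<=` D.

End Domains.

(* Meant for open A: complex differentiability at every point of A. *)
Definition holomorphic_on {R : realType} {U V : normedModType R[i]}
    (A : set U) (f : U -> V) := forall z, A z -> differentiable f z.

(* f restricts to an element of O(A, B); the values of f off A are
   irrelevant. *)
Definition holomorphic_map {R : realType} {U V : normedModType R[i]}
    (A : set U) (B : set V) (f : U -> V) :=
  holomorphic_on A f /\ (forall z, A z -> B (f z)).

Definition biholomorphic {R : realType} {U V : normedModType R[i]}
    (A : set U) (B : set V) :=
  exists (f : U -> V) (g : V -> U),
    [/\ holomorphic_map A B f, holomorphic_map B A g,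
        (forall z, A z -> g (f z) = z) & (forall w, B w -> f (g w) = w)].

Section Caratheodory.
Context {R : realType}.

Definition unit_disc : set R[i]^o := [set z | `|z| < 1].

Definition artanh (x : R) : R := 2^-1 * ln ((1 + x) / (1 - x)).

Definition poincare_dist (a b : R[i]) : R :=
  artanh (complex.Re `|(a - b) / (1 - a^* * b)|).

Definition caratheodory {n : nat} (D : set 'rV[R[i]^o]_n)
    (z w : 'rV[R[i]^o]_n) : \bar R :=
  ereal_sup [set (poincare_dist (f z) (f w))%:E |
              f in [set f : 'rV[R[i]^o]_n -> R[i]^o |
                     holomorphic_map D unit_disc f]].

Definition c_ball {n : nat} (D : set 'rV[R[i]^o]_n) (z : 'rV[R[i]^o]_n) (r : R) :=
  [set w | D w /\ (caratheodory D z w < r%:E)%E].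

Definition c_finite_compact {n : nat} (D : set 'rV[R[i]^o]_n) :=
  forall z (r : R), D z -> 0 < r -> relatively_compact (c_ball D z r) D.

Definition distance_on {T : Type} (A : set T) (d : T -> T -> \bar R) :=
  [/\ (forall x y, A x -> A y -> d x y \is a fin_num /\ (0 <= d x y)%E),
      (forall x y, A x -> A y -> (d x y = 0%E <-> x = y)),
      (forall x y, A x -> A y -> d x y = d y x) &
      (forall x y z, A x -> A y -> A z -> (d x z <= d x y + d y z)%E)].

Definition complete_on {T : Type} (A : set T) (d : T -> T -> \bar R) :=
  forall x : nat -> T, (forall k, A (x k)) ->
    (forall e : R, 0 < e -> exists N, forall j k,
       (N <= j)%N -> (N <= k)%N -> (d (x j) (x k) < e%:E)%E) ->
    exists2 l, A l & forall e : R, 0 < e ->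
      exists N, forall k, (N <= k)%N -> (d (x k) l < e%:E)%E.

Definition c_complete {n : nat} (D : set 'rV[R[i]^o]_n) :=
  distance_on D (caratheodory D) /\ complete_on D (caratheodory D).

End Caratheodory.

Section Hyperconvex.
Context {R : realType}.

Definition upper_semicontinuous_on {T : topologicalType} (A : set T)
    (u : T -> \bar R) :=
  forall x, A x -> forall a : R, (u x < a%:E)%E ->
    \forall y \near within A (nbhs x), (u y < a%:E)%E.

(* Values in [-oo, +oo[, the constant -oo being allowed. The integral makes
   sense: the integrand is upper semicontinuous, hence bounded above, on the
   circle. *)
Definition subharmonic_on (A : set R[i]^o) (v : R[i]^o -> \bar R) :=
  [/\ (forall z, A z -> (v z < +oo)%E),
      upper_semicontinuous_on A v &
      (forall (c : R[i]^o) (r : R), 0 < r ->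
         [set z | `|z - c| <= r%:C] `<=` A ->
         (v c <= ((2 * pi)^-1)%:E *
            \int[lebesgue_measure]_(t in `[0%R, (2 * pi)%R])
               v (c + r%:C * (cos t +i* sin t))%R)%E)].

Definition plurisubharmonic_on {n : nat} (D : set 'rV[R[i]^o]_n)
    (u : 'rV[R[i]^o]_n -> \bar R) :=
  [/\ (forall z, D z -> (u z < +oo)%E),
      upper_semicontinuous_on D u &
      (forall a b : 'rV[R[i]^o]_n,
         subharmonic_on [set l | D (a + l *: b)] (fun l => u (a + l *: b)))].

Definition hyperconvex {n : nat} (D : set 'rV[R[i]^o]_n) :=
  exists u : 'rV[R[i]^o]_n -> \bar R,
    [/\ plurisubharmonic_on D u,
        (forall z, D z -> (u z < 0)%E) &
        (forall c : R, c < 0 ->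
           relatively_compact [set z | D z /\ (u z < c%:E)%E] D)].

End Hyperconvex.

Section Taut.
Context {R : realType} {n : nat}.

(* Normality of O(unit_disc, D): a subsequence either converges locally
   uniformly to an element of O(unit_disc, D) or diverges compactly. *)
Definition taut (D : set 'rV[R[i]^o]_n) :=
  forall f : nat -> R[i]^o -> 'rV[R[i]^o]_n,
    (forall k, holomorphic_map unit_disc D (f k)) ->
    exists2 phi : nat -> nat, {homo phi : j k / (j < k)%N} &
      (exists2 g, holomorphic_map unit_disc D g &
         forall K : set R[i]^o, compact K -> K `<=` unit_disc ->
           {uniform K, (f \o phi) @ \oo --> g}) \/
      (forall (K : set R[i]^o) (L : set 'rV[R[i]^o]_n),
         compact K -> K `<=` unit_disc -> compact L -> L `<=` D ->
         \forall k \near \oo, (f (phi k) @` K) `&` L = set0).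

End Taut.

(* Main.v *)
Require Import Defs.
From HB Require Import structures.
From mathcomp Require Import all_boot all_order all_algebra.
From mathcomp Require Import complex.
From mathcomp Require Import all_classical all_reals all_analysis.
From mathcomp Require Import ring lra.
Import Order.TTheory GRing.Theory Num.Theory numFieldNormedType.Exports.
Local Open Scope classical_set_scope.
Local Open Scope ring_scope.

(** Everything follows from logarithms of affine functionals without zeros on D.

    Logarithms. A nonvanishing continuous function g on an open C-convex set D has
    a continuous logarithm: continue it from a base point z0 to z along the complex
    line through z0 and z, whose intersection with D is connected and simply
    connected (C_convex_log). This rests on lifting paths and homotopies through
    exp, and on the continuity of the increments in the parameter (log_increment).
    The logarithm is holomorphic if g is.

    Supporting hyperplanes. Let a ball in D touch a boundary point a. If the complex
    tangent plane at a met D, the logarithm increments on the complex lines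
    through a close to that plane would give a continuous logarithm of conj(eta) on
    a circle, where eta is the slope of the line (tangent_plane_misses). Such points
    are dense in the boundary, so by compactness every boundary point lies on a
    complex hyperplane missing D (supporting_hyperplane).

    Bounded model. If D contains no complex line, these hyperplanes give n linearly
    independent affine functionals without zeros on D (independent_functionals). A
    logarithm L of such a functional depends on its value only, because the fibres
    are C-convex; so L(D) and L(D) + 2 pi i are disjoint and L(D) misses a disc
    around some q (log_omits_disc). The functions 1 / (L_j - q_j) embed D
    biholomorphically onto a bounded domain (biholomorphic_bounded).

    Finite compactness. Again rho / (2 (L - q)) is a nonvanishing function into
    the disc. The Cayley transform of its logarithm maps D to the disc and tends to
    the boundary as L tends to infinity, so that L is bounded on Caratheodory balls
    (log_bounded_on_balls). Hence the functionals are bounded, and bounded away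
    from 0, on such balls: the balls are bounded and do not accumulate at the
    boundary (C_convex_c_finite_compact). Completeness follows.

    Hyperconvexity and tautness hold for every c-finite compact domain. With
    m(z0, z) the hyperbolic tangent of the Caratheodory distance, m(z0, .) - 1 is
    a negative exhaustion function; it is plurisubharmonic as a supremum of moduli
    of holomorphic functions (c_finite_compact_hyperconvex). For a sequence of
    holomorphic maps f_k of the disc to D, either the f_k(0) leave every ball, and
    then the f_k diverge compactly, or infinitely many f_k(0) stay in one ball, and
    these f_k are locally uniformly relatively compact and equicontinuous, so that
    a subsequence converges (c_finite_compact_taut).

    The one-variable theory needed for this, up to the theorem of Weierstrass on
    uniform limits, is derived from Goursat's lemma in logarithmic polar
    coordinates, which gives the mean value property (mean_value_punctured). *)

Set Implicit Arguments.
Unset Strict Implicit.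
Unset Printing Implicit Defensive.
Local Open Scope complex_scope.

(** * Real-valued norms, convergence and differentiability *)

Lemma near_cvg {T : Type} {X : topologicalType} {F : set_system T} (f : T -> X)
    (l : X) (P : X -> Prop) :
  f @ F --> l -> (\forall y \near l, P y) -> \forall x \near F, P (f x).
Proof. by move=> fl /fl. Qed.

Lemma near_imply {X : topologicalType} {x : X} {P Q : X -> Prop} :
  (\forall y \near x, P y) -> (forall y, P y -> Q y) -> \forall y \near x, Q y.
Proof. by move=> nP PQ; exact: filterS nP. Qed.

Lemma near_imply2 {X : topologicalType} {x : X} {P1 P2 Q : X -> Prop} :
  (\forall y \near x, P1 y) -> (\forall y \near x, P2 y) ->
  (forall y, P1 y -> P2 y -> Q y) -> \forall y \near x, Q y.
Proof. by move=> n1 n2 PQ; exact: filterS2 n1 n2. Qed.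

Lemma cvg_comp_at {T : Type} {Y Z : topologicalType} {F : set_system T}
    (f : T -> Y) (g : Y -> Z) (y : Y) (z : Z) :
  f @ F --> y -> g @ y --> z -> g (f x) @[x --> F] --> z.
Proof. by move=> fy gz; exact: cvg_comp fy gz. Qed.

Lemma cvg_pair_at {T : Type} {Y Z : topologicalType} {F : set_system T} {FF : Filter F}
    (f : T -> Y) (g : T -> Z) (y : Y) (z : Z) :
  f @ F --> y -> g @ F --> z -> (f x, g x) @[x --> F] --> ((y, z) : Y * Z).
Proof. by move=> fy gz; exact: cvg_pair fy gz. Qed.

Lemma cvg_id_at {Y : topologicalType} (y : Y) : id x @[x --> y] --> y.
Proof. exact: cvg_id. Qed.

Lemma cvg_fst_at {Y Z : topologicalType} (p : Y * Z) : q.1 @[q --> p] --> p.1.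
Proof. exact: cvg_fst. Qed.

Lemma cvg_snd_at {Y Z : topologicalType} (p : Y * Z) : q.2 @[q --> p] --> p.2.
Proof. exact: cvg_snd. Qed.

Lemma cvg_cst_at {T : Type} {Y : topologicalType} {F : set_system T} {FF : Filter F} (y : Y) :
  (fun=> y) @ F --> y.
Proof. exact: cvg_cst. Qed.

Arguments cvg_cst_at {T Y F FF} y.
Arguments cvg_id_at {Y} y.
Arguments cvg_fst_at {Y Z} p.
Arguments cvg_snd_at {Y Z} p.

Section ModulusBasics.
Variable R : realType.
Local Notation C := (R[i]^o).

(** The norm of an R[i]-module takes its values in R[i], which is only partially
    ordered; estimates are made with its real counterpart. *)
Definition nrm {V : normedModType R[i]} (v : V) : R := complex.Re `|v|.

Lemma normE {V : normedModType R[i]} (v : V) : `|v| = (nrm v)%:C.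
Proof. by rewrite /nrm RRe_real // ger0_real. Qed.

Section Module.
Variable V : normedModType R[i].
Implicit Types u v w : V.

Lemma nrm_ge0 v : 0 <= nrm v. Proof. by rewrite -lecR -normE; exact: normr_ge0. Qed.

Lemma nrm0 : nrm (0 : V) = 0. Proof. by rewrite /nrm normr0. Qed.

Lemma nrm_eq0 v : (nrm v == 0) = (v == 0).
Proof. by rewrite -(inj_eq (@complexI R)) -normE normr_eq0. Qed.

Lemma nrm_gt0 v : (0 < nrm v) = (v != 0).
Proof. by rewrite lt_def nrm_ge0 andbT nrm_eq0. Qed.

Lemma nrmN v : nrm (- v) = nrm v. Proof. by rewrite /nrm normrN. Qed.

Lemma nrmB v w : nrm (v - w) = nrm (w - v). Proof. by rewrite -nrmN opprB. Qed.

Lemma nrmD v w : nrm (v + w) <= nrm v + nrm w.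
Proof. by rewrite -lecR rmorphD /= -!normE ler_normD. Qed.

Lemma nrm_tri u v w : nrm (u - w) <= nrm (u - v) + nrm (v - w).
Proof. by apply: le_trans (nrmD _ _); rewrite addrA subrK. Qed.

Lemma nrmBl v w : nrm v - nrm w <= nrm (v - w).
Proof. by rewrite lerBlDr; apply: le_trans (nrmD _ _); rewrite subrK. Qed.

Lemma nrmZ (a : C) v : nrm (a *: v) = nrm a * nrm v.
Proof. by apply: complexI; rewrite -normE normrZ !normE -rmorphM. Qed.

Lemma nbhs_nrm v (A : set V) :
  nbhs v A <-> exists2 e : R, 0 < e & forall w, nrm (w - v) < e -> A w.
Proof.
split=> [/nbhs_ballP[e /= e0 eA]|[e e0 eA]].
  have ereal : e = (complex.Re e)%:C by rewrite RRe_real // gtr0_real.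
  exists (complex.Re e); first by rewrite -ltcR -ereal.
  move=> w we; apply: eA; rewrite -ball_normE /ball_ /=.
  by rewrite normE ereal ltcR nrmB.
apply/nbhs_ballP; exists e%:C; first by rewrite /= ltcR.
by move=> w; rewrite -ball_normE /ball_ /= normE ltcR nrmB => /eA.
Qed.

Lemma near_nrm v (e : R) : 0 < e -> \forall w \near v, nrm (w - v) < e.
Proof. by move=> e0; apply/nbhs_nrm; exists e. Qed.

Lemma cvg_nrm {T : Type} {F : set_system T} {FF : Filter F} (f : T -> V) v :
  f x @[x --> F] --> v <-> forall e : R, 0 < e -> \forall x \near F, nrm (f x - v) < e.
Proof.
split=> [fv e e0|H].
  by have := fv _ (near_nrm v e0); apply.
move=> A /nbhs_nrm[e e0 eA]; have := H e e0.
by apply: filterS => x /eA.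
Qed.

Lemma cvg_lt_nrm {T : Type} {F : set_system T} (f : T -> V) v (e : R) :
  f x @[x --> F] --> v -> 0 < e -> \forall x \near F, nrm (f x - v) < e.
Proof. by move=> fv e0; exact: near_cvg fv (near_nrm v e0). Qed.

Lemma nrm_cts v : {for v, continuous (nrm : V -> R)}.
Proof.
apply/cvgrPdist_lt => e e0; have := near_nrm v e0.
apply: filterS => w we; rewrite ltr_norml; apply/andP; split.
  by have := nrmBl w v; lra.
by have := nrmBl v w; rewrite nrmB; lra.
Qed.

Lemma cvg_nrmf {T : Type} {F : set_system T} {FF : Filter F} (f : T -> V) v :
  f x @[x --> F] --> v -> nrm (f x) @[x --> F] --> nrm v.
Proof. by move=> fv; apply: continuous_cvg fv; exact: nrm_cts. Qed.

Lemma open_nrm (A : set V) : open A <->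
  forall v, A v -> exists2 e : R, 0 < e & forall w, nrm (w - v) < e -> A w.
Proof.
rewrite openE; split=> [oA v /oA /nbhs_nrm//|H v /H h].
by apply/nbhs_nrm.
Qed.

End Module.

Implicit Types z w : C.

Lemma nrmE z : nrm z = Num.sqrt (complex.Re z ^+ 2 + complex.Im z ^+ 2).
Proof. by case: z => a b. Qed.

Lemma nrm_sqr z : nrm z ^+ 2 = complex.Re z ^+ 2 + complex.Im z ^+ 2.
Proof. by rewrite nrmE sqr_sqrtr // addr_ge0 // sqr_ge0. Qed.

Lemma nrm1 : nrm (1 : C) = 1. Proof. by rewrite /nrm normr1. Qed.

Lemma nrmM z w : nrm (z * w) = nrm z * nrm w.
Proof. by rewrite -nrmZ. Qed.

Lemma nrmV z : nrm z^-1 = (nrm z)^-1.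
Proof. by apply: complexI; rewrite -normE normfV normE -fmorphV. Qed.

Lemma nrm_real (x : R) : nrm (x%:C : C) = `|x|.
Proof. by rewrite nrmE /= expr0n addr0 sqrtr_sqr. Qed.

Lemma nrm_pos (x : R) : 0 <= x -> nrm (x%:C : C) = x.
Proof. by move=> x0; rewrite nrm_real ger0_norm. Qed.

Lemma nrm_conj z : nrm (z^* : C) = nrm z.
Proof. by rewrite !nrmE; case: z => a b /=; rewrite sqrrN. Qed.

Lemma Re_le z : `|complex.Re z| <= nrm z.
Proof.
by rewrite nrmE -[leLHS]sqrtr_sqr ler_wsqrtr // lerDl sqr_ge0.
Qed.

Lemma Im_le z : `|complex.Im z| <= nrm z.
Proof.
by rewrite nrmE -[leLHS]sqrtr_sqr ler_wsqrtr // lerDr sqr_ge0.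
Qed.

Lemma nrm_le z : nrm z <= `|complex.Re z| + `|complex.Im z|.
Proof.
rewrite -(@ler_pXn2r _ 2) ?nnegrE ?addr_ge0 ?nrm_ge0 // nrm_sqr sqrrD.
by rewrite !real_normK ?num_real // lerD2r lerDl mulrn_wge0 // mulr_ge0.
Qed.

Lemma ReD z w : complex.Re (z + w) = complex.Re z + complex.Re w.
Proof. exact: raddfD. Qed.
Lemma ImD z w : complex.Im (z + w) = complex.Im z + complex.Im w.
Proof. exact: raddfD. Qed.
Lemma ReN z : complex.Re (- z) = - complex.Re z. Proof. exact: raddfN. Qed.
Lemma ImN z : complex.Im (- z) = - complex.Im z. Proof. exact: raddfN. Qed.
Lemma ReM z w : complex.Re (z * w) =
  complex.Re z * complex.Re w - complex.Im z * complex.Im w.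
Proof. by case: z; case: w. Qed.
Lemma ImM z w : complex.Im (z * w) =
  complex.Re z * complex.Im w + complex.Im z * complex.Re w.
Proof. by case: z; case: w => *; rewrite /=; ring. Qed.

Lemma complexP z w : complex.Re z = complex.Re w -> complex.Im z = complex.Im w -> z = w.
Proof. by case: z; case: w => ? ? ? ? /= -> ->. Qed.

Lemma cvg_complex {T : Type} {F : set_system T} {FF : Filter F} (f g : T -> R) (a b : R) :
  f x @[x --> F] --> a -> g x @[x --> F] --> b ->
  ((f x +i* g x : C) @[x --> F] --> (a +i* b : C)).
Proof.
move=> /cvgrPdist_lt fa /cvgrPdist_lt gb; apply/cvg_nrm => e e0.
have e2 : 0 < e / 2 by lra.
near=> x; apply: le_lt_trans (nrm_le _) _ => /=.
have : `|a - f x| < e / 2 by near: x; apply: fa.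
have : `|b - g x| < e / 2 by near: x; apply: gb.
rewrite -(normrN (a - _)) -(normrN (b - _)) !opprB; lra.
Unshelve. all: by end_near. Qed.

Lemma cvg_Re {T : Type} {F : set_system T} {FF : Filter F} (f : T -> C) z :
  f x @[x --> F] --> z -> complex.Re (f x) @[x --> F] --> complex.Re z.
Proof.
move=> /cvg_nrm fa; apply/cvgrPdist_lt => e e0.
move: (fa e e0); apply: filterS => x; rewrite nrmB; apply: le_lt_trans.
by apply: le_trans (Re_le _); rewrite ReD ReN.
Qed.

Lemma cvg_Im {T : Type} {F : set_system T} {FF : Filter F} (f : T -> C) z :
  f x @[x --> F] --> z -> complex.Im (f x) @[x --> F] --> complex.Im z.
Proof.
move=> /cvg_nrm fa; apply/cvgrPdist_lt => e e0.
move: (fa e e0); apply: filterS => x; rewrite nrmB; apply: le_lt_trans.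
by apply: le_trans (Im_le _); rewrite ImD ImN.
Qed.

Lemma Re_cts z : complex.Re w @[w --> z] --> complex.Re z.
Proof. exact: (@cvg_Re C (nbhs z) (nbhs_filter z) id z (@cvg_id _ (nbhs z))). Qed.

Lemma Im_cts z : complex.Im w @[w --> z] --> complex.Im z.
Proof. exact: (@cvg_Im C (nbhs z) (nbhs_filter z) id z (@cvg_id _ (nbhs z))). Qed.

Lemma cvg_toC {T : Type} {F : set_system T} {FF : Filter F} (f : T -> R) (a : R) :
  f x @[x --> F] --> a -> ((f x)%:C : C) @[x --> F] --> (a%:C : C).
Proof. by move=> fa; apply: (cvg_complex fa); exact: cvg_cst. Qed.

Lemma cvg_conj {T : Type} {F : set_system T} {FF : Filter F} (f : T -> C) z :
  f x @[x --> F] --> z -> ((f x)^* : C) @[x --> F] --> (z^* : C).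
Proof.
move=> /cvg_nrm fa; apply/cvg_nrm => e e0; move: (fa e e0).
by apply: filterS => x; rewrite -rmorphB nrm_conj.
Qed.

(** Complex differentiability in one variable, in epsilon-delta form. *)
Definition cdiff (f : C -> C) (z d : C) := forall e : R, 0 < e ->
  \forall w \near z, nrm (f w - f z - (w - z) * d) <= e * nrm (w - z).

Lemma cdiff_differentiable f z : (exists d, cdiff f z d) <-> differentiable f z.
Proof.
split=> [[d fd]|/derivable1_diffP fz].
  apply/derivable1_diffP; apply/cvg_ex; exists d; apply/cvg_nrm => e e0.
  have e2 : 0 < e / 2 by lra.
  have [k k0 kP] := (nbhs_nrm _ _).1 (fd _ e2).
  near=> h.
  have h0 : h != 0 by near: h; exact: nbhs_dnbhs_neq.
  have hk : nrm (h : C) < k.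
    near: h; apply: nbhs_dnbhs; have := near_nrm (0 : C) k0.
    by apply: filterS => x; rewrite subr0.
  have := kP (h + z); rewrite addrK => /(_ hk).
  rewrite -[_ *: _]/(h^-1 * _) [_ *: 1]mulr1.
  have -> : h^-1 * (f (h + z) - f z) - d = h^-1 * (f (h + z) - f z - h * d).
    by rewrite [in RHS]mulrBr mulKf.
  rewrite nrmM nrmV => H; have hp : 0 < nrm h by rewrite nrm_gt0.
  rewrite mulrC ltr_pdivrMr //; apply: le_lt_trans H _.
  by rewrite ltr_pM2r //; lra.
exists ('D_1 f z) => e e0.
have := (@cvg_nrm C R[i] _ (dnbhs_filter (0 : C)) _ _).1 fz e e0.
rewrite /= /dnbhs /within /= => H0; have [k k0 kP] := (nbhs_nrm (0 : C) _).1 H0.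
apply/nbhs_nrm; exists k => // w wz.
have [->|wz0] := eqVneq w z; first by rewrite !subrr mul0r subr0 nrm0 mulr0.
have := kP (w - z); rewrite subr0 subr_eq0 => /(_ wz wz0).
rewrite -[_ *: (_ - _)]/((w - z)^-1 * _) [_ *: 1]mulr1 subrK -/('D_1 f z).
have h0 : w - z != 0 by rewrite subr_eq0.
have {1}-> : (w - z)^-1 * (f w - f z) - ('D_1 f z) =
   (w - z)^-1 * (f w - f z - (w - z) * ('D_1 f z)).
  by rewrite [in RHS]mulrBr mulKf.
rewrite nrmM nrmV => H; have hp : 0 < nrm (w - z) by rewrite nrm_gt0.
by move: H; rewrite mulrC ltr_pdivrMr // => /ltW.
Unshelve. all: by end_near. Qed.

End ModulusBasics.

Arguments nrm {R V} v.

(** * The complex exponential and logarithm *)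

Lemma locally_constant_connected {X : topologicalType} {T : Type} (S : set X) (f : X -> T) :
  connected S ->
  (forall x, S x -> \forall y \near x, S y -> f y = f x) ->
  forall x y, S x -> S y -> f x = f y.
Proof.
move=> cS loc x0 y Sx0 Sy.
pose B := [set y | S y /\ f y = f x0].
suff BS : B = S by move: Sy; rewrite -{1}BS => -[_ ->].
apply: cS; first by exists x0.
- exists (interior [set y | S y -> f y = f x0]); first exact: open_interior.
  rewrite /B; apply/seteqP; split=> z /=.
    by move=> [Sz zx0]; split => //; move: (loc z Sz); apply: filterS => w h /h ->.
  by move=> [Sz /nbhs_singleton h]; split => //; apply: h.
- exists (~` (interior [set y | S y -> f y <> f x0])).
    by apply: open_closedC; exact: open_interior.
  rewrite /B; apply/seteqP; split=> z /=.
    by move=> [Sz zx0]; split => // /nbhs_singleton/(_ Sz); exact.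
  move=> [Sz h]; split => //; apply: contrapT => fz; apply: h.
  by move: (loc z Sz); apply: filterS => w h /h ->.
Qed.

Section ComplexExponential.
Variable R : realType.
Local Notation C := (R[i]^o).
Implicit Types z w : C.

Definition cexp z : C :=
  (expR (complex.Re z) * cos (complex.Im z)) +i*
  (expR (complex.Re z) * sin (complex.Im z)).

Lemma cexpD z w : cexp (z + w) = cexp z * cexp w.
Proof.
apply: complexP; rewrite ?ReM ?ImM /= ReD ImD expRD ?cosD ?sinD; ring.
Qed.

Lemma cexp0 : cexp 0 = 1.
Proof. by apply: complexP => /=; rewrite expR0 ?cos0 ?sin0 ?mul1r. Qed.

Lemma nrm_cexp z : nrm (cexp z) = expR (complex.Re z).
Proof.
by rewrite nrmE /= !exprMn -mulrDr cos2Dsin2 mulr1 sqrtr_sqr ger0_norm ?expR_ge0.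
Qed.

Lemma cexp_neq0 z : cexp z != 0.
Proof. by rewrite -nrm_gt0 nrm_cexp expR_gt0. Qed.

Lemma cexpN z : cexp (- z) = (cexp z)^-1.
Proof.
apply: (mulfI (cexp_neq0 z)); rewrite -cexpD subrr cexp0 mulfV //.
exact: cexp_neq0.
Qed.

Lemma cexpB z w : cexp (z - w) = cexp z / cexp w.
Proof. by rewrite cexpD cexpN. Qed.

Lemma cexp_2pi (z : C) : cexp (z + (2 * pi) *i) = cexp z.
Proof.
apply: complexP; rewrite /= ReD ImD /= addr0.
  by rewrite mulrC [2 * pi]mulr_natl cosD2pi mulrC.
by rewrite mulrC [2 * pi]mulr_natl sinD2pi mulrC.
Qed.

(** The nonzero periods of cexp have norm at least 2 pi; 2 is a convenient bound
    below it. *)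
Lemma cexp_eq1 z : cexp z = 1 -> nrm z < 2 -> z = 0.
Proof.
case: z => x y [hc hs] hz.
have x0 : x = 0.
  apply: expR_inj; rewrite expR0 -[expR x](nrm_cexp (x +i* y)) /=.
  by rewrite -(nrm1 R); congr nrm; apply: complexP.
move: hs; rewrite x0 expR0 mul1r => sy.
have ypi : `|y| < pi.
  by apply: lt_le_trans (pi_ge2 R); apply: le_lt_trans hz; exact: (Im_le (x +i* y)).
have {}ypi : -pi < y < pi by rewrite -ltr_norml.
case: (ltgtP y 0) => [yn|yp|->] //.
  have : 0 < sin (- y) by apply: sin_gt0_pi; lra.
  by rewrite sinN sy oppr0 ltxx.
have : 0 < sin y by apply: sin_gt0_pi; lra.
by rewrite sy ltxx.
Qed.

Lemma cvg_cexp {T : Type} {F : set_system T} {FF : Filter F} (f : T -> C) z :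
  f x @[x --> F] --> z -> cexp (f x) @[x --> F] --> cexp z.
Proof.
move=> fz; apply: cvg_complex; apply: cvgM.
- by apply: continuous_cvg; [exact: continuous_expR|exact: cvg_Re].
- by apply: continuous_cvg; [exact: continuous_cos|exact: cvg_Im].
- by apply: continuous_cvg; [exact: continuous_expR|exact: cvg_Re].
- by apply: continuous_cvg; [exact: continuous_sin|exact: cvg_Im].
Qed.

Lemma real_deriv_bound (f : R -> R) (d e : R) : is_derive (0 : R) 1 f d -> 0 < e ->
  \forall x \near (0 : R), `|f x - f 0 - x * d| <= e * `|x|.
Proof.
move=> fd e0.
have dv : h^-1 *: (f (h *: 1 + 0) - f 0) @[h --> (0:R)^'] --> d.
  by have := @ex_derive _ _ _ _ _ _ _ fd; rewrite /derivable => h;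
     have <- := @derive_val _ _ _ _ _ _ _ fd.
move/cvgrPdist_lt/(_ e e0) : dv; rewrite /dnbhs near_withinE.
apply: filterS => x.
have [->|x0] := eqVneq x 0; first by rewrite subrr normr0 mulr0 mul0r subrr normr0.
move=> /(_ isT); rewrite addr0 [_ *: 1]mulr1 => h.
have -> : f x - f 0 - x * d = - (x * (d - x^-1 *: (f x - f 0))).
  by rewrite /GRing.scale /=; field.
by rewrite normrN normrM mulrC ler_pM2r ?normr_gt0 // ltW.
Qed.

Lemma cdiff_cexp0 : cdiff cexp 0 1.
Proof.
move=> e0 e00; pose e := Num.min 1 (e0 / 8).
have [e_gt0 e1 ee] : [/\ 0 < e, e <= 1 & e <= e0 / 8].
  rewrite /e; split; [rewrite lt_min|by rewrite ge_min lexx|by rewrite ge_min lexx orbT].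
  by rewrite ltr01 /=; lra.
have De := real_deriv_bound (is_derive_expR (0 : R)) e_gt0.
have Dc := real_deriv_bound (is_derive_cos (0 : R)) e_gt0.
have Ds := real_deriv_bound (is_derive_sin (0 : R)) e_gt0.
have Re0 : complex.Re z @[z --> (0 : C)] --> complex.Re (0 : C).
  exact: Re_cts.
have Im0 : complex.Im z @[z --> (0 : C)] --> complex.Im (0 : C).
  exact: Im_cts.
have E1 : \forall z \near (0 : C), `|expR (complex.Re z) - 1 - complex.Re z| <= e * `|complex.Re z|.
  by have := near_cvg Re0 De; apply: filterS => z /=; rewrite expR0 mulr1.
have E2 : \forall z \near (0 : C), `|cos (complex.Im z) - 1| <= e * `|complex.Im z|.
  by have := near_cvg Im0 Dc; apply: filterS => z /=; rewrite cos0 sin0 oppr0 mulr0 subr0.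
have E3 : \forall z \near (0 : C), `|sin (complex.Im z) - complex.Im z| <= e * `|complex.Im z|.
  by have := near_cvg Im0 Ds; apply: filterS => z /=; rewrite cos0 sin0 mulr1 subr0.
have E4 : \forall z \near (0 : C), nrm z < e.
  by have := near_nrm (0 : C) e_gt0; apply: filterS => t; rewrite subr0.
near=> z.
have h1 : `|expR (complex.Re z) - 1 - complex.Re z| <= e * `|complex.Re z| by near: z.
have h2 : `|cos (complex.Im z) - 1| <= e * `|complex.Im z| by near: z.
have h3 : `|sin (complex.Im z) - complex.Im z| <= e * `|complex.Im z| by near: z.
have h4 : nrm z < e by near: z.
rewrite subr0 mulr1 cexp0.
have hx := Re_le z; have hy := Im_le z.
have zE : complex.Re (cexp z - 1 - z) =
    expR (complex.Re z) * cos (complex.Im z) - 1 - complex.Re z.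
  by rewrite !ReD !ReN /=.
have zE' : complex.Im (cexp z - 1 - z) =
    expR (complex.Re z) * sin (complex.Im z) - complex.Im z.
  by rewrite !ImD !ImN /= subr0.
move: h1 h2 h3 hx hy zE zE'.
move: (complex.Re z) (complex.Im z) => x y h1 h2 h3 hx hy zE zE'.
set N := nrm _ in h4 hx hy *.
have cE : `|cos y| <= 1 by rewrite ler_norml cos_geN1 cos_le1.
have sE : `|sin y| <= `|y| * 2.
  rewrite -[sin y](subrK y); apply: le_trans (ler_normD _ _) _.
  have := ler_wpM2r (normr_ge0 y) e1; lra.
have xe : `|x| <= e by apply: le_trans hx (ltW h4).
apply: le_trans (nrm_le _) _; rewrite zE zE'.
have N0 : 0 <= N by exact: nrm_ge0.
have eN : 0 <= e * N by apply: mulr_ge0 => //; lra.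
have exx : e * `|x| <= e * N by rewrite ler_pM2l.
have eyy : e * `|y| <= e * N by rewrite ler_pM2l.
have A : `|expR x * cos y - 1 - x| <= 3 * (e * N).
  have -> : expR x * cos y - 1 - x = (expR x - 1 - x) * cos y + (1 + x) * (cos y - 1) by ring.
  apply: le_trans (ler_normD _ _) _; rewrite !normrM.
  have a1 : `|expR x - 1 - x| * `|cos y| <= (e * N) * 1.
    by apply: ler_pM => //; apply: le_trans h1 _.
  have a2 : `|1 + x| * `|cos y - 1| <= 2 * (e * N).
    apply: ler_pM => //; last by apply: le_trans h2 _.
    by apply: le_trans (ler_normD _ _) _; rewrite normr1; lra.
  lra.
have B : `|expR x * sin y - y| <= 5 * (e * N).
  have -> : expR x * sin y - y = (expR x - 1 - x) * sin y + (1 + x) * (sin y - y) + x * y by ring.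
  apply: le_trans (ler_normD _ _) _; rewrite [X in _ + X]normrM.
  have a0 : `|x| * `|y| <= e * N by apply: ler_pM.
  have := ler_normD ((expR x - 1 - x) * sin y) ((1 + x) * (sin y - y)); rewrite !normrM.
  have a1 : `|expR x - 1 - x| * `|sin y| <= (e * N) * 2.
    apply: ler_pM => //; [by apply: le_trans h1 _|apply: le_trans sE _].
    by have := lt_le_trans h4 e1; lra.
  have a2 : `|1 + x| * `|sin y - y| <= 2 * (e * N).
    apply: ler_pM => //; last by apply: le_trans h3 _.
    by apply: le_trans (ler_normD _ _) _; rewrite normr1; lra.
  lra.
have := ler_wpM2r N0 ee.
move: A B; set a := `|_|; set b := `|_|; move=> A B.
suff : a + b <= 8 * (e * N) by lra.
lra.
Unshelve. all: by end_near. Qed.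

Lemma cdiff_cexp z : cdiff cexp z (cexp z).
Proof.
move=> e e0; set M := nrm (cexp z).
have M0 : 0 < M by rewrite /M nrm_gt0 cexp_neq0.
have eM : 0 < e / M by rewrite divr_gt0.
have [k k0 kP] := (nbhs_nrm _ _).1 (cdiff_cexp0 eM).
apply/nbhs_nrm; exists k => // w wz.
have := kP (w - z); rewrite !subr0 cexp0 mulr1 => /(_ wz) h.
have -> : cexp w - cexp z - (w - z) * cexp z = cexp z * (cexp (w - z) - 1 - (w - z)).
  by rewrite cexpB; field; exact: cexp_neq0.
rewrite nrmM -/M; apply: le_trans (ler_wpM2l (ltW M0) h) _.
by rewrite mulrA mulrCA divff ?mulr1 ?gt_eqF.
Qed.

Lemma differentiable_cexp z : differentiable cexp z.
Proof. by apply/cdiff_differentiable; exists (cexp z); exact: cdiff_cexp. Qed.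

(** The principal logarithm on the right half-plane. *)
Definition clog z : C := ln (nrm z) +i* atan (complex.Im z / complex.Re z).

Lemma clogK z : 0 < complex.Re z -> cexp (clog z) = z.
Proof.
move=> x0; have z0 : 0 < nrm z.
  by apply: lt_le_trans (Re_le _); rewrite gtr0_norm.
have z2 := nrm_sqr z.
rewrite /clog /cexp /= lnK ?posrE //.
move: x0 z0 z2; set x := complex.Re z; set y := complex.Im z; set n := nrm z.
move=> x0 n0 n2.
have ca : cos (atan (y / x)) = x / n.
  rewrite cos_atan; have -> : 1 + (y / x) ^+ 2 = (n / x) ^+ 2.
    by rewrite !expr_div_n n2; field; rewrite gt_eqF.
  by rewrite sqrtr_sqr ger0_norm ?invf_div // divr_ge0 // ltW.
have sa : sin (atan (y / x)) = y / n.
  have := atanK (y / x); rewrite /tan => /(congr1 ( *%R^~ (cos (atan (y / x))))).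
  rewrite /= mulfVK; last by rewrite ca mulf_neq0 ?invr_neq0 // gt_eqF.
  by move=> ->; rewrite ca; field; rewrite !gt_eqF.
by apply: complexP; rewrite /= ?ca ?sa mulrCA divff ?mulr1 // gt_eqF.
Qed.

Lemma clog1 : clog 1 = 0.
Proof. by rewrite /clog nrm1 ln1 /= mul0r atan0. Qed.

Lemma cvg_clog {T : Type} {F : set_system T} {FF : Filter F} (f : T -> C) z :
  0 < complex.Re z -> f x @[x --> F] --> z -> clog (f x) @[x --> F] --> clog z.
Proof.
move=> z0 fz; apply: cvg_complex.
  apply: continuous_cvg; last exact: cvg_nrmf.
  by apply: continuous_ln; apply: lt_le_trans (Re_le _); rewrite gtr0_norm.
apply: continuous_cvg; first exact: continuous_atan.
apply: cvgM; first exact: cvg_Im.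
by apply: cvgV; [rewrite gt_eqF|exact: cvg_Re].
Qed.

Lemma Re_near1 z : nrm (z - 1) < 1 -> 0 < complex.Re z.
Proof.
move=> h; have := le_lt_trans (Re_le _) h; rewrite ReD ReN /= ltr_norml; lra.
Qed.

(** Multiplication by 'i, - 'i or -1 brings z into the right half-plane, where
    clog is available. *)
Lemma cexp_surj z : z != 0 -> exists w, cexp w = z.
Proof.
move=> z0.
have H u : 0 <= complex.Re u -> u != 0 -> exists w, cexp w = u.
  rewrite le_eqVlt => /orP[/eqP u0 un0|u0 _]; last by exists (clog u); rewrite clogK.
  have ci : cexp ((pi / 2) *i) = 'i :> C.
    by apply: complexP; rewrite /= expR0 mul1r ?cos_pihalf ?sin_pihalf.
  have cj : cexp (- (pi / 2) *i) = - 'i :> C by rewrite cexpN ci; apply: complexP; rewrite /=; field.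
  have [up|un] := ltP 0 (complex.Im u).
    exists (clog (u * - 'i) + (pi / 2) *i); rewrite cexpD clogK.
      by rewrite ci -mulrA mulNr -expr2 sqr_i opprK mulr1.
    by rewrite ReM /= -u0; lra.
  exists (clog (u * 'i) + - (pi / 2) *i); rewrite cexpD clogK.
    by rewrite cj -mulrA mulrN -expr2 sqr_i opprK mulr1.
  rewrite ReM /= -u0 mul0r add0r mulr1 oppr_gt0 lt_def eq_sym un andbT eq_sym.
  apply: contra_neq un0 => ui; exact: complexP.
have [zp|zn] := leP 0 (complex.Re z); first exact: H.
have [w wP] : exists w, cexp w = - z.
  by apply: H; rewrite ?oppr_eq0 // ReN; lra.
exists (w + pi *i); rewrite cexpD wP.
have -> : cexp (pi *i) = -1 :> C.
  by apply: complexP; rewrite /= expR0 mul1r ?cospi ?sinpi ?oppr0.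
by rewrite mulrN1 opprK.
Qed.

(** As clog is a continuous right inverse of cexp, its derivative at 1 is the
    inverse of that of cexp at 0. *)
Lemma cdiff_clog1 : cdiff clog 1 1.
Proof.
have d0 := cvg_clog _ (@cvg_id _ (nbhs (1 : C))).
have {}d0 : clog z @[z --> (1 : C)] --> (0 : C).
  by rewrite -clog1; apply: d0 => /=.
move=> e0 e00; pose e := Num.min (2^-1) (e0 / 2).
have [e_gt0 e1 ee] : [/\ 0 < e, e <= 2^-1 & e <= e0 / 2].
  rewrite /e; split; [rewrite lt_min|by rewrite ge_min lexx|by rewrite ge_min lexx orbT].
  by rewrite invr_gt0 ltr0n /=; lra.
have D := near_cvg d0 (cdiff_cexp0 e_gt0).
have {}D : \forall w \near (1 : C), nrm (cexp (clog w) - 1 - clog w) <= e * nrm (clog w).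
  by move: D; apply: filterS => w; rewrite /= cexp0 !subr0 mulr1.
have E1 : \forall w \near (1 : C), nrm ((w : C) - 1) < 1 by exact: near_nrm.
near=> w.
have w1 : 0 < complex.Re w.
  by apply: Re_near1; near: w.
have : nrm (cexp (clog w) - 1 - clog w) <= e * nrm (clog w) by near: w.
rewrite clogK // clog1 subr0 mulr1; set l := clog w => h.
have N0 : 0 <= nrm l by exact: nrm_ge0.
have h2 : nrm l <= 2 * nrm (w - 1).
  have : nrm l <= nrm (w - 1) + nrm (w - 1 - l).
    by have := nrm_tri l (w - 1) 0; rewrite !subr0 (nrmB l); lra.
  have := ler_wpM2r N0 e1; lra.
rewrite nrmB; apply: le_trans h _.
have := ler_wpM2l (ltW e_gt0) h2; have := ler_wpM2r (nrm_ge0 (w - 1)) ee; lra.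
Unshelve. all: by end_near. Qed.

Lemma differentiable_clog1 : differentiable clog (1 : C).
Proof. by apply/cdiff_differentiable; exists 1; exact: cdiff_clog1. Qed.

End ComplexExponential.

(** * Lifting paths through the exponential *)

Section Lifting.
Variable R : realType.
Local Notation C := (R[i]^o).

(** Precomposition with clip extends paths and homotopies from [0, 1] to R. *)
Definition clip (t : R) : R := Num.max 0 (Num.min t 1).

Lemma clip_ge0 t : 0 <= clip t. Proof. by rewrite /clip le_max lexx. Qed.
Lemma clip_le1 t : clip t <= 1.
Proof. by rewrite /clip ge_max ler01 ge_min lexx orbT. Qed.
Lemma clip_id t : 0 <= t <= 1 -> clip t = t.
Proof. by move=> /andP[t0 t1]; rewrite /clip (min_l t1) (max_r t0). Qed.
Lemma clip_0 t : t <= 0 -> clip t = 0.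
Proof.
by move=> t0; rewrite /clip min_l ?max_l //; apply: le_trans t0 ler01.
Qed.
Lemma clip_1 t : 1 <= t -> clip t = 1.
Proof. by move=> t0; rewrite /clip min_r ?max_r. Qed.

Lemma clip_cts : continuous clip.
Proof.
move=> t; rewrite /clip; apply: (@continuous_max R R (fun=> 0) _ t); first exact: cvg_cst.
have := @continuous_min R R id (fun=> 1) t; rewrite /continuous_at => H; apply: H; [exact: cvg_id|exact: cvg_cst].
Qed.

Lemma clip_fst_cts {X : topologicalType} (p : R * X) : clip q.1 @[q --> p] --> clip p.1.
Proof. exact: cvg_comp_at (cvg_fst_at p) (@clip_cts p.1). Qed.

(** The fibres of cexp are discrete. *)
Lemma cexp_const_connected {X : topologicalType} (S : set X) (L : X -> C) :
  connected S -> (forall x, S x -> L y @[y --> x] --> L x) ->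
  (forall x y, S x -> S y -> cexp (L x) = cexp (L y)) ->
  forall x y, S x -> S y -> L x = L y.
Proof.
move=> cS Lc Le; apply: (@locally_constant_connected X C S L cS) => x Sx.
have h := cvg_lt_nrm (Lc x Sx) (ltr0n _ 2).
move: h; apply: filterS => y h Sy; apply/eqP; rewrite -subr_eq0; apply/eqP.
apply: cexp_eq1 h; rewrite cexpB (Le _ _ Sy Sx) divff //; exact: cexp_neq0.
Qed.

Lemma unit_interval_connected : connected [set t : R | 0 <= t <= 1].
Proof.
apply/connected_intervalP => x y /= /andP[x0 x1] /andP[y0 y1] z /andP[xz zy].
by apply/andP; split; [exact: le_trans xz|exact: le_trans y1].
Qed.

Lemma unit_interval_compact : compact [set t : R | 0 <= t <= 1].
Proof.
have := @segment_compact R 0 1; congr compact; apply/seteqP; split => t /=; rewrite in_itv //.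
Qed.

(** The tube lemma for the compact interval [0, 1]. *)
Lemma near_clip {X : topologicalType} (x0 : X) (P : R -> X -> Prop) :
  (forall t : R, \forall t' \near t & x \near x0, P t' x) ->
  \forall x \near x0, forall t, 0 <= t <= 1 -> P t x.
Proof.
move=> H.
exact: ((compact_near_coveringP _).1 unit_interval_compact X (nbhs x0) (fun x t => P t x) _ (fun t _ => H t)).
Qed.

Definition lift (f l : R -> C) :=
  continuous l /\ forall t, 0 <= t <= 1 -> cexp (l t) = f t.

Lemma lift_unique f l l' : lift f l -> lift f l' -> l 1 - l 0 = l' 1 - l' 0.
Proof.
move=> [lc lf] [lc' lf'].
have := @cexp_const_connected R _ (fun t => l t - l' t) unit_interval_connected.
move=> /(_ _ _ 0 1); rewrite /= !lexx !ler01 => H.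
have : l 0 - l' 0 = l 1 - l' 1.
  apply: H => // [t _|x y x0 y0]; first by apply: cvgB; [exact: lc|exact: lc'].
  by rewrite !cexpB !lf ?lf' ?lf // !divff // -lf //; exact: cexp_neq0.
by move=> h; apply/eqP; rewrite subr_eq -addrA (addrC (- _)) h addrC subrK.
Qed.

(** If f' stays so close to f that f' / f avoids the negative half-plane, adding
    clog (f' / f) turns a lift of f into a lift of f'. *)
Lemma lift_ratio (f f' l : R -> C) : continuous f -> continuous f' ->
  (forall t, 0 <= t <= 1 -> f t != 0) ->
  (forall t, 0 <= t <= 1 -> nrm (f' t / f t - 1) < 1) -> lift f l ->
  exists l', lift f' l' /\ forall t, 0 <= t <= 1 -> l' t = l t + clog (f' t / f t).
Proof.
move=> fc fc' f0 rat [lc lf].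
have ct t : 0 <= clip t <= 1 by rewrite clip_ge0 clip_le1.
exists (fun t => l t + clog (f' (clip t) / f (clip t))).
split; last by move=> t t01; rewrite clip_id.
split=> [t|t t01].
  apply: cvgD; first exact: lc.
  apply: cvg_clog; first exact/Re_near1/rat.
  apply: cvgM; first by apply: continuous_cvg; [exact: fc'|exact: clip_cts].
  by apply: cvgV; [exact: f0|apply: continuous_cvg; [exact: fc|exact: clip_cts]].
rewrite cexpD lf // clip_id // clogK; last exact/Re_near1/rat.
by rewrite mulrC divfK ?f0.
Qed.

Lemma clog_small (e : R) : 0 < e ->
  exists2 k : R, 0 < k <= 1 & forall z : C, nrm (z - 1) < k -> nrm (clog z) < e.
Proof.
move=> e0.
have cl : clog z @[z --> (1 : C)] --> (0 : C).
  by rewrite -(clog1 R); apply: (@cvg_clog R C (nbhs (1 : C)) _ id 1) => //=; exact: cvg_id.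
have := cvg_lt_nrm cl e0 => H.
have [k k0 kP] := (nbhs_nrm _ _).1 H.
exists (Num.min k 1); first by rewrite lt_min k0 ltr01 ge_min lexx orbT.
by move=> z; rewrite lt_min => /andP[/kP]; rewrite subr0.
Qed.

Section Family.
Variables (X : topologicalType) (A : set X) (F : X -> R -> C).
Hypothesis openA : open A.
Hypothesis F_cts : forall x t, A x ->
  F p.2 p.1 @[p --> ((t, x) : R * X)] --> F x t.
Hypothesis F_neq0 : forall x t, A x -> F x t != 0.

Lemma family_path_cts x : A x -> continuous (F x).
Proof.
move=> Ax t; have c : (t', x) @[t' --> t] --> ((t, x) : R * X).
  by apply: cvg_pair_at; [exact: cvg_id_at|exact: cvg_cst].
exact: cvg_comp_at c (@F_cts x t Ax).
Qed.

Lemma family_ratio x0 (e : R) : A x0 -> 0 < e ->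
  \forall x \near x0, forall t, 0 <= t <= 1 ->
    nrm (F x t / F x0 t - 1) < e /\ nrm (F x0 t / F x t - 1) < e.
Proof.
move=> Ax0 e0; apply: near_clip => t.
have c1 := @F_cts x0 t Ax0.
have c2 : F x0 p.1 @[p --> ((t, x0) : R * X)] --> F x0 t.
  by apply: continuous_cvg; [exact: family_path_cts|exact: cvg_fst_at].
have r1 : F p.2 p.1 / F x0 p.1 @[p --> ((t, x0) : R * X)] --> F x0 t / F x0 t.
  exact: (cvgM c1 (cvgV (F_neq0 t Ax0) c2)).
have r2 : F x0 p.1 / F p.2 p.1 @[p --> ((t, x0) : R * X)] --> F x0 t / F x0 t.
  exact: (cvgM c2 (cvgV (F_neq0 t Ax0) c1)).
rewrite (divff (F_neq0 t Ax0)) in r1 r2.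
have h1 := cvg_lt_nrm r1 e0.
have h2 := cvg_lt_nrm r2 e0.
have h3 : \forall p \near ((t, x0) : R * X), nrm (F p.2 p.1 / F x0 p.1 - 1) < e /\
    nrm (F x0 p.1 / F p.2 p.1 - 1) < e.
  exact: (filterI h1 h2).
exact: h3.
Qed.

Lemma family_lift x0 (e : R) : A x0 -> 0 < e -> \forall x \near x0,
  (forall l, lift (F x0) l -> exists2 l', lift (F x) l' &
     nrm ((l' 1 - l' 0) - (l 1 - l 0)) < e) /\
  (forall l, lift (F x) l -> exists l', lift (F x0) l').
Proof.
move=> Ax0 e0.
have [k /andP[k0 k1] kP] := @clog_small (e / 2) (divr_gt0 e0 (ltr0n _ 2)).
have H := family_ratio Ax0 k0.
have HA : \forall x \near x0, A x by exact: open_nbhs_nbhs.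
apply: filterS2 HA H => x Ax Hx.
split=> l lf.
  have [||] := lift_ratio (family_path_cts Ax0) (family_path_cts Ax) _ _ lf.
  - by move=> t _; exact: F_neq0.
  - by move=> t /Hx[h _]; exact: lt_le_trans k1.
  move=> l' [lf' l'E]; exists l' => //.
  rewrite !l'E ?lexx ?ler01 //.
  set a := clog _; set b := clog _.
  have -> : l 1 + a - (l 0 + b) - (l 1 - l 0) = a - b by ring.
  apply: le_lt_trans (nrmD _ _) _; rewrite nrmN.
  have := kP _ (Hx 1 _).1; have := kP _ (Hx 0 _).1.
  by rewrite !lexx !ler01 -/a -/b => /(_ isT) ? /(_ isT) ?; lra.
have [||l' [lf' _]] := lift_ratio (family_path_cts Ax) (family_path_cts Ax0) _ _ lf.
- by move=> t _; exact: F_neq0.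
- by move=> t /Hx[_ h]; exact: lt_le_trans k1.
by exists l'.
Qed.

End Family.

Lemma real_line_connected : connected [set: R].
Proof. by apply/connected_intervalP => x y _ _ z _. Qed.

(** The paths t |-> f (s t), s in R, join f to a constant path, and whether a
    path lifts is a locally constant property. *)
Lemma lift_exists (f : R -> C) : continuous f -> (forall t, f t != 0) ->
  exists l, lift f l.
Proof.
move=> fc f0; pose F (s t : R) := f (s * t).
have FE : forall s, (exists l, lift (F 0) l) = (exists l, lift (F s) l).
  move=> s.
  apply: (@locally_constant_connected R Prop setT (fun s => exists l, lift (F s) l)
    real_line_connected) => // x _.
  have Fc y t (_ : [set: R] y) : F p.2 p.1 @[p --> ((t, y) : R * R)] --> F y t.
    apply: continuous_cvg; first exact: fc.
    by apply: cvgM; [exact: cvg_snd_at|exact: cvg_fst_at].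
  have nx := @family_lift R setT F openT Fc (fun _ _ _ => f0 _) x 1 I ltr01.
  apply: (near_imply nx) => y [h1 h2] _.
  apply/propext; split=> [[l /h2//]|[l /h1[l' lf' _]]]; by exists l'.
have [w wf] := cexp_surj (f0 0).
have : exists l, lift (F 0) l.
  by exists (fun=> w); split=> [t|t _]; [exact: cvg_cst|rewrite /F mul0r].
by rewrite (FE 1) => -[l [lc lf]]; exists l; split; [exact: lc|move=> t t01; rewrite lf // /F mul1r].
Qed.

(** Along a homotopy with fixed end points the increments of the lifts vary
    continuously and stay in a translate of the discrete set 2 pi i Z. *)
Lemma homotopy_lift (H : R * R -> C) l0 l1 : continuous H -> (forall p, H p != 0) ->
  (forall s, H (s, 0) = H (0, 0)) -> (forall s, H (s, 1) = H (0, 1)) ->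
  lift (fun t => H (0, t)) l0 -> lift (fun t => H (1, t)) l1 ->
  l0 1 - l0 0 = l1 1 - l1 0.
Proof.
move=> Hc H0 Ha Hb ll0 ll1; pose F (s t : R) := H (s, t).
have Fc y t (_ : [set: R] y) : F p.2 p.1 @[p --> ((t, y) : R * R)] --> F y t.
  apply: continuous_cvg; first exact: Hc.
  by apply: cvg_pair_at; [exact: cvg_snd_at|exact: cvg_fst_at].
have Fl s : {l | lift (F s) l}.
  by apply: cid; apply: lift_exists; [exact: (family_path_cts Fc)|move=> t; exact: H0].
pose d s := projT1 (Fl s) 1 - projT1 (Fl s) 0.
have dE s l : lift (F s) l -> d s = l 1 - l 0.
  by move=> lF; apply: lift_unique lF; exact: projT2 (Fl s).
rewrite -(dE 0 l0) // -(dE 1 l1) //.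
apply: (@locally_constant_connected R C setT d real_line_connected) => // x _.
have nx := @family_lift R setT F openT Fc (fun _ _ _ => H0 _) x 2 I (ltr0n _ 2).
apply: (near_imply nx) => y [h _] _.
have [l ll dl] := h _ (projT2 (Fl x)).
apply/eqP; rewrite -subr_eq0; apply/eqP; apply: cexp_eq1; last by rewrite (dE y l).
rewrite (dE y l) // cexpB (cexpB (l 1)) /d cexpB.
have [_ hx] := projT2 (Fl x); have [_ hy] := ll.
rewrite !hx ?hy ?lexx ?ler01 // /F (Ha x) (Ha y) (Hb x) (Hb y) divff //.
by rewrite mulf_neq0 // invr_eq0.
Qed.

(** * Logarithm increments in planar regions *)

(** Simple connectedness for plane regions, with paths and homotopies defined on R
    and R * R, as the lifting lemmas have them. *)
Definition loops_contract (U : set C) := forall gamma : R -> C,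
  continuous gamma -> (forall t, U (gamma t)) -> gamma 0 = gamma 1 ->
  exists H : R * R -> C, [/\ continuous H, (forall p, U (H p)),
    (forall t, 0 <= t <= 1 -> H (0, t) = gamma t),
    (forall t, 0 <= t <= 1 -> H (1, t) = gamma 0) &
    (forall s, H (s, 0) = gamma 0 /\ H (s, 1) = gamma 0)].

Lemma loops_contractT : loops_contract setT.
Proof.
move=> gamma gc _ g01; exists (fun p => gamma p.2 + ((clip p.1)%:C : C) * (gamma 0 - gamma p.2)).
have c2 p : gamma q.2 @[q --> (p : R * R)] --> gamma p.2.
  by apply: continuous_cvg; [exact: gc|exact: cvg_snd_at].
split.
- move=> p; apply: cvgD; first exact: c2.
  apply: cvgM; last by apply: cvgB; [exact: cvg_cst|exact: c2].
  by apply: cvg_toC; exact: clip_fst_cts.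
- by [].
- by move=> t _ /=; rewrite clip_0 // mul0r addr0.
- by move=> t _ /=; rewrite clip_1 // mul1r addrC subrK.
- by move=> s /=; rewrite -g01 !subrr !mulr0 !addr0.
Qed.

Definition path_cat (g h : R -> C) (t : R) : C :=
  g (clip (2 * t)) + h (clip (2 * t - 1)) - g 1.

Lemma path_cat_cts g h : continuous g -> continuous h -> continuous (path_cat g h).
Proof.
move=> gc hc t.
have c2 : 2 * x @[x --> t] --> 2 * t by apply: cvgM; [exact: cvg_cst|exact: cvg_id_at].
have c1 : 2 * x - 1 @[x --> t] --> 2 * t - 1 by apply: cvgB; [exact: c2|exact: cvg_cst].
apply: cvgB; last exact: cvg_cst.
apply: cvgD; first exact: cvg_comp_at (cvg_comp_at c2 (@clip_cts _)) (gc _).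
exact: cvg_comp_at (cvg_comp_at c1 (@clip_cts _)) (hc _).
Qed.

Lemma path_catl g h t : g 1 = h 0 -> 2 * t <= 1 -> path_cat g h t = g (clip (2 * t)).
Proof.
move=> gh t1; rewrite /path_cat (@clip_0 (2 * t - 1)); last by lra.
by rewrite -gh addrK.
Qed.

Lemma path_catr g h t : 1 <= 2 * t -> path_cat g h t = h (clip (2 * t - 1)).
Proof. by move=> t1; rewrite /path_cat (@clip_1 (2 * t)) // addrAC subrr add0r. Qed.

Lemma path_cat0 g h : g 1 = h 0 -> path_cat g h 0 = g 0.
Proof. by move=> gh; rewrite path_catl // mulr0 ?ler01 // clip_0. Qed.

Lemma path_cat1 g h : path_cat g h 1 = h 1.
Proof. by rewrite path_catr ?clip_1 //; lra. Qed.

Lemma path_cat_in (U : set C) g h : g 1 = h 0 -> (forall t, U (g t)) ->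
  (forall t, U (h t)) -> forall t, U (path_cat g h t).
Proof.
move=> gh gU hU t; have [t1|t1] := leP (2 * t) 1; first by rewrite path_catl.
by rewrite path_catr // ltW.
Qed.

Definition path_in (U : set C) (a b : C) (g : R -> C) :=
  [/\ continuous g, (forall t, U (g t)), g 0 = a & g 1 = b].

Lemma path_in_cat U a b c g h : path_in U a b g -> path_in U b c h ->
  path_in U a c (path_cat g h).
Proof.
move=> [gc gU ga gb] [hc hU hb hd]; have gh : g 1 = h 0 by rewrite gb hb.
split; [exact: path_cat_cts|exact: path_cat_in|by rewrite path_cat0|by rewrite path_cat1].
Qed.

Lemma path_in_rev U a b g : path_in U a b g -> path_in U b a (fun t => g (1 - t)).
Proof.
move=> [gc gU ga gb]; split => [t|t||]; rewrite ?subr0 ?subrr //.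
have c1 : 1 - x @[x --> t] --> 1 - t by apply: cvgB; [exact: cvg_cst|exact: cvg_id_at].
exact: cvg_comp_at c1 (gc _).
Qed.

(** Being joined to a by a path in U is a locally constant property of points of
    U, as discs are convex. *)
Lemma open_connected_path (U : set C) a b : open U -> connected U -> U a -> U b ->
  exists g, path_in U a b g.
Proof.
move=> oU cU Ua Ub.
have -> : (exists g, path_in U a b g) = (exists g, path_in U a a g).
  apply: (locally_constant_connected (f := fun x => exists g, path_in U a x g) cU) => // x Ux.
  have [e e0 eU] := (open_nrm _).1 oU x Ux.
  apply/nbhs_nrm; exists e => // y xy Uy.
  have seg : path_in U x y (fun t => x + (clip t)%:C * (y - x)).
    split=> [t|t||].
    - apply: cvgD; first exact: cvg_cst.
      apply: cvgM; last exact: cvg_cst.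
      by apply: cvg_toC; exact: clip_cts.
    - apply: eU; rewrite addrAC subrr add0r nrmM nrm_pos ?clip_ge0 //.
      by apply: le_lt_trans xy; rewrite ler_piMl ?nrm_ge0 ?clip_le1.
    - by rewrite clip_0 // mul0r addr0.
    - by rewrite clip_1 // mul1r addrC subrK.
  apply/propext; split=> -[g gp].
    by exists (path_cat g (fun t => x + (clip (1 - t))%:C * (y - x))); exact: path_in_cat gp (path_in_rev seg).
  by exists (path_cat g (fun t => x + (clip t)%:C * (y - x))); exact: path_in_cat gp seg.
exists (fun=> a); split; [by move=> t; exact: cvg_cst|by []|by []|by []].
Qed.

(** A path followed by the reverse of another one with the same end points is a
    contractible loop, along which the logarithm of g has increment 0. *)
Lemma increment_unique (U : set C) (g : C -> C) a b h1 h2 l1 l2 :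
  loops_contract U -> (forall z, U z -> g w @[w --> z] --> g z) ->
  (forall z, U z -> g z != 0) ->
  path_in U a b h1 -> path_in U a b h2 ->
  lift (g \o h1) l1 -> lift (g \o h2) l2 -> l1 1 - l1 0 = l2 1 - l2 0.
Proof.
move=> lU gc g0 p1 p2 [lc1 lf1] [lc2 lf2].
have p2' := path_in_rev p2.
have [c1 U1 h10 h11] := p1.
have [c2 U2 h20 h21] := p2.
have [cc UU q0 q1] := path_in_cat p1 p2'.
have [H [Hc HU H0 H1 Hs]] := lU _ cc UU (etrans q0 (esym q1)).
pose G p := g (H p).
have Gc : continuous G by move=> p; exact: cvg_comp_at (Hc p) (gc _ (HU p)).
pose l0 := path_cat l1 (fun t => l2 (1 - t) - l2 1 + l1 1).
have lift0 : lift (fun t => G (0, t)) l0.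
  split.
    apply: path_cat_cts; first exact: lc1.
    move=> t; apply: cvgD; last exact: cvg_cst.
    apply: cvgB; last exact: cvg_cst.
    have c3 : 1 - x @[x --> t] --> 1 - t by apply: cvgB; [exact: cvg_cst|exact: cvg_id_at].
    exact: cvg_comp_at c3 (lc2 _).
  move=> t t01; rewrite /G H0 //.
  have ct s : 0 <= clip s <= 1 by rewrite clip_ge0 clip_le1.
  have ct' s : 0 <= 1 - clip s <= 1 by have := ct s; lra.
  have [t1|t1] := leP (2 * t) 1.
    by rewrite /l0 !path_catl ?subr0 ?h11 ?h21 ?lf1 //; ring.
  rewrite /l0 !path_catr ?(ltW t1) // cexpD cexpB lf1 ?lf2 ?lexx ?ler01 //=.
  by rewrite h11 h21 divfK // g0 // -h21.
have lift1 : lift (fun t => G (1, t)) (fun=> l1 0).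
  split=> [t|t t01]; first exact: cvg_cst.
  by rewrite lf1 ?lexx ?ler01 // /G H1 // q0 /= h10.
have Gs0 s : G (s, 0) = G (0, 0) by rewrite /G !(Hs _).1.
have Gs1 s : G (s, 1) = G (0, 1) by rewrite /G !(Hs _).2.
have := homotopy_lift Gc (fun p => g0 _ (HU p)) Gs0 Gs1 lift0 lift1.
rewrite subrr /l0 path_cat1 path_cat0; last by rewrite subr0; ring.
by rewrite subrr => h; apply/eqP; rewrite -subr_eq0 -h; apply/eqP; ring.
Qed.

(** Here d x is the increment of the logarithm of g x along any path from s0 x to
    s1 x in U x. It is continuous in x: a path for x0, sheared so as to join the
    moving end points s0 x and s1 x, stays in U x for x near x0. The parameter is
    a point of D in C_convex_log and a slope in tangent_plane_misses. *)
Theorem log_increment (X : topologicalType) (A : set X) (U : X -> set C)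
    (s0 s1 : X -> C) (g : X -> C -> C) :
  open A -> (forall x, A x -> connected (U x)) ->
  (forall x, A x -> loops_contract (U x)) ->
  (forall x z, A x -> U x z -> \forall x' \near x & z' \near z, U x' z') ->
  (forall x z, A x -> U x z -> g p.1 p.2 @[p --> ((x, z) : X * C)] --> g x z) ->
  (forall x z, A x -> U x z -> g x z != 0) ->
  (forall x, A x -> U x (s0 x) /\ U x (s1 x)) ->
  (forall x, A x -> s0 y @[y --> x] --> s0 x) ->
  (forall x, A x -> s1 y @[y --> x] --> s1 x) ->
  exists d : X -> C, (forall x, A x -> d y @[y --> x] --> d x) /\
    forall x, A x -> cexp (d x) = g x (s1 x) / g x (s0 x).
Proof.
move=> oA cU lU oU gc g0 sU s0c s1c.
have gxc x z : A x -> U x z -> g x w @[w --> z] --> g x z.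
  move=> Ax Uz.
  have c : (x, w) @[w --> z] --> ((x, z) : X * C).
    exact: (cvg_pair_at (f := fun=> x) (g := id) (cvg_cst_at x) (cvg_id_at z)).
  exact: cvg_comp_at c (gc _ _ Ax Uz).
have oUx x : A x -> open (U x).
  move=> Ax; rewrite openE => z Uz; have [[P Q] /= [Px Qz] PQ] := oU x z Ax Uz.
  apply: (near_imply (x := z) (P := Q) Qz) => w Qw; apply: (PQ (x, w)); split; last exact: Qw.
  exact: nbhs_singleton.
pose good x d := exists h l, [/\ path_in (U x) (s0 x) (s1 x) h, lift (g x \o h) l & d = l 1 - l 0].
have good_ex x : A x -> exists d, good x d.
  move=> Ax; have [Ua Ub] := sU x Ax.
  have [h hp] := open_connected_path (oUx x Ax) (cU x Ax) Ua Ub.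
  have [hc hU _ _] := hp.
  have [|t|l lf] := @lift_exists (g x \o h).
  - by move=> t; exact: cvg_comp_at (hc t) (gxc _ _ Ax (hU t)).
  - exact: g0.
  by exists (l 1 - l 0), h, l.
have good_uniq x d d' : A x -> good x d -> good x d' -> d = d'.
  move=> Ax [h [l [hp lf ->]]] [h' [l' [hp' lf' ->]]].
  by apply: increment_unique hp hp' lf lf'; [exact: lU|move=> z; exact: gxc|move=> z; exact: g0].
pose d x := if pselect (A x) is left Ax then projT1 (cid (good_ex x Ax)) else 0.
have dP x : A x -> good x (d x).
  by rewrite /d; case: pselect => // Ax _; exact: projT2 (cid (good_ex x Ax)).
exists d; split=> [x0 Ax0|x Ax]; last first.
  have [h [l [[_ _ h0 h1] [_ lf] ->]]] := dP x Ax.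
  by rewrite cexpB !lf ?lexx ?ler01 //= h0 h1.
have [h [l [hp [lc lf] dx0]]] := dP x0 Ax0.
have [hc hU h0 h1] := hp.
pose H x t : C := h (clip t) + (1 - (clip t)%:C) * (s0 x - s0 x0) + (clip t)%:C * (s1 x - s1 x0).
have Hx0 t : H x0 t = h (clip t) by rewrite /H !subrr !mulr0 !addr0.
have Hc x t : A x -> H p.2 p.1 @[p --> ((t, x) : R * X)] --> H x t.
  move=> Ax.
  have cc : ((clip p.1)%:C : C) @[p --> ((t, x) : R * X)] --> ((clip t)%:C : C).
    by apply: cvg_toC; exact: (@clip_fst_cts _ (t, x)).
  have c0 := cvg_comp_at (cvg_snd_at (t, x)) (s0c _ Ax).
  have c1 := cvg_comp_at (cvg_snd_at (t, x)) (s1c _ Ax).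
  have ch := cvg_comp_at (@clip_fst_cts _ (t, x)) (hc _).
  apply: cvgD; first apply: cvgD.
  - exact: ch.
  - exact: (cvgM (cvgB (cvg_cst_at (1 : C)) cc) (cvgB c0 (cvg_cst_at (s0 x0)))).
  - exact: (cvgM cc (cvgB c1 (cvg_cst_at (s1 x0)))).
have HU : \forall x \near x0, forall t, 0 <= t <= 1 -> U x (H x t).
  apply: near_clip => t.
  have Uh : U x0 (H x0 t) by rewrite Hx0.
  have cH : (p.2, H p.2 p.1) @[p --> ((t, x0) : R * X)] --> ((x0, H x0 t) : X * C).
    exact: cvg_pair_at (cvg_snd_at (t, x0)) (Hc x0 t Ax0).
  exact: cH _ (oU x0 _ Ax0 Uh).
pose B := interior [set x | A x /\ forall t, 0 <= t <= 1 -> U x (H x t)].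
have BA x : B x -> A x by move=> /nbhs_singleton[].
have BU x t : B x -> U x (H x t).
  move=> /nbhs_singleton[_ /(_ (clip t))]; rewrite /H [clip (clip t)]clip_id ?clip_ge0 ?clip_le1 //.
  exact.
have Bx0 : B x0 by apply: filterI HU; exact: open_nbhs_nbhs.
have FcB x t : B x -> g p.2 (H p.2 p.1) @[p --> ((t, x) : R * X)] --> g x (H x t).
  move=> Bx.
  have c : (p.2, H p.2 p.1) @[p --> ((t, x) : R * X)] --> ((x, H x t) : X * C).
    exact: cvg_pair_at (cvg_snd_at (t, x)) (Hc x t (BA _ Bx)).
  exact: cvg_comp_at c (gc _ _ (BA _ Bx) (BU _ t Bx)).
apply/cvg_nrm => e e0.
have nx := @family_lift X B (fun x t => g x (H x t)) (@open_interior _ _) FcB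
  (fun x t Bx => g0 _ _ (BA _ Bx) (BU x t Bx)) x0 e Bx0 e0.
have nB : \forall x \near x0, B x by apply: open_nbhs_nbhs; split => //; exact: open_interior.
apply: (near_imply2 nB nx) => x Bx [+ _] => /(_ l) [|l' lf' le].
  by split; [exact: lc|move=> t t01; rewrite lf //= Hx0 clip_id].
suff -> : d x = l' 1 - l' 0 by rewrite dx0.
apply: (good_uniq x) => //; [exact: BA|exact: dP (BA _ Bx)|].
exists (H x), l'; split; [split|exact: lf'|by []].
- move=> t; have c : (t', x) @[t' --> t] --> ((t, x) : R * X).
    by apply: cvg_pair_at; [exact: cvg_id_at|exact: cvg_cst].
  exact: cvg_comp_at c (Hc x t (BA _ Bx)).
- by move=> t; exact: BU.
- by rewrite /H clip_0 // h0 subr0 mul1r mul0r addr0 addrC subrK.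
- by rewrite /H clip_1 // h1 subrr mul0r addr0 mul1r addrC subrK.
Qed.

End Lifting.

(** * Logarithms on C-convex sets *)

Section Rows.
Variables (R : realType) (n : nat).
Local Notation C := (R[i]^o).
Local Notation V := ('rV[R[i]^o]_n).
Implicit Types v w : V.

Lemma nrm_rV_lt v (e : R) : 0 < e -> (forall i, nrm (v 0 i : C) < e) -> nrm v < e.
Proof.
move=> e0 h.
have b : ball (0 : V) e%:C v.
  split; first by rewrite ltcR.
  move=> i j; rewrite (ord1 i) mxE; rewrite -ball_normE /ball_ /= sub0r normrN normE ltcR.
  exact: h.
by move: b; rewrite -ball_normE /ball_ /= sub0r normrN normE ltcR.
Qed.

Lemma nrm_coord v i : nrm (v 0 i : C) <= nrm v.
Proof.
apply/ler_addgt0Pr => e e0.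
have b : ball (0 : V) ((nrm v + e)%:C) v.
  by rewrite -ball_normE /ball_ /= sub0r normrN normE ltcR; lra.
have [_ /(_ 0 i)] := b.
by rewrite -ball_normE /ball_ /= mxE sub0r normrN normE ltcR => /ltW.
Qed.

Lemma cvg_rV {T : Type} {F : set_system T} {FF : Filter F} (f : T -> V) v :
  (forall i, (f x 0 i : C) @[x --> F] --> (v 0 i : C)) -> f x @[x --> F] --> v.
Proof.
move=> h; apply/cvg_nrm => e e0.
have H : \forall x \near F, forall i, nrm (f x 0 i - v 0 i : C) < e.
  by apply: filter_forall => i; exact: cvg_lt_nrm (h i) e0.
apply: filterS H => x H; apply: nrm_rV_lt => // i.
by rewrite !mxE; exact: H.
Qed.

Lemma cvg_coord {T : Type} {F : set_system T} {FF : Filter F} (f : T -> V) v i :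
  f x @[x --> F] --> v -> (f x 0 i : C) @[x --> F] --> (v 0 i : C).
Proof.
move=> h; apply/cvg_nrm => e e0.
apply: filterS (cvg_lt_nrm h e0) => x; apply: le_lt_trans.
by have := nrm_coord (f x - v) i; rewrite !mxE.
Qed.

Lemma compact_disc (M : R) : compact [set z : C | nrm z <= M].
Proof.
have [M0|M0] := ltP M 0.
  have -> : [set z : C | nrm z <= M] = set0.
    by apply/seteqP; split=> z //= h; have := nrm_ge0 z; lra.
  exact: compact0.
have cK := compact_setX (@segment_compact R (- M) M) (@segment_compact R (- M) M).
have cf : continuous (fun p : R * R => p.1 +i* p.2 : C).
  by move=> p; apply: cvg_complex; [exact: cvg_fst_at|exact: cvg_snd_at].
apply: (subclosed_compact _ (continuous_compact (continuous_subspaceT cf) cK)).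
  rewrite (_ : [set _ | _] = (nrm : C -> R) @^-1` [set x | x <= M]) //.
  by apply: closed_comp (@closed_le R M) => z _; exact: nrm_cts.
move=> z /= zM; exists (complex.Re z, complex.Im z); last by case: (z).
have := Re_le z; have := Im_le z; rewrite /= !in_itv /= -!ler_norml; lra.
Qed.

Lemma compact_bounded (A : set V) (M : R) : closed A ->
  (forall v, A v -> nrm v <= M) -> compact A.
Proof.
move=> cA AM.
have K := @rV_compact C n (fun=> [set z : C | nrm z <= M]) (fun=> @compact_disc M).
by apply: (subclosed_compact cA K) => v Av i; apply: le_trans (nrm_coord v i) (AM _ Av).
Qed.

Lemma line_cts (a b : V) : continuous (fun l : C => a + l *: b).
Proof.
by move=> l; exact: (cvgD (cvg_cst_at a) (cvgZ (cvg_id_at l) (cvg_cst_at b))).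
Qed.

End Rows.

Arguments cvg_coord {R n T F FF f v} i.

Section Slices.
Variables (R : realType) (n : nat).
Local Notation C := (R[i]^o).
Local Notation V := ('rV[R[i]^o]_n).
Implicit Types (D : set V) (a b : V).

Lemma within_continuous_retract {X Y : topologicalType} (K : set X) (r : X -> X) (f : X -> Y) :
  continuous r -> (forall x, K (r x)) -> {within K, continuous f} -> continuous (f \o r).
Proof.
move=> rc Kr /subspace_continuousP fc x.
move=> A hA; have h : \forall z \near r x, K z -> A (f z) by exact: fc _ (Kr x) A hA.
have h2 : \forall y \near x, K (r y) -> A (f (r y)) by exact: near_cvg (rc x) h.
by apply: (near_imply h2) => y; apply; exact: Kr.
Qed.

(** The parameter l is a continuous function of the point a + l b, being an affine
    function of one of its coordinates; so the topological properties of the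
    intersection with the line pass to the set of parameters. *)
Lemma C_convex_slice D a b : C_convex D -> b != 0 -> (exists l : C, D (a + l *: b)) ->
  connected [set l : C | D (a + l *: b)] /\ loops_contract [set l : C | D (a + l *: b)].
Proof.
move=> cD b0 [l0 Dl0].
have [i bi0] : exists i, b 0 i != 0.
  apply: contrapT => h; move/eqP: b0; apply; apply/rowP => i; rewrite mxE.
  by apply/eqP; apply: contrapT => /negP bi; apply: h; exists i.
pose k (v : V) : C := (v 0 i - a 0 i) / b 0 i.
have kline l : k (a + l *: b) = l.
  by rewrite /k !mxE addrAC subrr add0r mulfK.
have linek v : complex_line a b v -> a + k v *: b = v.
  by move=> [l _ <-]; rewrite kline.
have kc : continuous k.
  move=> v; have vi : (fun w : V => w 0 i : C) @ v --> (v 0 i : C) by exact: coord_continuous.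
  exact: (cvgM (cvgB vi (cvg_cst_at (a 0 i : C))) (cvg_cst_at ((b 0 i)^-1 : C))).
have [|cL sL] := cD a b b0.
  by exists (a + l0 *: b); split => //; exists l0.
split.
  have := connected_continuous_connected cL (continuous_subspaceT kc).
  congr connected; apply/seteqP; split=> l /=.
    by move=> [v [Dv Lv] <-]; rewrite linek.
  by move=> Dl; exists (a + l *: b); rewrite ?kline //; split => //; exists l.
move=> gamma gc gU g01.
have [|||H [Hc HU H0 H1 Hs]] := sL (fun t => a + gamma t *: b).
- apply: continuous_subspaceT => t.
  exact: cvg_comp_at (gc t) (@line_cts R n a b (gamma t)).
- by move=> t _; split; [exact: gU|exists (gamma t)].
- by rewrite g01.
have cl t : clip t \in (`[0, 1] : interval R) by rewrite in_itv /= clip_ge0 clip_le1.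
exists (fun p => k (H (clip p.1, clip p.2))); split.
- have Hc' : continuous (H \o (fun p : R * R => (clip p.1, clip p.2))).
    apply: within_continuous_retract Hc => p.
      apply: cvg_pair_at; apply: continuous_cvg; try exact: clip_cts.
        exact: cvg_fst_at.
      exact: cvg_snd_at.
    by split; exact: cl.
  by move=> p; exact: cvg_comp_at (Hc' p) (kc _).
- move=> p; have [Dp Lp] := HU _ _ (cl p.1) (cl p.2).
  by rewrite /= linek.
- by move=> t t01; rewrite /= clip_0 // clip_id // H0 ?kline ?in_itv.
- by move=> t t01; rewrite /= clip_1 // (@clip_id _ t) // H1 ?kline ?in_itv.
- move=> s /=; have [h0 h1] := Hs _ (cl s).
  by rewrite (@clip_0 _ 0) // (@clip_1 _ 1) // h0 h1 !kline.
Qed.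

(** The value at z is continued from a base point z0 along the complex line through
    z0 and z, with parameter 0 at z0 and 1 at z. For z = z0 the line degenerates to
    a point and the region of parameters is the whole plane. *)
Theorem C_convex_log D (g : V -> C) : open D -> D !=set0 -> C_convex D ->
  (forall z, D z -> g w @[w --> z] --> g z) -> (forall z, D z -> g z != 0) ->
  exists L : V -> C, (forall z, D z -> L w @[w --> z] --> L z) /\
    forall z, D z -> cexp (L z) = g z.
Proof.
move=> oD [z0 Dz0] cD gc g0.
pose U (z : V) := [set l : C | D (z0 + l *: (z - z0))].
pose P (p : V * C) := z0 + p.2 *: (p.1 - z0).
have Pc : continuous P.
  move=> p.
  exact: (cvgD (cvg_cst_at z0) (cvgZ (cvg_snd_at p) (cvgB (cvg_fst_at p) (cvg_cst_at z0)))).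
have Uprop z : D z -> connected (U z) /\ loops_contract (U z).
  move=> Dz; have [->|zz0] := eqVneq z z0.
    have -> : U z0 = setT.
      by apply/seteqP; split=> // l _; rewrite /U /= subrr scaler0 addr0.
    split; last exact: loops_contractT.
    have -> : [set: C] = \bigcup_(r in [set: C]) [set t%:C * r | t in [set: R]].
      by apply/seteqP; split=> // r _; exists r => //; exists 1; rewrite ?mul1r.
    apply: bigcup_connected.
      by exists 0 => r _; exists 0; rewrite ?mul0r.
    move=> r _; apply: connected_continuous_connected; first exact: real_line_connected.
    apply: continuous_subspaceT => t; apply: cvgM; last exact: cvg_cst.
    by apply: cvg_toC; exact: cvg_id_at.
  apply: C_convex_slice => //; first by rewrite subr_eq0.
  by exists 0; rewrite scale0r addr0.
have [|||||||||d [dc dE]] := @log_increment R V D U (fun=> 0) (fun=> 1) (fun z l => g (P (z, l))).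
- exact: oD.
- by move=> z /Uprop[].
- by move=> z /Uprop[].
- move=> z l Dz Ul.
  have DU : \forall v \near P (z, l), D v by exact: open_nbhs_nbhs.
  by have := near_cvg (Pc (z, l)) DU.
- by move=> z l Dz Ul; exact: cvg_comp_at (Pc (z, l)) (gc _ Ul).
- by move=> z l Dz Ul; exact: g0.
- by move=> z Dz; split; rewrite /U /= ?scale0r ?scale1r ?addr0 // addrC subrK.
- by move=> z _; exact: (cvg_cst_at (F := nbhs z) (0 : C)).
- by move=> z _; exact: (cvg_cst_at (F := nbhs z) (1 : C)).
have [w0 w0E] := cexp_surj (g0 _ Dz0).
exists (fun z => w0 + d z); split=> z Dz.
  exact: (cvgD (cvg_cst_at w0) (dc z Dz)).
rewrite cexpD dE // w0E /P /= scale0r scale1r addr0 (addrC z0) subrK.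
by rewrite mulrC divfK // g0.
Qed.

End Slices.

Lemma near_eq_differentiable {K : numFieldType} {V W : normedModType K} (f g : V -> W) z :
  differentiable f z -> (\forall w \near z, g w = f w) -> differentiable g z.
Proof.
move=> df fg; have [dfc dfo] := (diff_locallyP _ _).1 df.
have fgz : g z = f z by exact: nbhs_singleton fg.
have go : g \o shift z = cst (g z) + 'd f z +o_ (0 : V) id.
  apply/eqaddoP => e e0.
  have fo := (eqaddoP _ _ _ _).1 dfo e e0.
  have fg0 : \forall h \near (0 : V), g (h + z) = f (h + z).
    by move: fg; rewrite (near_shift 0) /= subr0.
  apply: (near_imply2 fo fg0) => h hP hE; move: hP.
  by rewrite !fctE /= hE fgz.
have dE := diff_unique dfc go.
by apply/diff_locallyP; rewrite dE.
Qed.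

Section LogHolomorphic.
Variables (R : realType) (W : normedModType R[i]).
Local Notation C := (R[i]^o).

(** Locally, a continuous logarithm of g is a constant plus clog of a multiple of g. *)
Lemma log_branch_differentiable (L g : W -> C) (D : set W) : open D ->
  (forall z, D z -> L w @[w --> z] --> L z) -> (forall z, D z -> cexp (L z) = g z) ->
  holomorphic_on D g -> holomorphic_on D L.
Proof.
move=> oD Lc LE gd z Dz.
have gz0 : g z != 0 by rewrite -LE // cexp_neq0.
pose h w : C := g w / g z.
have hd : differentiable h z.
  by apply: (@differentiableM _ _ g (fun=> (g z)^-1)); [exact: gd|exact: differentiable_cst].
have hz : h z = 1 by rewrite /h divff.
have Dh : differentiable (fun w => L z + clog (h w)) z.
  have d1 : differentiable (@clog R) (h z) by rewrite hz; exact: differentiable_clog1.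
  exact: (differentiableD (differentiable_cst (L z) z) (differentiable_comp hd d1)).
(* near z both L and L z + clog (g / g z) are logarithms of g close to L z *)
have hc : h w @[w --> z] --> (1 : C).
  by rewrite -hz; exact: (differentiable_continuous hd).
have c1 : clog (h w) @[w --> z] --> (0 : C).
  by rewrite -(clog1 R); apply: cvg_clog => //=.
have near_eq : \forall w \near z, L w = L z + clog (h w).
  have n1 : \forall w \near z, D w by exact: open_nbhs_nbhs.
  have n2 := cvg_lt_nrm (Lc z Dz) ltr01.
  have n3 := cvg_lt_nrm c1 ltr01.
  have n4 := cvg_lt_nrm hc ltr01.
  near=> w.
  have Dw : D w by near: w.
  have w2 : nrm (L w - L z) < 1 by near: w.
  have w3 : nrm (clog (h w) - 0) < 1 by near: w.
  have w4 : nrm (h w - 1) < 1 by near: w.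
  apply/eqP; rewrite -subr_eq0; apply/eqP; apply: cexp_eq1.
    have gw0 : g w != 0 by rewrite -LE // cexp_neq0.
    by rewrite cexpB cexpD clogK ?Re_near1 // !LE // /h; field; rewrite gz0 gw0.
  rewrite opprD addrA; apply: le_lt_trans (nrmD _ _) _.
  by rewrite nrmN; move: w3; rewrite subr0; lra.
exact: near_eq_differentiable Dh near_eq.
Unshelve. all: by end_near. Qed.

End LogHolomorphic.

(** * Supporting complex hyperplanes *)

Section Euclid.
Variables (R : realType) (n : nat).
Local Notation C := (R[i]^o).
Local Notation V := ('rV[R[i]^o]_n).
Implicit Types v w z c a b : V.

(** Bilinear rather than Hermitian, so that dot . nu is a complex linear functional;
    the Hermitian product is z, w |-> dot z (cconj w). *)
Definition dot z w : C := \sum_i (z 0 i * w 0 i : C).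
Definition cconj w : V := \row_i ((w 0 i)^* : C).
Definition sqn z : R := \sum_i nrm (z 0 i : C) ^+ 2.

Lemma dotDl z w v : dot (z + w) v = dot z v + dot w v.
Proof. by rewrite /dot -big_split; apply: eq_bigr => i _; rewrite !mxE mulrDl. Qed.
Lemma dotZl (a : C) z v : dot (a *: z) v = a * dot z v.
Proof. by rewrite /dot big_distrr; apply: eq_bigr => i _; rewrite !mxE /= mulrA. Qed.
Lemma dotC z w : dot z w = dot w z.
Proof. by apply: eq_bigr => i _; rewrite mulrC. Qed.
Lemma dotBl z w v : dot (z - w) v = dot z v - dot w v.
Proof. by rewrite dotDl -scaleN1r dotZl mulN1r. Qed.
Lemma dot0l v : dot 0 v = 0. Proof. by rewrite -(scale0r 0) dotZl mul0r. Qed.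
Lemma dotDr z w v : dot v (z + w) = dot v z + dot v w.
Proof. by rewrite !(dotC v) dotDl. Qed.
Lemma dotZr (a : C) z v : dot v (a *: z) = a * dot v z.
Proof. by rewrite !(dotC v) dotZl. Qed.
Lemma cconjD z w : cconj (z + w) = cconj z + cconj w.
Proof. by apply/rowP => i; rewrite !mxE rmorphD. Qed.
Lemma cconjZ (a : C) z : cconj (a *: z) = (a^* : C) *: cconj z.
Proof. by apply/rowP => i; rewrite !mxE rmorphM. Qed.
Lemma cconjK z : cconj (cconj z) = z.
Proof. by apply/rowP => i; rewrite !mxE conjcK. Qed.

Lemma dot_conj z w : dot (cconj z) w = ((dot z (cconj w))^* : C).
Proof.
rewrite /dot rmorph_sum; apply: eq_bigr => i _.
by rewrite !mxE rmorphM /= conjcK.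
Qed.

Lemma nrm2_conj (z : C) : ((nrm z ^+ 2)%:C : C) = z * z^*.
Proof. by rewrite rmorphXn /= -normE sqr_normc. Qed.

Lemma sqnE z : ((sqn z)%:C : C) = dot z (cconj z).
Proof. rewrite /sqn rmorph_sum; apply: eq_bigr => i _; rewrite mxE; exact: nrm2_conj. Qed.

Lemma sqn_ge0 z : 0 <= sqn z.
Proof. by apply: sumr_ge0 => i _; exact: sqr_ge0. Qed.

Lemma sqn_coord z i : nrm (z 0 i : C) ^+ 2 <= sqn z.
Proof. by rewrite /sqn (bigD1 i) //= lerDl sumr_ge0 // => j _; exact: sqr_ge0. Qed.

Lemma sqn_gt0 z : z != 0 -> 0 < sqn z.
Proof.
move=> z0; have [i zi] : exists i, z 0 i != 0.
  apply: contrapT => h; move/eqP: z0; apply; apply/rowP => i; rewrite mxE.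
  by apply/eqP; apply: contrapT => /negP bi; apply: h; exists i.
apply: lt_le_trans (sqn_coord z i); rewrite exprn_gt0 //.
by rewrite nrm_gt0.
Qed.

Lemma sqn_orth (al be : C) v c : dot v (cconj c) = 0 ->
  sqn (al *: v + be *: c) = nrm al ^+ 2 * sqn v + nrm be ^+ 2 * sqn c.
Proof.
move=> vc; apply: complexI.
have cv : dot c (cconj v) = 0.
  by rewrite dotC dot_conj -(conjc0 R) -vc; congr (_ ^*); rewrite cconjK dotC.
have -> : ((nrm al ^+ 2 * sqn v + nrm be ^+ 2 * sqn c)%:C : C) =
    (al * al^*) * dot v (cconj v) + (be * be^*) * dot c (cconj c).
  by rewrite -!sqnE -!nrm2_conj rmorphD !rmorphM.
rewrite [LHS]sqnE cconjD !cconjZ dotDl !dotDr !dotZl !dotZr vc cv; ring.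
Qed.

Lemma sqn_small z (e : R) : 0 < e -> sqn z < e ^+ 2 -> nrm z < e.
Proof.
move=> e0 h; apply: nrm_rV_lt => // i.
rewrite -(@ltr_pXn2r _ 2) ?nnegrE ?nrm_ge0 ?(ltW e0) //.
exact: le_lt_trans (sqn_coord z i) h.
Qed.

Lemma cvg_sum_at {T : Type} {F : set_system T} {FF : Filter F} {W : normedModType R[i]}
    (I : Type) (r : seq I) (f : I -> T -> W) (l : I -> W) :
  (forall i, f i x @[x --> F] --> l i) ->
  \sum_(i <- r) f i x @[x --> F] --> \sum_(i <- r) l i.
Proof.
move=> h; elim: r => [|i r IH].
  by rewrite big_nil; under eq_fun do rewrite big_nil; exact: (cvg_cst_at (0 : W)).
rewrite big_cons; under eq_fun do rewrite big_cons.
exact: (cvgD (h i) IH).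
Qed.

Lemma cvg_dot {T : Type} {F : set_system T} {FF : Filter F} (f g : T -> V) v w :
  f x @[x --> F] --> v -> g x @[x --> F] --> w -> dot (f x) (g x) @[x --> F] --> dot v w.
Proof.
move=> fv gw; apply: cvg_sum_at => i.
exact: (cvgM (cvg_coord i fv) (cvg_coord i gw)).
Qed.

Lemma cvg_cconj {T : Type} {F : set_system T} {FF : Filter F} (f : T -> V) v :
  f x @[x --> F] --> v -> cconj (f x) @[x --> F] --> cconj v.
Proof.
move=> fv; apply: cvg_rV => i; rewrite mxE; under eq_fun do rewrite mxE.
exact: cvg_conj (cvg_coord i fv).
Qed.

Lemma cvg_sqn {T : Type} {F : set_system T} {FF : Filter F} (f : T -> V) v :
  f x @[x --> F] --> v -> sqn (f x) @[x --> F] --> sqn v.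
Proof.
move=> fv; have := @cvg_Re R T F FF _ _ (cvg_dot fv (cvg_cconj fv)); rewrite -sqnE /=.
have E x : complex.Re (dot (f x) (cconj (f x))) = sqn (f x) by rewrite -sqnE.
by under eq_fun do rewrite E; move=> h; exact: h.
Qed.

Lemma cconj_eq0 z : (cconj z == 0) = (z == 0).
Proof.
apply/eqP/eqP => [h|->]; last by apply/rowP => i; rewrite !mxE conjc0.
by rewrite -(cconjK z) h; apply/rowP => i; rewrite !mxE conjc0.
Qed.

End Euclid.

Section Support.
Variables (R : realType) (n : nat).
Local Notation C := (R[i]^o).
Local Notation V := ('rV[R[i]^o]_n).
Implicit Types v w z c a b : V.

(** Suppose that the complex tangent plane at a of the ball around c meets D at a + v.
    For small eta the line through a and a + v + eta (c - a) carries two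
    distinguished points of D: the orthogonal projection of c, at parameter
    conj(eta) k with k > 0, and a + v + eta (c - a), at parameter 1. The
    increments of the logarithm of the line parameter between them would be a
    continuous branch of - log (conj(eta) k) on a punctured disc. *)
Lemma tangent_plane_misses (D : set V) c a : open D -> C_convex D ->
  (forall z, sqn (z - c) < sqn (a - c) -> D z) -> ~ D a -> a != c ->
  forall z, D z -> dot (z - a) (cconj (c - a)) != 0.
Proof.
move=> oD cD ballD nDa ac p Dp; apply/negP => /eqP orth.
pose v : V := p - a; pose u : V := c - a.
have u0 : u != 0 by rewrite subr_eq0 eq_sym.
have qu : 0 < sqn u by exact: sqn_gt0.
have v0 : v != 0.
  by apply/eqP => /eqP; rewrite subr_eq0 => /eqP pa; apply: nDa; rewrite -pa.
have qv : 0 < sqn v by exact: sqn_gt0.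
have acu : sqn (a - c) = sqn u.
  have := @sqn_orth R n 0 (-1) 0 u; rewrite dot0l => /(_ erefl).
  by rewrite scaler0 add0r scaleN1r opprB nrm0 nrmN nrm1 expr0n mul0r add0r expr1n mul1r.
pose k (eta : C) : R := sqn u / (sqn v + nrm eta ^+ 2 * sqn u).
have dpos (eta : C) : 0 < sqn v + nrm eta ^+ 2 * sqn u.
  by apply: ltr_wpDr => //; rewrite mulr_ge0 ?sqr_ge0 ?ltW.
have kpos (eta : C) : 0 < k eta by rewrite divr_gt0.
pose dir (eta : C) : V := v + eta *: u.
have dirE (eta : C) : dir eta = 1 *: v + eta *: u by rewrite scale1r.
have dir0 (eta : C) : dir eta != 0.
  apply/eqP => h; have := @sqn_orth R n 1 eta v u orth.
  rewrite -dirE h nrm1 expr1n mul1r => h2; have := dpos eta.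
  by rewrite -h2 /sqn big1 ?ltxx // => i _; rewrite mxE nrm0 expr0n.
pose s0 (eta : C) : C := (eta^*) * (k eta)%:C.
have Ds0 (eta : C) : eta != 0 -> D (a + s0 eta *: dir eta).
  move=> eta0; apply: ballD; rewrite acu.
  have en : 0 < nrm eta ^+ 2 by rewrite exprn_gt0 // nrm_gt0.
  have -> : a + s0 eta *: dir eta - c = s0 eta *: v + (s0 eta * eta - 1) *: u.
    by rewrite /dir scalerDr scalerA scalerBl scale1r /u; apply/rowP => i; rewrite !mxE; ring.
  rewrite sqn_orth //.
  have -> : s0 eta * eta = (nrm eta ^+ 2 * k eta)%:C.
    by rewrite rmorphM /= nrm2_conj /s0; ring.
  have -> : ((nrm eta ^+ 2 * k eta)%:C - 1 : C) = ((nrm eta ^+ 2 * k eta - 1)%:C : C).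
    by rewrite rmorphB.
  rewrite nrm_real /s0 nrmM nrm_conj nrm_pos ?(ltW (kpos _)) // exprMn real_normK ?num_real //.
  set x := nrm eta ^+ 2 in en *; have kE : k eta * (sqn v + x * sqn u) = sqn u.
    by rewrite /k divfK // gt_eqF // dpos.
  have := kpos eta; move: (k eta) kE => K kE K0.
  have h : x * K * sqn u > 0 by apply: mulr_gt0 => //; exact: mulr_gt0.
  have -> : x * K ^+ 2 * sqn v + (x * K - 1) ^+ 2 * sqn u =
    x * K * (K * (sqn v + x * sqn u)) - 2 * (x * K * sqn u) + sqn u by ring.
  by rewrite kE; lra.
pose A := [set eta : C | eta != 0 /\ D (a + dir eta)].
pose U (eta : C) := [set t : C | D (a + t *: dir eta)].
have dirc (eta : C) : dir e @[e --> eta] --> dir eta.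
  exact: (cvgD (cvg_cst_at v) (cvgZ (cvg_id_at eta) (cvg_cst_at u))).
have oA : open A.
  rewrite openE => eta [eta0 De].
  have n1 : \forall e \near eta, D (a + dir e).
    have c1 : a + dir e @[e --> eta] --> a + dir eta.
      exact: (cvgD (cvg_cst_at a) (dirc eta)).
    by apply: (near_cvg c1); exact: open_nbhs_nbhs.
  have n2 : \forall e \near eta, nrm ((e : C) - eta) < nrm eta.
    by apply: near_nrm; rewrite nrm_gt0.
  apply: (near_imply2 n1 n2) => e h1 h2; split => //.
  by apply/eqP => e0; move: h2; rewrite e0 sub0r nrmN ltxx.
have [|||||||||d [dc dE]] := @log_increment R C A U s0 (fun=> 1) (fun _ t => t).
- exact: oA.
- by move=> e [_ De]; have [] := C_convex_slice cD (dir0 e) (ex_intro _ 1 (eq_rect_r D De (congr1 (+%R a) (scale1r (dir e))))).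
- by move=> e [_ De]; have [] := C_convex_slice cD (dir0 e) (ex_intro _ 1 (eq_rect_r D De (congr1 (+%R a) (scale1r (dir e))))).
- move=> e t Ae Ut.
  have c1 : a + q.2 *: dir q.1 @[q --> ((e, t) : C * C)] --> a + t *: dir e.
    exact: (cvgD (cvg_cst_at a) (cvgZ (cvg_snd_at (e, t)) (cvg_comp_at (cvg_fst_at (e, t)) (dirc e)))).
  have DU : \forall z \near (a + t *: dir e), D z by exact: open_nbhs_nbhs.
  exact: near_cvg c1 DU.
- by move=> e t _ _; exact: (cvg_snd_at (e, t)).
- by move=> e t _ Ut; apply/eqP => t0; apply: nDa; move: Ut; rewrite /U /= t0 scale0r addr0.
- move=> e [e0 De]; split; first exact: Ds0.
  by rewrite /U /= scale1r.
- move=> e [e0 De].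
  have c1 : (fun x : C => x^* : C) @ e --> (e^* : C) by exact: cvg_conj (cvg_id_at e).
  have c2 : (fun x : C => nrm x) @ e --> nrm e by exact: cvg_nrmf (cvg_id_at e).
  have c4 : (fun x : C => nrm x ^+ 2) @ e --> nrm e ^+ 2 by exact: (cvgM c2 c2).
  have c3 : k x @[x --> e] --> k e.
    exact: (cvgM (cvg_cst_at (sqn u)) (cvgV (lt0r_neq0 (dpos e)) (cvgD (cvg_cst_at (sqn v)) (cvgM c4 (cvg_cst_at (sqn u)))))).
  exact: (cvgM c1 (cvg_toC c3)).
- by move=> e _; exact: (cvg_cst_at (F := nbhs e) (1 : C)).
have [r r0 rA] : exists2 r : R, 0 < r & forall e : C, nrm e = r -> A e.
  have c1 : a + dir e @[e --> (0 : C)] --> a + dir 0.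
    exact: (cvgD (cvg_cst_at a) (dirc 0)).
  have D0 : D (a + dir 0) by rewrite /dir scale0r addr0 /v addrC subrK.
  have DU : \forall z \near (a + dir 0), D z by exact: open_nbhs_nbhs.
  have [e e0 eP] := (nbhs_nrm _ _).1 (near_cvg c1 DU).
  exists (e / 2) => [|f fe]; first lra.
  split; first by rewrite -nrm_gt0 fe; lra.
  by apply: eP; rewrite subr0 fe; lra.
pose E (t : R) : C := r%:C * cexp (- (t *i)).
have nE t : nrm (E t) = r.
  by rewrite nrmM nrm_cexp /= oppr0 expR0 mulr1 nrm_pos // ltW.
have AE t : A (E t) by apply: rA; exact: nE.
pose m (t : R) : C := d (E t) + t *i.
have ic (t : R) : (x *i : C) @[x --> t] --> (t *i : C).
  by apply: cvg_complex; [exact: cvg_cst|exact: cvg_id_at].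
have Ec t : E x @[x --> t] --> E t.
  exact: (cvgM (cvg_cst_at (r%:C : C)) (cvg_cexp (cvgN (ic t)))).
have mc t : m x @[x --> t] --> m t.
  exact: (cvgD (cvg_comp_at (Ec t) (dc _ (AE t))) (ic t)).
have mE t : cexp (m t) = ((r * (sqn u / (sqn v + r ^+ 2 * sqn u)))%:C : C)^-1.
  rewrite /m cexpD dE // div1r.
  have cE : (E t)^* = r%:C * cexp (t *i) :> C.
    by apply: complexP; rewrite /E /cexp /= oppr0 expR0 cosN sinN; ring.
  have -> : s0 (E t) = r%:C * cexp (t *i) * ((sqn u / (sqn v + r ^+ 2 * sqn u))%:C : C).
    by rewrite /s0 /k nE; congr (_ * _); exact: cE.
  have := cexp_neq0 (t *i : C); move: (cexp _) => e e0.
  have -> : ((r * (sqn u / (sqn v + r ^+ 2 * sqn u)))%:C : C) =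
    r%:C * ((sqn u / (sqn v + r ^+ 2 * sqn u))%:C : C) by rewrite rmorphM.
  by rewrite mulrAC (invfM _ e) -mulrA mulVf ?mulr1.
have := @cexp_const_connected R _ setT m (@real_line_connected R).
move=> /(_ (fun t _ => mc t) (fun s t _ _ => etrans (mE s) (esym (mE t))) 0 (2 * pi) I I).
rewrite /m.
have -> : E (2 * pi) = E 0.
  rewrite /E; congr (_ * _); rewrite !cexpN; congr (_^-1).
  by have := @cexp_2pi R 0; rewrite add0r => ->; congr cexp; exact: complexP.
move/addrI => /(congr1 (@complex.Im R)) /= h.
by have := pi_gt0 R; lra.
Qed.

Lemma nearest_point (D : set V) c a : open D -> ~ D a ->
  exists b, [/\ ~ D b, sqn (b - c) <= sqn (a - c) &
    forall z, sqn (z - c) < sqn (b - c) -> D z].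
Proof.
move=> oD nDa.
pose K := (~` D) `&` [set z | sqn (z - c) <= sqn (a - c)].
have fc z : sqn (w - c) @[w --> z] --> sqn (z - c).
  exact: (cvg_sqn (cvgB (cvg_id_at z) (cvg_cst_at c))).
have cK : closed K.
  apply: closedI; first exact: open_closedC.
  rewrite (_ : [set _ | _] = (fun z : V => sqn (z - c)) @^-1` [set x | x <= sqn (a - c)]) //.
  by apply: closed_comp (@closed_le R _) => z _; exact: fc.
have compK : compact K.
  apply: (@compact_bounded R n K (sqn (a - c) + 1 + nrm c)) => // z [_ /= zc].
  have := nrm_tri z c 0; rewrite !subr0 => h; apply: le_trans h _.
  rewrite lerD2r; apply: ltW; apply: sqn_small; first by have := sqn_ge0 (a - c); lra.
  apply: le_lt_trans zc _; have := sqn_ge0 (a - c); nra.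
have [||b Kb bmin] := @compact_EVT_min V R (fun z => sqn (z - c)) K _ compK.
- by exists a; split=> /=.
- by apply: continuous_subspaceT => z; exact: fc.
move: Kb; rewrite inE => -[nDb bc]; exists b; split => // z zb.
apply: contrapT => nDz.
have Kz : z \in K by rewrite inE; split => //=; apply: le_trans (ltW zb) bc.
by have := bmin z Kz; rewrite leNgt zb.
Qed.

(** Boundary points touched by balls in D are dense in the boundary, and through
    each of them passes a complex hyperplane missing D. The hyperplanes through a
    form a compact family, normalised by nrm nu = 1: if all of them met D, so would
    all hyperplanes through the points near a. *)
Theorem supporting_hyperplane (D : set V) a : open D -> C_convex D ->
  closure D a -> ~ D a ->
  exists nu : V, nu != 0 /\ forall z, D z -> dot (z - a) nu != 0.
Proof.
move=> oD cD clDa nDa; apply: contrapT => nosup.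
pose S := [set nu : V | nrm nu = 1].
have compS : compact S.
  apply: (@compact_bounded R n S 1) => [|v /= -> //].
  rewrite (_ : S = (fun v : V => nrm v) @^-1` [set x | x = 1]) //.
  by apply: closed_comp (@closed_eq R 1) => z _; exact: nrm_cts.
have H : \forall b \near a, S `<=` [set nu | exists2 z, D z & dot (z - b) nu = 0].
  apply: ((compact_near_coveringP S).1 compS V (nbhs a)
    (fun b nu => exists2 z, D z & dot (z - b) nu = 0)) => nu Snu.
  have nu0 : nu != 0 by rewrite -nrm_gt0 Snu ltr01.
  have [z Dz zE] : exists2 z, D z & dot (z - a) nu = 0.
    apply: contrapT => h; apply: nosup; exists nu; split => // z Dz.
    by apply/eqP => zE; apply: h; exists z.
  pose w := cconj nu.
  have wn : dot w nu != 0.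
    rewrite /w dotC -sqnE; apply/eqP => h; have := sqn_gt0 nu0.
    by rewrite (complexI h : sqn nu = 0) ltxx.
  pose f (p : V * V) : V := z - (dot (z - p.2) p.1 / dot w p.1) *: w.
  have c2 : (fun p : V * V => dot w p.1) @ ((nu, a) : V * V) --> dot w nu.
    exact: cvg_dot (cvg_cst_at w) (cvg_fst_at ((nu, a) : V * V)).
  have fc : f p @[p --> ((nu, a) : V * V)] --> f (nu, a).
    have c1 : (fun p : V * V => dot (z - p.2) p.1) @ ((nu, a) : V * V) --> dot (z - a) nu.
      exact: cvg_dot (cvgB (cvg_cst_at z) (cvg_snd_at ((nu, a) : V * V))) (cvg_fst_at ((nu, a) : V * V)).
    exact: (cvgB (cvg_cst_at z) (cvgZ (cvgM c1 (cvgV wn c2)) (cvg_cst_at w))).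
  have fz : f (nu, a) = z by rewrite /f /= zE mul0r scale0r subr0.
  have n1 : \forall p \near ((nu, a) : V * V), D (f p).
    by apply: (near_cvg fc); apply: open_nbhs_nbhs; rewrite fz.
  have n2 : \forall p \near ((nu, a) : V * V), dot w p.1 != 0.
    have wn0 : 0 < nrm (dot w nu) by rewrite nrm_gt0.
    apply: (near_imply (cvg_lt_nrm c2 wn0)) => p; apply: contraTneq => ->.
    by rewrite sub0r nrmN ltxx.
  have n3 : \forall p \near ((nu, a) : V * V), exists2 z, D z & dot (z - p.2) p.1 = 0.
    apply: (near_imply2 n1 n2) => p Dp wp; exists (f p) => //.
    have -> : f p - p.2 = (z - p.2) - (dot (z - p.2) p.1 / dot w p.1) *: w by rewrite /f addrAC.
    by rewrite (dotBl (z - p.2)) dotZl divfK ?subrr.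
  exact: n3.
have [e e0 eH] := (nbhs_nrm _ _).1 H.
have [k k0 kP] : exists2 k : R, 0 < k & forall z, nrm (z - a) < k -> sqn (a - z) < (e / 2) ^+ 2.
  have c1 : sqn (a - z) @[z --> a] --> sqn (a - a).
    exact: (cvg_sqn (cvgB (cvg_cst_at a) (cvg_id_at a))).
  have s0 : sqn (a - a) = 0.
    by rewrite subrr /sqn big1 // => i _; rewrite mxE nrm0 expr0n.
  have e2 : sqn (a - a) < (e / 2) ^+ 2 by rewrite s0 exprn_gt0 //; lra.
  have h : \forall z \near a, sqn (a - z) < (e / 2) ^+ 2.
    exact: cvgr_lt c1 _ e2.
  by have [k k0 kP] := (nbhs_nrm _ _).1 h; exists k.
have [c [Dc ca]] : exists c, D c /\ nrm (c - a) < Num.min k (e / 2).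
  have m0 : 0 < Num.min k (e / 2) by rewrite lt_min k0; lra.
  by have [c [? ?]] := clDa _ (near_nrm a m0); exists c.
move: ca; rewrite lt_min => /andP[/kP ca1 ca2].
have [b [nDb bc ball]] := nearest_point c oD nDa.
have bcc : b != c by apply/eqP => h; apply: nDb; rewrite h.
have bne : nrm (b - a) < e.
  have := nrm_tri b c a; have : nrm (b - c) < e / 2.
    by apply: sqn_small; [lra|exact: le_lt_trans bc ca1].
  lra.
pose nu := cconj (c - b).
have nu0 : nu != 0 by rewrite cconj_eq0 subr_eq0 eq_sym.
pose nu1 := ((nrm nu)^-1%:C : C) *: nu.
have S1 : S nu1.
  by rewrite /S /= nrmZ nrm_pos ?invr_ge0 ?nrm_ge0 // mulVf // nrm_eq0.
have [z Dz] := eH _ bne _ S1.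
rewrite dotZr => /eqP; rewrite mulf_eq0 => /orP[|]; last first.
  by apply/negP; exact: (tangent_plane_misses oD cD ball nDb bcc Dz).
move=> /eqP/(congr1 (@complex.Re R)) /= /eqP.
by rewrite invr_eq0 nrm_eq0 (negbTE nu0).
Qed.

End Support.

(** * Logarithms of affine functionals *)

Section Functionals.
Variables (R : realType) (n : nat).
Local Notation C := (R[i]^o).
Local Notation V := ('rV[R[i]^o]_n).
Implicit Types (D : set V) (v w z a b nu : V).

Definition omits_value D nu := exists k : C, forall z, D z -> dot z nu != k.

(** On the real segment from z0 to a point outside D, membership of D would
    otherwise be locally constant. *)
Lemma line_leaves D z0 b (l0 : C) : open D -> D z0 -> ~ D (z0 + l0 *: b) ->
  exists l : C, closure D (z0 + l *: b) /\ ~ D (z0 + l *: b).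
Proof.
move=> oD Dz0 nD; apply: contrapT => H.
pose p (t : R) : V := z0 + (t%:C * l0) *: b.
have pc t : p x @[x --> t] --> p t.
  have c1 : (fun x : R => x%:C : C) @ t --> (t%:C : C) by exact: cvg_toC (cvg_id_at t).
  exact: (cvgD (cvg_cst_at z0) (cvgZ (cvgM c1 (cvg_cst_at l0)) (cvg_cst_at b))).
have E : D (p 0) = D (p 1).
  apply: (@locally_constant_connected R Prop setT (fun t => D (p t)) (@real_line_connected R)) => // t _.
  have [Dt|nDt] := pselect (D (p t)).
    have n1 : \forall x \near t, D (p x) by apply: (near_cvg (pc t)); exact: open_nbhs_nbhs.
    by apply: (near_imply n1) => x Dx _; apply/propext.
  have ncl : ~ closure D (p t) by move=> cl; apply: H; exists (t%:C * l0).
  have n2 : \forall x \near t, (~` closure D) (p x).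
    by apply: (near_cvg (pc t)); apply: open_nbhs_nbhs; split => //; exact/closed_openC/closed_closure.
  by apply: (near_imply n2) => x nx _; apply/propext; split => // Dx; case: nx; exact: subset_closure.
move: E; rewrite /p mul0r scale0r addr0 mul1r => E.
by apply: nD; rewrite -E.
Qed.

(** A line in the direction b through a point of D leaves D at a boundary point. A
    hyperplane through that point which misses D cannot contain the line. *)
Lemma functional_separates D b : domain D -> C_convex D ->
  ~ contains_complex_line D -> b != 0 -> exists nu, omits_value D nu /\ dot b nu != 0.
Proof.
move=> [oD _ [z0 Dz0]] cD nl b0.
have [l0 nD0] : exists l0 : C, ~ D (z0 + l0 *: b).
  apply: contrapT => h; apply: nl; exists z0, b; split => // v [l _ <-].
  by apply: contrapT => nDl; apply: h; exists l.
have [l [cl nDa]] := line_leaves oD Dz0 nD0.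
have [nu [nu0 H]] := supporting_hyperplane oD cD cl nDa.
exists nu; split.
  exists (dot (z0 + l *: b) nu) => z /H; rewrite dotBl.
  by apply: contra_neq => ->; rewrite subrr.
have := H z0 Dz0; apply: contra_neq => h.
by rewrite dotBl dotDl dotZl h mulr0 addr0 subrr.
Qed.

(** As long as the functionals found so far have a common zero b != 0, one that
    does not vanish at b can be added. *)
Lemma independent_functionals D : domain D -> C_convex D ->
  ~ contains_complex_line D ->
  exists (M : 'M[R[i]^o]_n) (k : 'I_n -> C), M \in unitmx /\
    forall z j, D z -> dot z (row j M) != k j.
Proof.
move=> dD cD nl.
have step m : (m <= n)%N -> exists F : 'M[R[i]^o]_(m, n), row_free F /\
    forall i, omits_value D (row i F).
  elim: m => [_|m IH mn].
    by exists 0; split=> [|[]//]; rewrite /row_free mxrank0.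
  have [F [Ffree FN]] := IH (ltnW mn).
  have [b b0 bF] : exists2 b : V, b != 0 & b *m F^T = 0.
    have kn : kermx F^T != 0.
      rewrite kermx_eq0 /row_free mxrank_tr; apply/eqP => h.
      by have := rank_leq_row F; rewrite h leqNgt mn.
    exists (nz_row (kermx F^T)); first by rewrite nz_row_eq0.
    by apply/sub_kermxP; exact: nz_row_sub.
  have [nu [nuN bnu]] := functional_separates dD cD nl b0.
  exists (col_mx nu F); split; last first.
    move=> i; rewrite -(@fintype.splitK 1 m i); case: (@fintype.split 1 m i) => j /=.
      have -> : row (lshift m j) (col_mx nu F) = nu by rewrite rowKu row_id.
      exact: nuN.
    have -> : row (rshift 1 j) (col_mx nu F) = row j F by rewrite rowKd.
    exact: FN.
  have FnuF : (F < col_mx nu F)%MS.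
    rewrite /ltmx -!addsmxE addsmxSr addsmx_sub submx_refl andbT /=.
    apply/negP => /submxP[y yE]; move/eqP: bnu; apply.
    have -> : dot b nu = (b *m nu^T) 0 0.
      by rewrite mxE; apply: eq_bigr => i _; rewrite mxE.
    by rewrite yE trmx_mul mulmxA bF mul0mx mxE.
  rewrite /row_free eqn_leq rank_leq_row /=.
  by have := rank_ltmx FnuF; rewrite (eqP Ffree).
have [M [Mf MN]] := step n (leqnn n).
have [k kP] := @choice _ _ (fun j (k : C) => forall z, D z -> dot z (row j M) != k) MN.
by exists M, k; split; [rewrite -row_free_unit|move=> z j; exact: kP].
Qed.

End Functionals.

Section Differentiability.
Variables (R : realType) (W : normedModType R[i]) (n : nat).
Local Notation C := (R[i]^o).
Local Notation V := ('rV[R[i]^o]_n).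

Lemma differentiable_sum_at m (f : 'I_m -> W -> C) (z : W) :
  (forall i, differentiable (f i) z) -> differentiable (fun w => \sum_i f i w) z.
Proof.
move=> h; have := differentiable_sum h.
by rewrite (_ : \sum_i f i = (fun w => \sum_i f i w)) //; apply/funext => w; rewrite fct_sumE.
Qed.

Lemma differentiable_rV (f : W -> V) (z : W) :
  (forall j, differentiable (fun w => f w 0 j : C) z) -> differentiable f z.
Proof.
move=> h.
have d : differentiable (\sum_(j < n) (fun w => (f w 0 j : C) *: (delta_mx 0 j : V))) z.
  by apply: differentiable_sum => j; exact: (@differentiableZl _ _ _ (fun w => f w 0 j : C)).
move: d; rewrite (_ : \sum_(j < n) _ = f) //.
by apply/funext => w; rewrite fct_sumE [RHS]row_sum_delta.
Qed.

Lemma differentiable_cmul (f : W -> C) (c : C) z :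
  differentiable f z -> differentiable (fun w => f w * c) z.
Proof. by move=> fz; exact: (@differentiableM _ _ f (fun=> c) z fz (differentiable_cst c z)). Qed.

Lemma differentiable_addc (f : W -> C) (c : C) z :
  differentiable f z -> differentiable (fun w => f w + c) z.
Proof. by move=> fz; exact: (@differentiableD _ _ _ f (fun=> c) z fz (differentiable_cst c z)). Qed.

Lemma differentiable_mulmx (f : W -> V) (A : 'M[R[i]^o]_n) z :
  (forall j, differentiable (fun w => f w 0 j : C) z) -> differentiable (fun w => f w *m A) z.
Proof.
move=> h; apply: differentiable_rV => j.
rewrite (_ : (fun w => _) = (fun w => \sum_i (f w 0 i * A i j : C))); last first.
  by apply/funext => w; rewrite mxE.
by apply: differentiable_sum_at => i; exact: differentiable_cmul.
Qed.

End Differentiability.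

Lemma differentiable_dot {R : realType} {n : nat} (nu z : 'rV[R[i]^o]_n) :
  differentiable (fun w => dot w nu) z.
Proof.
apply: differentiable_sum_at => i; apply: differentiable_cmul.
exact: differentiable_coord.
Qed.

Section OneFunctional.
Variables (R : realType) (n : nat).
Local Notation C := (R[i]^o).
Local Notation V := ('rV[R[i]^o]_n).
Variables (D : set V) (nu : V) (k : C).
Hypotheses (dD : domain D) (cD : C_convex D) (nu0 : nu != 0).
Hypothesis omit : forall z, D z -> dot z nu != k.

(** A logarithm L of dot . nu - k depends on dot . nu only, because the lines on
    which this function is constant meet D in connected sets. Hence L(D) is
    disjoint from its translate by 2 pi i; as it contains a disc, it misses one. *)
Lemma log_omits_disc : exists (L : V -> C) (q : C) (rho : R),
  [/\ 0 < rho, holomorphic_on D L,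
      (forall z, D z -> cexp (L z) = dot z nu - k) &
      (forall z, D z -> rho <= nrm (L z - q))].
Proof.
have [oD _ D0] := dD.
have gd z : D z -> differentiable (fun w => dot w nu - k) z.
  by move=> _; apply: differentiable_addc; exact: differentiable_dot.
have gc z : D z -> (fun w => dot w nu - k) @ z --> dot z nu - k.
  by move=> Dz; exact: (differentiable_continuous (gd z Dz)).
have g0 z : D z -> dot z nu - k != 0 by move=> Dz; rewrite subr_eq0 omit.
have [L [Lc LE]] := C_convex_log oD D0 cD gc g0.
have Lfib z w : D z -> D w -> dot z nu = dot w nu -> L z = L w.
  move=> Dz Dw zw; have [->//|neq] := eqVneq z w.
  have wz0 : w - z != 0 by rewrite subr_eq0 eq_sym.
  have [|cL _] := @cD z (w - z) wz0.
    by exists z; split => //; exists 0; rewrite ?scale0r ?addr0.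
  apply: (@cexp_const_connected R V _ L cL).
  - by move=> x [Dx _]; exact: Lc.
  - move=> x y [Dx [lx _ xE]] [Dy [ly _ yE]]; rewrite !LE // -xE -yE !dotDl !dotZl.
    by rewrite dotBl zw subrr !mulr0.
  - by split => //; exists 0; rewrite ?scale0r ?addr0.
  - by split => //; exists 1; rewrite // scale1r addrC subrK.
have [z0 Dz0] := D0.
have [v vnu] : exists v, dot v nu = 1.
  exists (((sqn nu)^-1%:C : C) *: cconj nu); rewrite dotZl dotC -sqnE -rmorphM /=.
  by rewrite mulVf // gt_eqF // sqn_gt0.
pose h (w : C) : V := z0 + (cexp w - (dot z0 nu - k)) *: v.
have hE w : dot (h w) nu - k = cexp w by rewrite /h dotDl dotZl vnu; ring.
have hL : h (L z0) = z0 by rewrite /h LE // subrr scale0r addr0.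
have hc w : h x @[x --> w] --> h w.
  have c1 : (fun x : C => cexp x) @ w --> cexp w by exact: cvg_cexp (cvg_id_at w).
  exact: (cvgD (cvg_cst_at z0) (cvgZ (cvgB c1 (cvg_cst_at (dot z0 nu - k))) (cvg_cst_at v))).
have [rho rho0 rhoP] : exists2 rho : R, 0 < rho &
    forall w, nrm (w - L z0) < rho -> D (h w) /\ L (h w) = w.
  have n1 : \forall w \near L z0, D (h w).
    by apply: (near_cvg (hc (L z0))); apply: open_nbhs_nbhs; rewrite hL.
  have cL : (fun w : C => L (h w)) @ L z0 --> L z0.
    rewrite -{2}hL; apply: cvg_comp_at (hc (L z0)) _; rewrite hL; exact: Lc.
  have n2 : \forall w \near L z0, nrm (L (h w) - L z0) < 1 by exact: cvg_lt_nrm cL ltr01.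
  have n3 : \forall w \near L z0, nrm ((w : C) - L z0) < 1 by exact: near_nrm.
  have n4 : \forall w \near L z0, D (h w) /\ L (h w) = w.
    have n5 : \forall w \near L z0, nrm (L (h w) - L z0) < 1 /\ nrm ((w : C) - L z0) < 1.
      exact: filterI n2 n3.
    apply: (near_imply2 n1 n5) => w Dw [w2 w3]; split => //.
    apply/eqP; rewrite -subr_eq0; apply/eqP; apply: cexp_eq1.
      by rewrite cexpB LE // hE divff // cexp_neq0.
    by have := nrm_tri (L (h w)) (L z0) w; rewrite (nrmB (L z0) w); lra.
  by have [rho rho0 rhoP] := (nbhs_nrm _ _).1 n4; exists rho.
exists L, (L z0 + (2 * pi) *i), rho; split => //.
  exact: (log_branch_differentiable oD Lc LE gd).
move=> z Dz; rewrite leNgt; apply/negP => hz.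
pose w := L z - (2 * pi) *i.
have [|Dw Lw] := rhoP w.
  by move: hz; rewrite /w; congr (nrm _ < _); ring.
have : L (h w) = L z.
  apply: Lfib => //; apply: (@addIr _ (- k)); rewrite hE -LE // -(cexp_2pi w).
  by rewrite /w subrK.
rewrite Lw /w => /eqP; rewrite -subr_eq0 addrAC subrr add0r oppr_eq0.
move=> /eqP/(congr1 (@complex.Im R)) /= h2.
by have := pi_gt0 R; lra.
Qed.

End OneFunctional.

(** * The bounded embedding *)

Section BoundedEmbedding.
Variables (R : realType) (n : nat).
Local Notation C := (R[i]^o).
Local Notation V := ('rV[R[i]^o]_n).
Variables (D : set V).
Hypotheses (dD : domain D) (cD : C_convex D) (nl : ~ contains_complex_line D).

Lemma log_coordinates : exists (M : 'M[R[i]^o]_n) (k : 'I_n -> C)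
    (L : 'I_n -> V -> C) (q : 'I_n -> C) (rho : 'I_n -> R),
  M \in unitmx /\ forall j, [/\ (forall z, D z -> dot z (row j M) != k j),
    0 < rho j, holomorphic_on D (L j),
    (forall z, D z -> cexp (L j z) = dot z (row j M) - k j) &
    (forall z, D z -> rho j <= nrm (L j z - q j))].
Proof.
have [M [k [Mu Mk]]] := independent_functionals dD cD nl.
have row0 j : row j M != 0.
  apply/eqP => rj; have : row j M *m invmx M = delta_mx 0 j.
    by rewrite -row_mul mulmxV // row1.
  rewrite rj mul0mx => /matrixP/(_ 0 j); rewrite !mxE !eqxx => /eqP.
  by rewrite eq_sym oner_eq0.
have H j : exists p : (V -> C) * C * R,
  [/\ (forall z, D z -> dot z (row j M) != k j),
    0 < p.2, holomorphic_on D p.1.1,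
    (forall z, D z -> cexp (p.1.1 z) = dot z (row j M) - k j) &
    (forall z, D z -> p.2 <= nrm (p.1.1 z - p.1.2))].
  have om z : D z -> dot z (row j M) != k j by exact: Mk.
  by have [L [q [rho [? ? ? ?]]]] := log_omits_disc dD cD (row0 j) om; exists (L, q, rho).
have [p pP] := choice H.
by exists M, k, (fun j => (p j).1.1), (fun j => (p j).1.2), (fun j => (p j).2).
Qed.

Lemma dot_mulmx z (M : 'M[R[i]^o]_n) j : (z *m M^T) 0 j = dot z (row j M).
Proof. by rewrite mxE; apply: eq_bigr => i _; rewrite !mxE. Qed.

(** The coordinates 1 / (L_j - q_j), where L_j = log (dot . nu_j - k_j), are
    bounded; the values of the functionals nu_j, hence the point, are recovered from
    them by exp. The image is open because L_j composed with the inverse differs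
    from the expected value by an integral multiple of 2 pi i, hence, near a point
    of the image, not at all. *)
Theorem biholomorphic_bounded : exists G : set V,
  [/\ domain G, bounded_set G & biholomorphic D G].
Proof.
have [oD conD D0] := dD.
have [M [k [L [q [rho [Mu H]]]]]] := log_coordinates.
have MTu : M^T \in unitmx by rewrite unitmx_tr.
pose f (z : V) : V := \row_j ((L j z - q j)^-1 : C).
pose g (y : V) : V := (\row_j (cexp ((y 0 j : C)^-1 + q j) + k j : C)) *m invmx M^T.
have L0 j z : D z -> L j z - q j != 0.
  move=> Dz; have [_ r0 _ _ h] := H j; rewrite -nrm_gt0.
  exact: lt_le_trans (h z Dz).
have gf z : D z -> g (f z) = z.
  move=> Dz; rewrite /g (_ : (\row_j _) = z *m M^T) ?mulmxK //.
  apply/rowP => j; rewrite dot_mulmx !mxE invrK subrK.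
  by have [_ _ _ -> //] := H j; rewrite subrK.
have gE y j : dot (g y) (row j M) - k j = cexp ((y 0 j : C)^-1 + q j).
  by rewrite -dot_mulmx /g mulmxKV // mxE addrK.
have fd : holomorphic_on D f.
  move=> z Dz; apply: differentiable_rV => j.
  rewrite (_ : (fun w => _) = (fun w => (L j w - q j)^-1)); last by apply/funext => w; rewrite mxE.
  apply: (@differentiableV _ _ (fun w => L j w - q j)); last exact: L0.
  by apply: differentiable_addc; have [_ _ h _ _] := H j; exact: h.
have gd (y : V) : (forall j, y 0 j != 0) -> differentiable g y.
  move=> y0; apply: differentiable_mulmx => j.
  rewrite (_ : (fun w => _) = (fun w : V => cexp ((w 0 j : C)^-1 + q j) + k j)); last first.
    by apply/funext => w; rewrite mxE.
  apply: differentiable_addc.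
  have d1 : differentiable (fun w : V => (w 0 j : C)^-1 + q j) y.
    apply: differentiable_addc; apply: (@differentiableV _ _ (fun w : V => w 0 j : C)) => //.
    exact: differentiable_coord.
  exact: (differentiable_comp d1 (@differentiable_cexp R _)).
have f0 z j : D z -> f z 0 j != 0 by move=> Dz; rewrite mxE invr_eq0 L0.
exists (f @` D); split.
- split; [|apply: connected_continuous_connected => //|]; last first.
  + by have [z Dz] := D0; exists (f z); exists z.
  + apply: continuous_in_subspaceT => z; rewrite inE => Dz.
    exact: (differentiable_continuous (fd z Dz)).
  rewrite openE => y [z Dz <-].
  have gc := differentiable_continuous (gd (f z) (fun j => f0 z j Dz)).
  have Lc j : {for z, continuous (L j)}.
    by have [_ _ h _ _] := H j; exact: (differentiable_continuous (h z Dz)).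
  have n1 : \forall y \near f z, D (g y).
    by apply: (near_cvg gc); apply: open_nbhs_nbhs; rewrite gf.
  have n2j j : \forall y \near f z, nrm (L j (g y) - ((y 0 j : C)^-1 + q j) : C) < 2.
    have c1 : (fun y : V => L j (g y)) @ f z --> L j z.
      have := cvg_comp_at gc; rewrite gf // => c; exact: c (Lc j).
    have c2 : (fun y : V => (y 0 j : C)) @ f z --> (f z 0 j : C).
      exact: (cvg_coord j (cvg_id_at (f z))).
    have c3 : (fun y : V => L j (g y) - ((y 0 j : C)^-1 + q j) : C) @ f z --> (0 : C).
      rewrite -(subrr (L j z)) -{2}(subrK (q j) (L j z)).
      have -> : L j z - q j = (f z 0 j : C)^-1 by rewrite mxE invrK.
      exact: (cvgB c1 (cvgD (cvgV (f0 z j Dz) c2) (cvg_cst_at (q j)))).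
    by apply: (near_imply (cvg_lt_nrm c3 (ltr0n _ 2))) => w; rewrite subr0.
  have n2 : \forall y \near f z, forall j, nrm (L j (g y) - ((y 0 j : C)^-1 + q j) : C) < 2.
    exact: filter_forall n2j.
  apply: (near_imply2 n1 n2) => w Dw hw; exists (g w) => //.
  apply/rowP => j; rewrite mxE.
  suff -> : L j (g w) = (w 0 j : C)^-1 + q j by rewrite addrK invrK.
  apply/eqP; rewrite -subr_eq0; apply/eqP; apply: cexp_eq1 (hw j).
  have [_ _ _ h _] := H j; rewrite cexpB h // gE divff //; exact: cexp_neq0.
- exists (\sum_j (rho j)^-1)%:C; split; first by apply/complex_realP; eexists.
  move=> x xM _ [z Dz <-]; apply: le_trans (ltW xM); rewrite normE lecR.
  have s0 : 0 <= \sum_j (rho j)^-1.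
    by apply: sumr_ge0 => j _; have [_ h _ _ _] := H j; rewrite invr_ge0 ltW.
  apply/ler_addgt0Pr => e e0; apply: ltW; apply: nrm_rV_lt; first by lra.
  move=> j; rewrite mxE nrmV; apply: (@le_lt_trans _ _ (rho j)^-1).
    have [_ r0 _ _ h] := H j; rewrite lef_pV2 ?posrE //; first exact: h.
    exact: lt_le_trans (h z Dz).
  rewrite (bigD1 j) //= -addrA ltrDl; apply: ltr_wpDl => //.
  by apply: sumr_ge0 => i _; have [_ h _ _ _] := H i; rewrite invr_ge0 ltW.
- exists f, g; split.
  + by split => // z Dz; exists z.
  + split=> [_ [z Dz <-]|_ [z Dz <-]]; last by rewrite gf.
    by apply: gd => j; exact: f0.
  + exact: gf.
  + by move=> _ [z Dz <-]; rewrite gf.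
Qed.

End BoundedEmbedding.

(** * The Poincare distance *)

Section Poincare.
Variable R : realType.
Local Notation C := (R[i]^o).
Implicit Types a b c z w : C.

(** The hyperbolic tangent. *)
Definition tnh (r : R) : R := (expR (2 * r) - 1) / (expR (2 * r) + 1).

Lemma tnh_lt1 r : tnh r < 1.
Proof. by rewrite /tnh ltr_pdivrMr; have := expR_gt0 (2 * r); lra. Qed.

Lemma tnh_ge0 r : 0 <= r -> 0 <= tnh r.
Proof.
move=> r0; apply: divr_ge0; last by have := expR_gt0 (2 * r); lra.
by rewrite subr_ge0; have := expR_ge1Dx (2 * r); lra.
Qed.

Lemma tnh_gt0 r : 0 < r -> 0 < tnh r.
Proof.
move=> r0; apply: divr_gt0; last by have := expR_gt0 (2 * r); lra.
by rewrite subr_gt0 expR_gt1; lra.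
Qed.

Lemma tnhK r : artanh (tnh r) = r.
Proof.
have e0 := expR_gt0 (2 * r).
rewrite /artanh /tnh; have -> : (1 + (expR (2 * r) - 1) / (expR (2 * r) + 1)) /
  (1 - (expR (2 * r) - 1) / (expR (2 * r) + 1)) = expR (2 * r).
  by field; apply/andP; split; apply: lt0r_neq0; lra.
by rewrite expRK mulKf.
Qed.

Lemma artanh_arg (x : R) : 0 <= x < 1 -> 0 < (1 + x) / (1 - x).
Proof. by move=> /andP[x0 x1]; apply: divr_gt0; lra. Qed.

Lemma artanh_lt (x y : R) : 0 <= x -> y < 1 -> x < y -> artanh x < artanh y.
Proof.
move=> x0 y1 xy; rewrite /artanh ltr_pM2l ?invr_gt0 ?ltr0n //.
have x1 : x < 1 by exact: lt_trans y1.
have y0 : 0 <= y by apply: le_trans (ltW xy).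
rewrite ltr_ln ?posrE ?artanh_arg ?x0 ?y0 //.
have -> : (1 + x) / (1 - x) = 2 / (1 - x) - 1 by field; lra.
have -> : (1 + y) / (1 - y) = 2 / (1 - y) - 1 by field; lra.
by rewrite ltrD2r ltr_pM2l // ltf_pV2 ?posrE; lra.
Qed.

Lemma artanh_le (x y : R) : 0 <= x -> y < 1 -> x <= y -> artanh x <= artanh y.
Proof.
by move=> x0 y1; rewrite le_eqVlt => /orP[/eqP->//|xy]; exact/ltW/artanh_lt.
Qed.

Lemma artanh0 : artanh (0 : R) = 0.
Proof. by rewrite /artanh addr0 subr0 divr1 ln1 mulr0. Qed.

Lemma artanh_ge0 (x : R) : 0 <= x < 1 -> 0 <= artanh x.
Proof. by move=> /andP[x0 x1]; rewrite -artanh0; exact: artanh_le. Qed.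

Lemma artanh_lt_tnh (x r : R) : 0 <= r -> x < 1 -> artanh x < r -> x < tnh r.
Proof.
move=> r0 x1 xr; rewrite ltNge; apply/negP => h.
by have := artanh_le (tnh_ge0 r0) x1 h; rewrite tnhK leNgt xr.
Qed.

Lemma artanh_le_tnh (x r : R) : 0 <= r -> x < 1 -> artanh x <= r -> x <= tnh r.
Proof.
move=> r0 x1 xr; rewrite leNgt; apply/negP => h.
by have := artanh_lt (tnh_ge0 r0) x1 h; rewrite tnhK ltNge xr.
Qed.

Lemma lt_tnh_artanh (x r : R) : 0 <= x -> x < tnh r -> artanh x < r.
Proof. by move=> x0 xr; rewrite -[ltRHS]tnhK; apply: artanh_lt => //; exact: tnh_lt1. Qed.

Lemma artanhD (x y : R) : 0 <= x < 1 -> 0 <= y < 1 ->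
  artanh ((x + y) / (1 + x * y)) = artanh x + artanh y.
Proof.
move=> x01 y01; rewrite /artanh -mulrDr -lnM ?posrE ?artanh_arg //.
move: x01 y01 => /andP[x0 x1] /andP[y0 y1].
congr (_ * ln _); field.
by repeat (apply/andP; split); apply: lt0r_neq0; nra.
Qed.

Lemma conjcB z w : conjc (z - w) = conjc z - conjc w :> C.
Proof. by apply: complexP; case: z; case: w => *; rewrite /= ?opprD. Qed.

Lemma conjcM z w : conjc (z * w) = conjc z * conjc w :> C.
Proof. by apply: complexP; case: z; case: w => *; rewrite /=; ring. Qed.

Lemma nrm_conjc z : nrm (conjc z : C) = nrm z.
Proof. exact: nrm_conj. Qed.

Lemma nrm2_conjc z : ((nrm z ^+ 2)%:C : C) = z * conjc z.
Proof. exact: nrm2_conj. Qed.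

(** The pseudo-hyperbolic distance, artanh of which is the Poincare distance. *)
Definition phyp a b : R := nrm ((a - b) / (1 - conjc a * b) : C).

Lemma poincareE a b : poincare_dist a b = artanh (phyp a b).
Proof. by []. Qed.

Lemma disc_den a b : nrm a < 1 -> nrm b < 1 -> (1 - conjc a * b : C) != 0.
Proof.
move=> a1 b1; apply/eqP => h.
have : nrm (conjc a * b : C) = 1.
  by rewrite -(nrm1 R); congr nrm; apply/eqP; rewrite eq_sym -subr_eq0 h.
rewrite nrmM nrm_conjc; have := nrm_ge0 a; have := nrm_ge0 b; nra.
Qed.

Lemma disc_den_gt0 a b : nrm a < 1 -> nrm b < 1 -> 0 < nrm (1 - conjc a * b : C).
Proof. by move=> a1 b1; rewrite nrm_gt0 disc_den. Qed.

Lemma disc_identity a b : nrm (1 - conjc a * b : C) ^+ 2 - nrm (a - b) ^+ 2 =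
  (1 - nrm a ^+ 2) * (1 - nrm b ^+ 2).
Proof. by rewrite !nrm_sqr; case: a => a1 a2; case: b => b1 b2 /=; ring. Qed.

Lemma phyp_ge0 a b : 0 <= phyp a b. Proof. exact: nrm_ge0. Qed.

Lemma phyp_sqr a b : nrm a < 1 -> nrm b < 1 ->
  1 - phyp a b ^+ 2 = (1 - nrm a ^+ 2) * (1 - nrm b ^+ 2) / nrm (1 - conjc a * b : C) ^+ 2.
Proof.
move=> a1 b1; rewrite -disc_identity /phyp nrmM nrmV.
by field; rewrite gt_eqF // disc_den_gt0.
Qed.

Lemma phyp_lt1 a b : nrm a < 1 -> nrm b < 1 -> phyp a b < 1.
Proof.
move=> a1 b1; rewrite -(@ltr_pXn2r _ 2) ?nnegrE ?phyp_ge0 // expr1n -subr_gt0.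
rewrite phyp_sqr //; have a0 := nrm_ge0 a; have b0 := nrm_ge0 b.
apply: divr_gt0; last by rewrite exprn_gt0 // disc_den_gt0.
by apply: mulr_gt0; nra.
Qed.

Lemma phypC a b : phyp a b = phyp b a.
Proof.
rewrite /phyp !nrmM !nrmV nrmB; congr (_ / _); rewrite -nrm_conjc.
by rewrite rmorphB rmorph1 rmorphM /= conjcK mulrC.
Qed.

Lemma phyp_self a : phyp a a = 0.
Proof. by rewrite /phyp subrr mul0r nrm0. Qed.

Lemma phyp_eq0 a b : nrm a < 1 -> nrm b < 1 -> phyp a b = 0 -> a = b.
Proof.
move=> a1 b1 /eqP; rewrite nrm_eq0 mulf_eq0 invr_eq0 (negbTE (disc_den a1 b1)) orbF.
by rewrite subr_eq0 => /eqP.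
Qed.

(** The disc automorphism exchanging 0 and b up to sign. *)
Definition mobius b z : C := (z - b) / (1 - conjc b * z).

Lemma nrm_mobius b z : nrm (mobius b z) = phyp b z.
Proof. by rewrite /mobius /phyp !nrmM nrmB. Qed.

(** Disc automorphisms are isometries; b can be moved to 0 in this way. *)
Lemma mobius_phyp a b c : nrm a < 1 -> nrm b < 1 -> nrm c < 1 ->
  phyp (mobius b a) (mobius b c) = phyp a c.
Proof.
move=> a1 b1 c1.
have ba := disc_den b1 a1; have bc := disc_den b1 c1; have ab := disc_den a1 b1.
have ma : nrm (mobius b a) < 1 by rewrite nrm_mobius phyp_lt1.
have mc : nrm (mobius b c) < 1 by rewrite nrm_mobius phyp_lt1.
apply/eqP; rewrite -(@eqrXn2 _ 2) ?phyp_ge0 //; apply/eqP.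
suff : 1 - phyp (mobius b a) (mobius b c) ^+ 2 = 1 - phyp a c ^+ 2 by lra.
rewrite !phyp_sqr // !nrm_mobius !phyp_sqr //.
have -> : (1 - (conjc (mobius b a)) * mobius b c : C) =
    ((1 - conjc b * b) * (1 - conjc a * c)) / ((1 - conjc a * b) * (1 - conjc b * c)).
  rewrite /mobius conjcM conjcB conjc_inv conjcB conjcM conjc1 conjcK.
  by field; apply/andP; split; [exact: bc|exact: ab].
have bb : nrm (1 - conjc b * b : C) = 1 - nrm b ^+ 2.
  have b0 := nrm_ge0 b; rewrite mulrC -nrm2_conjc.
  have -> : (1 - (nrm b ^+ 2)%:C : C) = ((1 - nrm b ^+ 2)%:C : C) by rewrite rmorphB.
  by rewrite nrm_pos //; nra.
have nab : nrm (1 - conjc a * b : C) = nrm (1 - conjc b * a : C).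
  by rewrite -nrm_conjc conjcB conjc1 conjcM conjcK mulrC.
rewrite nrmM nrmV !nrmM bb nab.
have h1 := disc_den_gt0 b1 a1; have h2 := disc_den_gt0 b1 c1; have h3 := disc_den_gt0 a1 c1.
have h4 : 1 - nrm b ^+ 2 != 0 by apply: lt0r_neq0; have := nrm_ge0 b; nra.
by field; rewrite h4 !lt0r_neq0.
Qed.

Lemma phyp_triangle a b c : nrm a < 1 -> nrm b < 1 -> nrm c < 1 ->
  phyp a c <= (phyp a b + phyp b c) / (1 + phyp a b * phyp b c).
Proof.
move=> a1 b1 c1.
have base z w : nrm z < 1 -> nrm w < 1 ->
    phyp z w <= (nrm z + nrm w) / (1 + nrm z * nrm w).
  move=> z1 w1; have z0 := nrm_ge0 z; have w0 := nrm_ge0 w.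
  have zw := mulr_ge0 z0 w0; have p0 : 0 < 1 + nrm z * nrm w by lra.
  rewrite -(@ler_pXn2r _ 2) ?nnegrE ?phyp_ge0 ?divr_ge0 ?addr_ge0 ?(ltW p0) //.
  suff : 1 - ((nrm z + nrm w) / (1 + nrm z * nrm w)) ^+ 2 <= 1 - phyp z w ^+ 2 by lra.
  rewrite phyp_sqr //.
  have -> : 1 - ((nrm z + nrm w) / (1 + nrm z * nrm w)) ^+ 2 =
     (1 - nrm z ^+ 2) * (1 - nrm w ^+ 2) / (1 + nrm z * nrm w) ^+ 2.
    by field; exact: lt0r_neq0.
  have d0 := disc_den_gt0 z1 w1.
  apply: ler_wpM2l; first by apply: mulr_ge0; nra.
  rewrite lef_pV2 ?posrE ?exprn_gt0 // ler_pXn2r ?nnegrE ?(ltW d0) ?(ltW p0) //.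
  by apply: le_trans (nrmD _ _) _; rewrite nrmN nrm1 nrmM nrm_conjc.
rewrite -(mobius_phyp a1 b1 c1) (phypC a b) -(nrm_mobius b a) -(nrm_mobius b c).
by apply: base; rewrite nrm_mobius phyp_lt1.
Qed.

Lemma phyp_triangle_le a b c : nrm a < 1 -> nrm b < 1 -> nrm c < 1 ->
  phyp a c <= phyp a b + phyp b c.
Proof.
move=> a1 b1 c1; apply: le_trans (phyp_triangle a1 b1 c1) _.
have x0 := phyp_ge0 a b; have y0 := phyp_ge0 b c.
have p0 : 0 < 1 + phyp a b * phyp b c by nra.
by rewrite ler_pdivrMr //; nra.
Qed.

Lemma poincare_triangle a b c : nrm a < 1 -> nrm b < 1 -> nrm c < 1 ->
  poincare_dist a c <= poincare_dist a b + poincare_dist b c.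
Proof.
move=> a1 b1 c1; rewrite !poincareE -artanhD ?phyp_ge0 ?phyp_lt1 //.
apply: artanh_le; [exact: phyp_ge0| |exact: phyp_triangle].
have x0 := phyp_ge0 a b; have y0 := phyp_ge0 b c.
have x1 := phyp_lt1 a1 b1; have y1 := phyp_lt1 b1 c1.
by rewrite ltr_pdivrMr; nra.
Qed.

Lemma unit_discE z : unit_disc z <-> nrm z < 1.
Proof. by rewrite /unit_disc /= normE -ltcR. Qed.

Lemma differentiable_idfun {W : normedModType R[i]} (z : W) :
  differentiable (fun w : W => w) z.
Proof. by have [] := is_diff_id z. Qed.

Lemma differentiable_mobius b z : nrm b < 1 -> nrm z < 1 -> differentiable (mobius b) z.
Proof.
move=> b1 z1.
have d1 : differentiable (fun w : C => 1 - conjc b * w : C) z.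
  have -> : (fun w : C => 1 - conjc b * w : C) = (fun w : C => w * (- (conjc b)) + 1).
    by apply/funext => w; ring.
  by apply: differentiable_addc; apply: differentiable_cmul; exact: differentiable_idfun.
apply: (@differentiableM _ _ (fun w : C => w - b) (fun w : C => (1 - conjc b * w)^-1)).
  by apply: differentiable_addc; exact: differentiable_idfun.
by apply: (@differentiableV _ _ (fun w : C => 1 - conjc b * w)) => //; exact: disc_den.
Qed.

End Poincare.

(** * Integrals of continuous functions and Goursat's lemma *)

Section IntervalIntegral.
Variable R : realType.
Implicit Types (f g : R -> R) (a b c : R).

Definition itg a b f : R := \int[@lebesgue_measure R]_(x in `[a, b]) f x.

Lemma cts_integrable a b f : continuous f ->
  (@lebesgue_measure R).-integrable `[a, b] (EFin \o f).
Proof.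
move=> fc; apply: continuous_compact_integrable; first exact: segment_compact.
exact: continuous_subspaceT.
Qed.

Lemma itgD a b f g : continuous f -> continuous g ->
  itg a b (fun x => f x + g x) = itg a b f + itg a b g.
Proof. by move=> fc gc; apply: RintegralD => //; exact: cts_integrable. Qed.

Lemma itgB a b f g : continuous f -> continuous g ->
  itg a b (fun x => f x - g x) = itg a b f - itg a b g.
Proof. by move=> fc gc; apply: RintegralB => //; exact: cts_integrable. Qed.

Lemma itg_le a b f g : continuous f -> continuous g ->
  (forall x, a <= x <= b -> f x <= g x) -> itg a b f <= itg a b g.
Proof.
by move=> fc gc h; apply: le_Rintegral => //; exact: cts_integrable.
Qed.

Lemma itg_cst a b c : a <= b -> itg a b (fun=> c) = c * (b - a).
Proof.
move=> ab; rewrite /itg Rintegral_cst //; congr (_ * _).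
apply: etrans (congr1 fine (@lebesgue_measure_itv R `[a, b])) _ => /=.
by rewrite lte_fin; case: ltgtP ab => //= ->; rewrite subrr.
Qed.

Lemma itg_bound a b f (M : R) : a <= b -> continuous f ->
  (forall x, a <= x <= b -> `|f x| <= M) -> `|itg a b f| <= M * (b - a).
Proof.
move=> ab fc h; rewrite ler_norml; apply/andP; split.
  rewrite -mulNr -itg_cst //; apply: itg_le => // [x|x /h]; first exact: cvg_cst.
  by rewrite ler_norml => /andP[].
rewrite -itg_cst //; apply: itg_le => // [x|x /h]; first exact: cvg_cst.
by rewrite ler_norml => /andP[].
Qed.

Lemma itg_split a b c f : a <= c -> c <= b -> continuous f ->
  itg a b f = itg a c f + itg c b f.
Proof.
move=> ac cb fc.
have := @Rintegral_itvB R f (BLeft a) (BRight b) c (cts_integrable _ _ fc).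
rewrite !bnd_simp => /(_ ac cb) h.
rewrite /itg -(Rintegral_itv_obnd_cbnd (r := c)); first by rewrite -h; ring.
by apply: integrableS (@cts_integrable c b f fc) => //; exact: subset_itv_oc_cc.
Qed.

Lemma eq_itg a b f g : (forall x, a <= x <= b -> f x = g x) -> itg a b f = itg a b g.
Proof. by move=> h; apply: eq_Rintegral => x; rewrite inE /= in_itv /=; exact: h. Qed.

End IntervalIntegral.

Section Goursat.
Variable R : realType.
Local Notation C := (R[i]^o).

(* boundary_itg is the real part of 1/i times the contour integral of u + i v over
   the boundary of [a, a + w] x [c, c + h]. *)
Variables (u v : R * R -> R).
Hypotheses (uc : continuous u) (vc : continuous v).

Definition boundary_itg a c w h : R :=
  itg c (c + h) (fun y => u (a + w, y) - u (a, y)) +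
  itg a (a + w) (fun x => v (x, c) - v (x, c + h)).

Lemma slice1_cts (f : R * R -> R) y : continuous f -> continuous (fun x => f (x, y)).
Proof.
move=> fc x; have c1 : (fun x : R => (x, y)) @ x --> ((x, y) : R * R).
  exact: (cvg_pair_at (f := id) (g := fun=> y) (cvg_id_at x) (cvg_cst_at y)).
exact: cvg_comp_at c1 (fc _).
Qed.

Lemma slice2_cts (f : R * R -> R) x : continuous f -> continuous (fun y => f (x, y)).
Proof.
move=> fc y; have c1 : (fun y : R => (x, y)) @ y --> ((x, y) : R * R).
  exact: (cvg_pair_at (f := fun=> x) (g := id) (cvg_cst_at x) (cvg_id_at y)).
exact: cvg_comp_at c1 (fc _).
Qed.

Lemma boundary_itg4 a c w h : 0 <= w -> 0 <= h ->
  boundary_itg a c w h =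
    boundary_itg a c (w / 2) (h / 2) + boundary_itg (a + w / 2) c (w / 2) (h / 2) +
    boundary_itg a (c + h / 2) (w / 2) (h / 2) +
    boundary_itg (a + w / 2) (c + h / 2) (w / 2) (h / 2).
Proof.
move=> w0 h0; rewrite /boundary_itg.
have uy x := @slice2_cts u x uc; have vx y := @slice1_cts v y vc.
have e1 : a + w / 2 + w / 2 = a + w by lra.
have e2 : c + h / 2 + h / 2 = c + h by lra.
rewrite !itgB // !e1 !e2.
rewrite !(@itg_split R c (c + h) (c + h / 2)) //; [|lra..].
rewrite !(@itg_split R a (a + w) (a + w / 2)) //; [|lra..].
ring.
Qed.

Variables (a0 c0 w0 h0 : R).
Hypotheses (w0_gt0 : 0 < w0) (h0_gt0 : 0 < h0).

Definition in_rect (a c w h : R) (p : R * R) :=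
  a <= p.1 <= a + w /\ c <= p.2 <= c + h.

(* u + i v has complex derivative p + i q at (x, y), relative to the rectangle *)
Hypothesis diff : forall x y, in_rect a0 c0 w0 h0 (x, y) -> exists p q : R,
  forall e : R, 0 < e -> exists2 d : R, 0 < d & forall x' y', in_rect a0 c0 w0 h0 (x', y') ->
    `|x' - x| < d -> `|y' - y| < d ->
    `|u (x', y') - (u (x, y) + p * (x' - x) - q * (y' - y))| <= e * (`|x' - x| + `|y' - y|) /\
    `|v (x', y') - (v (x, y) + q * (x' - x) + p * (y' - y))| <= e * (`|x' - x| + `|y' - y|).

(** The boundary integral vanishes on complex affine functions. *)
Lemma boundary_itg_small x y a c w h (e d p q : R) : 0 <= w -> 0 <= h -> 0 < e ->
  in_rect a c w h (x, y) ->
  (forall x' y', in_rect a c w h (x', y') ->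
    `|u (x', y') - (u (x, y) + p * (x' - x) - q * (y' - y))| <= e * (`|x' - x| + `|y' - y|) /\
    `|v (x', y') - (v (x, y) + q * (x' - x) + p * (y' - y))| <= e * (`|x' - x| + `|y' - y|)) ->
  `|boundary_itg a c w h| <= 2 * e * (w + h) ^+ 2.
Proof.
move=> w_ge0 h_ge0 e_gt0 [/= xa yc] H.
have uy x1 := @slice2_cts u x1 uc; have vx y1 := @slice1_cts v y1 vc.
have cu : continuous (fun y1 => u (a + w, y1) - u (a, y1) - p * w).
  by move=> y1; apply: cvgB; [apply: cvgB; exact: uy|exact: cvg_cst].
have cv : continuous (fun x1 => v (x1, c) - v (x1, c + h) + p * h).
  by move=> x1; apply: cvgD; [apply: cvgB; exact: vx|exact: cvg_cst].
have -> : boundary_itg a c w h =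
  itg c (c + h) (fun y1 => u (a + w, y1) - u (a, y1) - p * w) +
  itg a (a + w) (fun x1 => v (x1, c) - v (x1, c + h) + p * h).
  have k1 : continuous (fun y1 => u (a + w, y1) - u (a, y1)) by move=> y1; apply: cvgB; exact: uy.
  have k2 : continuous (fun x1 => v (x1, c) - v (x1, c + h)) by move=> x1; apply: cvgB; exact: vx.
  have k3 (r : R) : continuous (fun _ : R => r) by move=> y1; exact: cvg_cst.
  rewrite (itgB c (c + h) k1 (k3 (p * w))) (itgD a (a + w) k2 (k3 (p * h))).
  by rewrite !itg_cst /boundary_itg; [ring|lra..].
have big x' y' : a <= x' <= a + w -> c <= y' <= c + h -> `|x' - x| + `|y' - y| <= w + h.
  move=> /andP[x1 x2] /andP[y1 y2]; move: xa yc => /andP[x3 x4] /andP[y3 y4].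
  by apply: lerD; rewrite ler_norml; apply/andP; split; lra.
have bigE x' y' : a <= x' <= a + w -> c <= y' <= c + h -> e * (`|x' - x| + `|y' - y|) <= e * (w + h).
  by move=> hx hy; rewrite ler_pM2l //; exact: big.
have s1 : `|itg c (c + h) (fun y1 => u (a + w, y1) - u (a, y1) - p * w)| <= (2 * e * (w + h)) * (c + h - c).
  apply: itg_bound => //; first lra.
  move=> y1 y1c.
  have r1 : a <= a + w <= a + w by apply/andP; split; lra.
  have r2 : a <= a <= a + w by apply/andP; split; lra.
  have [h1 _] := H (a + w) y1 (conj r1 y1c); have [h2 _] := H a y1 (conj r2 y1c).
  have := bigE _ _ r1 y1c; have := bigE _ _ r2 y1c.
  have -> : u (a + w, y1) - u (a, y1) - p * w =
    (u (a + w, y1) - (u (x, y) + p * (a + w - x) - q * (y1 - y))) -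
    (u (a, y1) - (u (x, y) + p * (a - x) - q * (y1 - y))) by ring.
  move=> b1 b2; apply: le_trans (ler_normB _ _) _; lra.
have s2 : `|itg a (a + w) (fun x1 => v (x1, c) - v (x1, c + h) + p * h)| <= (2 * e * (w + h)) * (a + w - a).
  apply: itg_bound => //; first lra.
  move=> x1 x1a.
  have r1 : c <= c + h <= c + h by apply/andP; split; lra.
  have r2 : c <= c <= c + h by apply/andP; split; lra.
  have [_ h1] := H x1 (c + h) (conj x1a r1); have [_ h2] := H x1 c (conj x1a r2).
  have := bigE _ _ x1a r1; have := bigE _ _ x1a r2.
  have -> : v (x1, c) - v (x1, c + h) + p * h =
    (v (x1, c) - (v (x, y) + q * (x1 - x) + p * (c - y))) -
    (v (x1, c + h) - (v (x, y) + q * (x1 - x) + p * (c + h - y))) by ring.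
  move=> b1 b2; apply: le_trans (ler_normB _ _) _; lra.
apply: le_trans (ler_normD _ _) _.
have -> : 2 * e * (w + h) ^+ 2 = (2 * e * (w + h)) * (c + h - c) + (2 * e * (w + h)) * (a + w - a) by ring.
exact: lerD.
Qed.

(** Repeated quartering: if the boundary integral exceeds t > 0 in absolute value,
    some quarter has a boundary integral exceeding t / 4, and so on; the nested
    quarters shrink to a point, where differentiability bounds the k-th integral
    by t / (2 * 4^k) for large k. *)
Lemma goursat : boundary_itg a0 c0 w0 h0 = 0.
Proof.
apply/eqP; rewrite -normr_le0 leNgt; apply/negP => J0.
have [t t0 bad0] : exists2 t : R, 0 < t & t < `|boundary_itg a0 c0 w0 h0|.
  by exists (`|boundary_itg a0 c0 w0 h0| / 2); lra.
have wh : 0 < w0 + h0 by exact: addr_gt0.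
pose W k := w0 / 2 ^+ k; pose Hh k := h0 / 2 ^+ k.
have p2 k : 0 < 2 ^+ k :> R by rewrite exprn_gt0.
have W0 k : 0 < W k by rewrite divr_gt0.
have H0 k : 0 < Hh k by rewrite divr_gt0.
have WS k : W k.+1 = W k / 2 by rewrite /W exprS invfM; ring.
have HS k : Hh k.+1 = Hh k / 2 by rewrite /Hh exprS invfM; ring.
pose bad k (p : R * R) := t / 4 ^+ k < `|boundary_itg p.1 p.2 (W k) (Hh k)|.
have stepP k (p : R * R) : exists p' : R * R, bad k p ->
   [/\ bad k.+1 p', p.1 <= p'.1 <= p.1 + W k / 2 & p.2 <= p'.2 <= p.2 + Hh k / 2].
  have [bp|nbp] := pselect (bad k p); last by exists p.
  apply: contrapT => none.
  have small x y : p.1 <= x <= p.1 + W k / 2 -> p.2 <= y <= p.2 + Hh k / 2 ->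
      `|boundary_itg x y (W k / 2) (Hh k / 2)| <= t / 4 ^+ k / 4.
    move=> hx hy; rewrite leNgt; apply/negP => h; apply: none; exists (x, y) => _.
    split => //; rewrite /bad /= WS HS exprS invfM; apply: le_lt_trans h.
    by rewrite mulrA mulrAC.
  have w0' := W0 k; have h0' := H0 k.
  move: bp; rewrite /bad boundary_itg4 ?ltW // ltNge => /negP; apply.
  have q1 := small p.1 p.2; have q2 := small (p.1 + W k / 2) p.2.
  have q3 := small p.1 (p.2 + Hh k / 2); have q4 := small (p.1 + W k / 2) (p.2 + Hh k / 2).
  have i1 : p.1 <= p.1 <= p.1 + W k / 2 by apply/andP; split; lra.
  have i2 : p.1 <= p.1 + W k / 2 <= p.1 + W k / 2 by apply/andP; split; lra.
  have i3 : p.2 <= p.2 <= p.2 + Hh k / 2 by apply/andP; split; lra.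
  have i4 : p.2 <= p.2 + Hh k / 2 <= p.2 + Hh k / 2 by apply/andP; split; lra.
  have {}q1 := q1 i1 i3; have {}q2 := q2 i2 i3; have {}q3 := q3 i1 i4; have {}q4 := q4 i2 i4.
  set A := boundary_itg _ _ _ _ in q1 *; set B := boundary_itg _ _ _ _ in q2 *.
  set E := boundary_itg _ _ _ _ in q3 *; set F := boundary_itg _ _ _ _ in q4 *.
  have n1 := ler_normD (A + B + E) F; have n2 := ler_normD (A + B) E; have n3 := ler_normD A B.
  by lra.
have [g gP] := choice (fun kp : nat * (R * R) => stepP kp.1 kp.2).
pose P := fix P k := if k is k'.+1 then g (k', P k') else (a0, c0).
have PS k : P k.+1 = g (k, P k) by [].
have badP k : bad k (P k).
  elim: k => [|k IH]; first by rewrite /bad /W /Hh !expr0 !divr1.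
  by rewrite PS; have [] := gP (k, P k) IH.
have P1 k : (P k).1 <= (P k.+1).1 <= (P k).1 + W k / 2.
  by rewrite PS; have [] := gP (k, P k) (badP k).
have P2 k : (P k).2 <= (P k.+1).2 <= (P k).2 + Hh k / 2.
  by rewrite PS; have [] := gP (k, P k) (badP k).
have limit (s : nat -> R) (d : nat -> R) : (forall k, d k.+1 = d k / 2) -> (forall k, 0 < d k) ->
    (forall k, s k <= s k.+1 <= s k + d k / 2) -> exists l, forall k, s k <= l <= s k + d k.
  move=> dS d0 sS.
  have mono k m : s k <= s (k + m)%N /\ s (k + m)%N + d (k + m)%N <= s k + d k.
    elim: m => [|m [IH1 IH2]]; first by rewrite addn0.
    rewrite addnS dS; have /andP[q1 q2] := sS (k + m)%N; split; lra.
  have cmp k m : s k <= s m + d m.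
    have [km|mk] := leqP k m.
      have [q _] := mono k (m - k)%N; rewrite subnKC // in q.
      by apply: le_trans q _; have := d0 m; lra.
    have [q1 q2] := mono m (k - m)%N; rewrite subnKC ?(ltnW mk) // in q1 q2.
    by have := d0 k; lra.
  exists (sup (range s)) => k; apply/andP; split.
    apply: sup_upper_bound; last by exists k.
    split; first by exists (s 0%N); exists 0%N.
    by exists (s 0%N + d 0%N) => _ [m _ <-]; exact: cmp.
  apply: ge_sup; first by exists (s 0%N); exists 0%N.
  by move=> _ [m _ <-]; exact: cmp.
have [x xP] := limit (fun k => (P k).1) W WS W0 P1.
have [y yP] := limit (fun k => (P k).2) Hh HS H0 P2.
have inR k : in_rect a0 c0 w0 h0 (P k) /\ (P k).1 + W k <= a0 + w0 /\ (P k).2 + Hh k <= c0 + h0.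
  elim: k => [|k [[/andP[q1 q2] /andP[q3 q4]] [q5 q6]]].
    rewrite /W /Hh !expr0 !divr1 /in_rect /=; split; last by split; exact: lexx.
    by split; apply/andP; split; rewrite ?lexx // lerDl ltW.
  have /andP[r1 r2] := P1 k; have /andP[r3 r4] := P2 k.
  rewrite WS HS; have := W0 k; have := H0 k => h1 h2.
  by split; [split; apply/andP; split; lra|split; lra].
have xyR : in_rect a0 c0 w0 h0 (x, y).
  have := xP 0%N; have := yP 0%N; rewrite /W /Hh !expr0 !divr1 /=.
  by move=> q1 q2; split.
have [p [q pq]] := diff xyR.
pose e := t / (4 * (w0 + h0) ^+ 2).
have wh0 : 0 < (w0 + h0) ^+ 2 by rewrite exprn_gt0.
have e0 : 0 < e by rewrite /e divr_gt0 // mulr_gt0.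
have [d d0 dP] := pq e e0.
have [k kP] : exists k, w0 + h0 < d * 2 ^+ k.
  have [k kP] : exists k : nat, (w0 + h0) / d < k%:R.
    by exists (Num.truncn ((w0 + h0) / d)).+1; exact: truncnS_gt.
  exists k; rewrite mulrC -ltr_pdivrMr //; apply: lt_trans kP _.
  by rewrite -natrX ltr_nat ltn_expl.
have WHd : W k + Hh k < d by rewrite /W /Hh -mulrDl ltr_pdivrMr.
have [[/andP[r1 r2] /andP[r3 r4]] [r5 r6]] := inR k.
have xk := xP k; have yk := yP k; have wk := W0 k; have hk := H0 k.
have small := @boundary_itg_small x y (P k).1 (P k).2 (W k) (Hh k) e d p q (ltW wk) (ltW hk) e0 (conj xk yk).
have := badP k; rewrite /bad ltNge => /negP; apply; apply: le_trans (small _) _.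
  move=> x' y' [/= /andP[x1 x2] /andP[y1 y2]]; apply: dP.
  - by split; apply/andP; split; rewrite /=; lra.
  - by move/andP: xk => [xk1 xk2]; rewrite ltr_norml; apply/andP; split; lra.
  - by move/andP: yk => [yk1 yk2]; rewrite ltr_norml; apply/andP; split; lra.
have -> : W k + Hh k = (w0 + h0) / 2 ^+ k by rewrite /W /Hh -mulrDl.
have -> : (4 : R) ^+ k = 2 ^+ k ^+ 2 by rewrite -exprM mulnC exprM; congr (_ ^+ _); rewrite expr2; lra.
have -> : 2 * e * ((w0 + h0) / 2 ^+ k) ^+ 2 = t / 2 ^+ k ^+ 2 * 2^-1.
  by rewrite /e; field; rewrite gt_eqF //=; lra.
rewrite -[leRHS]mulr1; apply: ler_wpM2l; last by lra.
by rewrite divr_ge0 ?(ltW t0) // exprn_ge0 // ltW.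
Qed.

End Goursat.

(** * Mean values, Cauchy's estimate and uniform limits *)

Section Cauchy.
Variable R : realType.
Local Notation C := (R[i]^o).
Implicit Types (f g : C -> C) (c z w d : C).

Definition cderiv f z : C := xget 0 [set d | cdiff f z d].

Lemma cderivP f z : differentiable f z -> cdiff f z (cderiv f z).
Proof.
move=> /cdiff_differentiable[d fd]; rewrite /cderiv; case: xgetP => [y _ //|].
by move/(_ d).
Qed.

Lemma cdiffB f g z d e : cdiff f z d -> cdiff g z e -> cdiff (fun w => f w - g w) z (d - e).
Proof.
move=> fd ge k k0; have k2 : 0 < k / 2 by lra.
apply: (near_imply2 (fd _ k2) (ge _ k2)) => w h1 h2.
have -> : f w - g w - (f z - g z) - (w - z) * (d - e) =
  (f w - f z - (w - z) * d) - (g w - g z - (w - z) * e) by ring.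
by apply: le_trans (nrmD _ _) _; rewrite nrmN; lra.
Qed.

Lemma cdiff_lipschitz f c d (rho K : R) : 0 < rho -> cdiff f c d ->
  (forall z, nrm (z - c) < rho -> nrm (f z - f c) <= K * nrm (z - c)) -> nrm d <= K.
Proof.
move=> rho0 fd fK; apply/ler_addgt0Pr => e e0.
have [q q0 qP] := (nbhs_nrm _ _).1 (fd e e0).
have [m [m0 mq mr]] : exists m : R, [/\ 0 < m, m < q & m < rho].
  have mm : 0 < Num.min q rho by rewrite lt_min q0.
  have mq : Num.min q rho <= q by rewrite ge_min lexx.
  have mr : Num.min q rho <= rho by rewrite ge_min lexx orbT.
  by exists (Num.min q rho / 2); split; lra.
pose z : C := c + m%:C.
have zc : z - c = m%:C by rewrite /z addrAC subrr add0r.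
have nz : nrm (z - c) = m by rewrite zc nrm_pos // ltW.
have h1 := qP z; have h2 := fK z; rewrite nz in h1 h2.
have {}h1 := h1 mq; have {}h2 := h2 mr.
have h3 : m * nrm d <= nrm (f z - f c) + nrm (f z - f c - (z - c) * d).
  have := nrmBl ((z - c) * d) (f z - f c); rewrite (nrmB ((z - c) * d)) nrmM nz; lra.
by rewrite -(@ler_pM2l _ m) //; lra.
Qed.

Lemma unit_rotation d : exists a : C, a * d = (nrm d)%:C /\ nrm a = 1.
Proof.
have [->|d0] := eqVneq d 0; first by exists 1; rewrite mulr0 nrm0 nrm1.
have nd : 0 < nrm d by rewrite nrm_gt0.
exists (conjc d / (nrm d)%:C); split; last first.
  by rewrite nrmM nrmV nrm_conjc (nrm_pos (ltW nd)) divff // gt_eqF.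
rewrite mulrAC [conjc d * d]mulrC -nrm2_conjc rmorphXn /= expr2 mulfK //.
by apply/eqP => /(congr1 (@complex.Re R)) /= h; rewrite h ltxx in nd.
Qed.

(** Points are written c + exp (x + i y): for fixed x this parametrises a circle
    around c, and Goursat's lemma on rectangles in the (x, y)-plane compares
    the means over two circles, the horizontal sides cancelling by periodicity. As
    x tends to - oo the mean tends to l. The puncture makes the theorem applicable
    to difference quotients. *)
Theorem mean_value_punctured f c (l : C) (r : R) : 0 < r ->
  (forall z, z != c -> nrm (z - c) <= r -> differentiable f z) ->
  (forall e : R, 0 < e -> exists2 k : R, 0 < k &
     forall z, z != c -> nrm (z - c) < k -> nrm (f z - l) < e) ->
  itg 0 (2 * pi) (fun t => complex.Re (f (c + r%:C * cexp (t *i)))) = 2 * pi * complex.Re l.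
Proof.
move=> r0 fd fl; have pi0 := pi_gt0 R.
(* truncating x at X keeps E p in the closed disc for all p in the plane *)
pose X := ln r; pose E (p : R * R) : C := c + cexp (Num.min p.1 X +i* p.2).
have Ec p : E q @[q --> p] --> E p.
  have c1 : Num.min q.1 X @[q --> p] --> Num.min p.1 X.
    have h := @continuous_min R (R * R)%type (fun q => q.1) (fun=> X) p.
    by apply: h; [exact: cvg_fst_at|exact: cvg_cst].
  have c2 : (fun q : R * R => Num.min q.1 X +i* q.2 : C) @ p --> (Num.min p.1 X +i* p.2 : C).
    exact: cvg_complex c1 (cvg_snd_at p).
  exact: (cvgD (cvg_cst_at c) (cvg_cexp c2)).
have nE p : nrm (E p - c) = expR (Num.min p.1 X).
  by rewrite /E addrAC subrr add0r nrm_cexp.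
have E0 p : E p != c by rewrite -subr_eq0 -nrm_gt0 nE expR_gt0.
have Er p : nrm (E p - c) <= r.
  by rewrite nE -[leRHS](lnK (x := r)) ?posrE // ler_expR ge_min lexx orbT.
pose phi p := f (E p).
have phic p : phi q @[q --> p] --> phi p.
  exact: cvg_comp_at (Ec p) (differentiable_continuous (fd _ (E0 p) (Er p))).
pose u p := complex.Re (phi p); pose v p := complex.Im (phi p).
have uc : continuous u by move=> p; exact: cvg_Re (phic p).
have vc : continuous v by move=> p; exact: cvg_Im (phic p).
have circles x1 : x1 < X -> itg 0 (2 * pi) (fun y => u (X, y)) = itg 0 (2 * pi) (fun y => u (x1, y)).
  move=> x1X; have w0 : 0 < X - x1 by lra.
  have h0 : 0 < 2 * pi :> R by lra.
  have dphi x y : in_rect x1 0 (X - x1) (2 * pi) (x, y) -> exists p q : R,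
    forall e : R, 0 < e -> exists2 d : R, 0 < d & forall x' y', in_rect x1 0 (X - x1) (2 * pi) (x', y') ->
    `|x' - x| < d -> `|y' - y| < d ->
    `|u (x', y') - (u (x, y) + p * (x' - x) - q * (y' - y))| <= e * (`|x' - x| + `|y' - y|) /\
    `|v (x', y') - (v (x, y) + q * (x' - x) + p * (y' - y))| <= e * (`|x' - x| + `|y' - y|).
    move=> [/= /andP[xa xb] _].
    have minE x' y' : in_rect x1 0 (X - x1) (2 * pi) (x', y') -> E (x', y') = c + cexp (x' +i* y').
      by move=> [/= /andP[_ h] _]; rewrite /E /= min_l //; lra.
    pose z : C := x +i* y.
    have Fd : differentiable (fun w : C => f (c + cexp w)) z.
      have Ez : E (x, y) = c + cexp z by rewrite /E /= min_l //; lra.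
      have d1 : differentiable (fun w : C => cexp w + c) z.
        by apply: differentiable_addc; exact: differentiable_cexp.
      have d2 : differentiable f (cexp z + c).
        by rewrite addrC -Ez; apply: fd; [exact: E0|exact: Er].
      have -> : (fun w : C => f (c + cexp w)) = f \o (fun w => cexp w + c).
        by apply/funext => w /=; rewrite addrC.
      exact: (differentiable_comp d1 d2).
    have [d dP] := (cdiff_differentiable _ _).2 Fd.
    exists (complex.Re d), (complex.Im d) => e e0.
    have [k k0 kP] := (nbhs_nrm _ _).1 (dP e e0).
    exists (k / 2); first lra.
    move=> x' y' inR hx hy; pose z' : C := x' +i* y'.
    have zz : nrm (z' - z) <= `|x' - x| + `|y' - y| by exact: nrm_le.
    have := kP z'; rewrite /= -(minE _ _ inR).
    have -> : c + cexp z = E (x, y) by rewrite /E /= min_l //; lra.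
    rewrite -/(phi (x', y')) -/(phi (x, y)) => /(_ _) hh.
    have {hh}h : nrm (phi (x', y') - phi (x, y) - (z' - z) * d) <= e * (`|x' - x| + `|y' - y|).
      apply: le_trans (hh _) _; first by apply: le_lt_trans zz _; lra.
      by rewrite ler_pM2l.
    have hr := le_trans (Re_le _) h; have hi := le_trans (Im_le _) h.
    rewrite !ReD !ReN ReM in hr; rewrite !ImD !ImN ImM in hi; rewrite /= in hr hi.
    split; [move: hr; congr (`|_| <= _); rewrite /u; ring|move: hi; congr (`|_| <= _); rewrite /v; ring].
  have := goursat uc vc w0 h0 dphi.
  rewrite /boundary_itg add0r (_ : x1 + (X - x1) = X); last by ring.
  have per x : v (x, 0) = v (x, 2 * pi).
    rewrite /v /phi /E /=; congr (complex.Im (f (c + _))).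
    by rewrite -cexp_2pi; congr cexp; apply: complexP; rewrite /= ?addr0 ?add0r.
  have -> : itg x1 X (fun x => v (x, 0) - v (x, 2 * pi)) = 0.
    rewrite (@eq_itg R x1 X _ (fun=> 0)); first by rewrite itg_cst ?mul0r ?ltW.
    by move=> x _; rewrite per subrr.
  rewrite addr0 itgB; [|exact: slice2_cts|exact: slice2_cts].
  by move/eqP; rewrite subr_eq0 => /eqP.
have -> : itg 0 (2 * pi) (fun t => complex.Re (f (c + r%:C * cexp (t *i)))) = itg 0 (2 * pi) (fun y => u (X, y)).
  apply: eq_itg => t _; rewrite /u /phi /E /= min_l //; congr (complex.Re (f (c + _))).
  have -> : X +i* t = X%:C + t *i :> C by apply: complexP; rewrite /= ?addr0 ?add0r.
  rewrite cexpD; congr (_ * _); apply: complexP; rewrite /= ?cos0 ?sin0 ?mulr0 //.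
  by rewrite mulr1 lnK ?posrE.
apply/eqP; rewrite -subr_eq0 -normr_le0; apply/ler_addgt0Pr => /= e e0; rewrite add0r.
have e1 : 0 < e / (2 * pi) by apply: divr_gt0 => //; lra.
have [k k0 kP] := fl _ e1.
pose x1 := Num.min (X - 1) (ln (k / 2)).
have x1X : x1 < X by rewrite /x1 gt_min; apply/orP; left; lra.
have x1k : expR x1 < k.
  apply: (@le_lt_trans _ _ (k / 2)); last by lra.
  by rewrite -[leRHS]lnK ?posrE ?divr_gt0 // ler_expR /x1 ge_min lexx orbT.
rewrite (circles x1) //.
have -> : 2 * pi * complex.Re l = itg 0 (2 * pi) (fun=> complex.Re l).
  by rewrite itg_cst ?subr0; [ring|lra].
rewrite -itgB; [|exact: slice2_cts|by move=> t; exact: cvg_cst].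
apply: le_trans (@itg_bound R 0 (2 * pi) _ (e / (2 * pi)) _ _ _) _; first lra.
- by move=> t; apply: cvgB; [exact: slice2_cts|exact: cvg_cst].
- move=> y _; rewrite /u -ReN -ReD; apply: le_trans (Re_le _) _; apply: ltW.
  apply: kP; first exact: E0.
  by rewrite nE /= min_l // ltW.
- by rewrite subr0 divfK // gt_eqF //; lra.
Qed.

Lemma mean_value f c (r : R) : 0 < r ->
  (forall z, nrm (z - c) <= r -> differentiable f z) ->
  itg 0 (2 * pi) (fun t => complex.Re (f (c + r%:C * cexp (t *i)))) = 2 * pi * complex.Re (f c).
Proof.
move=> r0 fd; apply: mean_value_punctured => // [z _|e e0]; first exact: fd.
have fc : f z @[z --> c] --> f c.
  by apply: (differentiable_continuous (fd c _)); rewrite subrr nrm0 ltW.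
have [k k0 kP] := (nbhs_nrm _ _).1 (cvg_lt_nrm fc e0).
by exists k => // z _; exact: kP.
Qed.

Lemma circle_cts f c (r : R) : 0 < r ->
  (forall z, nrm (z - c) = r -> f w @[w --> z] --> f z) ->
  continuous (fun t : R => f (c + r%:C * cexp (t *i))).
Proof.
move=> r0 fc t.
have c1 : (fun t : R => c + r%:C * cexp (t *i) : C) @ t --> (c + r%:C * cexp (t *i) : C).
  have c2 : (fun t : R => t *i : C) @ t --> (t *i : C).
    exact: (cvg_complex (cvg_cst_at (0 : R)) (cvg_id_at t)).
  exact: (cvgD (cvg_cst_at c) (cvgM (cvg_cst_at (r%:C : C)) (cvg_cexp c2))).
apply: (cvg_comp_at c1); apply: fc.
by rewrite addrAC subrr add0r nrmM nrm_cexp /= expR0 mulr1 nrm_pos // ltW.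
Qed.

(** Cauchy's estimate: the difference quotient of f at c has mean value d on the
    circle, and is bounded there by M / r. *)
Lemma cauchy_bound f c d (r M : R) : 0 < r -> cdiff f c d ->
  (forall z, nrm (z - c) <= r -> differentiable f z) ->
  (forall z, nrm (z - c) = r -> nrm (f z - f c) <= M) -> nrm d <= M / r.
Proof.
move=> r0 fdd fd fM; have pi0 := pi_gt0 R.
have [->|d0] := eqVneq d 0.
  rewrite nrm0 divr_ge0 ?(ltW r0) //.
  have := fM (c + r%:C); rewrite addrAC subrr add0r nrm_pos ?(ltW r0) // => /(_ erefl).
  by apply: le_trans; exact: nrm_ge0.
have nd : 0 < nrm d by rewrite nrm_gt0.
have [al [ald nal]] := unit_rotation d.
pose G z : C := al * ((f z - f c) / (z - c)).
have Gd z : z != c -> nrm (z - c) <= r -> differentiable G z.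
  move=> zc zr; have d1 : differentiable (fun w => f w - f c) z.
    by apply: differentiable_addc; exact: fd.
  have d2 : differentiable (fun w : C => (w - c)^-1) z.
    apply: (@differentiableV _ _ (fun w : C => w - c)); last by rewrite subr_eq0.
    by apply: differentiable_addc; exact: differentiable_idfun.
  have -> : G = (fun w => ((f w - f c) * (w - c)^-1) * al).
    by apply/funext => w; rewrite /G mulrC.
  exact: (differentiable_cmul al (differentiableM d1 d2)).
have Gl (e : R) : 0 < e -> exists2 k : R, 0 < k &
     forall z, z != c -> nrm (z - c) < k -> nrm (G z - (nrm d)%:C) < e.
  move=> e0; have e2 : 0 < e / 2 by lra.
  have [k k0 kP] := (nbhs_nrm _ _).1 (fdd _ e2).
  exists k => // z zc zk; have h := kP z zk.
  have zc0 : z - c != 0 by rewrite subr_eq0.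
  have -> : G z - (nrm d)%:C = al * (f z - f c - (z - c) * d) / (z - c).
    by rewrite -ald /G; field.
  have zp : 0 < nrm (z - c) by rewrite nrm_gt0.
  rewrite !nrmM nal mul1r nrmV ltr_pdivrMr //; apply: le_lt_trans h _.
  by rewrite ltr_pM2r //; lra.
have := mean_value_punctured r0 Gd Gl.
have Gc : continuous (fun t : R => G (c + r%:C * cexp (t *i))).
  apply: circle_cts => // z zr; apply: (differentiable_continuous (Gd z _ _)); last by rewrite zr.
  by rewrite -subr_eq0 -nrm_gt0 zr.
move=> mv; rewrite -(@ler_pM2l _ (2 * pi)); last by lra.
rewrite -[nrm d]/(complex.Re ((nrm d)%:C : C)) -mv.
have -> : 2 * pi * (M / r) = itg 0 (2 * pi) (fun=> M / r).
  by rewrite itg_cst ?subr0; [ring|lra].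
apply: itg_le => [t|t|t _].
- exact: cvg_Re (Gc t).
- exact: cvg_cst.
- apply: le_trans (ler_norm _) _; apply: le_trans (Re_le _) _.
  have nr : nrm (c + r%:C * cexp (t *i) - c) = r.
    by rewrite addrAC subrr add0r nrmM nrm_cexp /= expR0 mulr1 nrm_pos // ltW.
  rewrite /G !nrmM nal mul1r nrmV nr.
  by rewrite ler_pM2r ?invr_gt0 //; apply: fM.
Qed.

Lemma real_is_derive (g : R -> R) (t d : R) :
  (forall e : R, 0 < e -> \forall s \near t, `|g s - g t - (s - t) * d| <= e * `|s - t|) ->
  is_derive t 1 g d.
Proof.
move=> H.
have cv : h^-1 *: (g (h *: 1 + t) - g t) @[h --> (0:R)^'] --> d.
  apply/cvgrPdist_lt => e e0; have e2 : 0 < e / 2 by lra.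
  have /nbhs_ballP[k /= k0 kP] := H _ e2.
  near=> h.
  have h0 : h != 0 by near: h; exact: nbhs_dnbhs_neq.
  have hk : `|h| < k by near: h; exact: dnbhs0_lt.
  have := kP (h + t); rewrite /ball /= opprD addrCA subrr addr0 normrN => /(_ hk).
  rewrite addrK [_ *: 1]mulr1 => hh.
  have -> : d - h^-1 *: (g (h + t) - g t) = - (h^-1 * (g (h + t) - g t - h * d)).
    by rewrite /GRing.scale /=; field.
  rewrite normrN normrM normfV mulrC ltr_pdivrMr ?normr_gt0 //.
  by apply: le_lt_trans hh _; rewrite ltr_pM2r ?normr_gt0 //; lra.
apply: DeriveDef; first by apply/cvg_ex; exists d.
exact/cvg_lim.
Unshelve. all: by end_near. Qed.

(** The mean value theorem for the real part of a rotate of f along [a, b]. *)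
Lemma mean_value_inequality f (f' : C -> C) (a b : C) (K : R) :
  (forall t : R, 0 <= t <= 1 -> cdiff f (a + t%:C * (b - a)) (f' (a + t%:C * (b - a)))) ->
  (forall t : R, 0 <= t <= 1 -> nrm (f' (a + t%:C * (b - a))) <= K) ->
  nrm (f b - f a) <= K * nrm (b - a).
Proof.
move=> fd fK.
have [fab|fab] := eqVneq (f b - f a) 0.
  rewrite fab nrm0 mulr_ge0 ?nrm_ge0 //; apply: le_trans (fK 0 _); first exact: nrm_ge0.
  by rewrite lexx ler01.
have nd : 0 < nrm (f b - f a) by rewrite nrm_gt0.
have [al [ald nal]] := unit_rotation (f b - f a).
pose p (t : R) : C := a + t%:C * (b - a).
pose g t := complex.Re (al * f (p t)).
pose g' t := complex.Re (al * f' (p t) * (b - a)).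
have pp s t : p s - p t = (s - t)%:C * (b - a) by rewrite /p rmorphB; ring.
have npp s t : nrm (p s - p t) = `|s - t| * nrm (b - a) by rewrite pp nrmM nrm_real.
have gd (t : R) : 0 <= t <= 1 -> is_derive t 1 g (g' t).
  move=> t01; apply: real_is_derive => e e0; have b0 := nrm_ge0 (b - a).
  have e1 : 0 < e / (nrm (b - a) + 1) by apply: divr_gt0; lra.
  have [k k0 kP] := (nbhs_nrm _ _).1 (fd t t01 _ e1).
  have k1 : 0 < k / (nrm (b - a) + 1) by apply: divr_gt0; lra.
  apply/nbhs_ballP; exists (k / (nrm (b - a) + 1)) => // s; rewrite /ball /= distrC => st.
  have {}st : `|s - t| * (nrm (b - a) + 1) < k by rewrite -ltr_pdivlMr //; lra.
  have := kP (p s); rewrite -/(p t) npp => /(_ _) h.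
  have {}h := h (le_lt_trans _ st).
  have -> : g s - g t - (s - t) * g' t = complex.Re (al * (f (p s) - f (p t) - (p s - p t) * f' (p t))).
    rewrite pp /g /g'.
    have -> : (s - t) * complex.Re (al * f' (p t) * (b - a)) = complex.Re ((s - t)%:C * (al * f' (p t) * (b - a))).
      by rewrite [RHS]ReM /= mul0r subr0.
    by rewrite -!ReN -!ReD; congr complex.Re; ring.
  apply: le_trans (Re_le _) _; rewrite nrmM nal mul1r.
  apply: le_trans (h _) _; first by rewrite ler_wpM2l //; lra.
  have en : e / (nrm (b - a) + 1) * nrm (b - a) <= e.
    by rewrite mulrAC ler_pdivrMr; nra.
  by rewrite mulrCA [leRHS]mulrC; apply: ler_wpM2l.
have [t||s s01] := @MVT_segment R g g' 0 1 ler01.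
- by rewrite in_itv /= => /andP[t0 t1]; apply: gd; rewrite !ltW.
- apply: derivable_within_continuous => t; rewrite in_itv /= => t01.
  by have [] := gd t t01.
move: s01; rewrite in_itv /= => s01; rewrite subr0 mulr1 => gE.
have p1 : p 1 = b by rewrite /p mul1r addrC subrK.
have p0 : p 0 = a by rewrite /p mul0r addr0.
have <- : g 1 - g 0 = nrm (f b - f a).
  by rewrite /g p1 p0 -ReN -ReD -mulrBr ald.
rewrite gE; apply: le_trans (ler_norm _) _; apply: le_trans (Re_le _) _.
rewrite !nrmM nal mul1r; apply: ler_wpM2r; first exact: nrm_ge0.
exact: fK.
Qed.

(** A crude Schwarz lemma: Cauchy's estimate bounds the derivative. *)
Lemma schwarz_weak f c (rho M : R) : 0 < rho ->
  (forall z, nrm (z - c) < rho -> differentiable f z) ->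
  (forall z w, nrm (z - c) < rho -> nrm (w - c) < rho -> nrm (f z - f w) <= M) ->
  forall z, nrm (z - c) < rho / 2 -> nrm (f z - f c) <= 2 * M / rho * nrm (z - c).
Proof.
move=> rho0 fd fM z zc.
have seg (t : R) : 0 <= t <= 1 -> nrm (c + t%:C * (z - c) - c) < rho / 2.
  move=> /andP[t0 t1]; rewrite addrAC subrr add0r nrmM nrm_pos //.
  by apply: le_lt_trans zc; rewrite ler_piMl ?nrm_ge0.
have r2 : 0 < rho / 2 by lra.
apply: (@mean_value_inequality f (cderiv f)) => t /seg sg.
  by apply: cderivP; apply: fd; lra.
have near_in w : nrm (w - (c + t%:C * (z - c))) <= rho / 2 -> nrm (w - c) < rho.
  by move=> h; have := nrm_tri w (c + t%:C * (z - c)) c; lra.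
have -> : 2 * M / rho = M / (rho / 2) by field; rewrite gt_eqF.
apply: (@cauchy_bound f (c + t%:C * (z - c)) _ (rho / 2) M) => //.
- by apply: cderivP; apply: fd; lra.
- by move=> w /near_in; exact: fd.
- by move=> w h; apply: fM; [apply: near_in; rewrite h|lra].
Qed.

(** By the Schwarz lemma the differences f j - f k, hence g - f k, satisfy Lipschitz
    bounds at c with small constants. So the derivatives at c are bounded, and a
    cluster point of them is the derivative of g. *)
Lemma weierstrass (f : nat -> C -> C) g c (rho : R) : 0 < rho ->
  (forall k z, nrm (z - c) < rho -> differentiable (f k) z) ->
  (forall e : R, 0 < e -> exists N, forall k z, (N <= k)%N -> nrm (z - c) < rho ->
     nrm (f k z - g z) < e) -> differentiable g c.
Proof.
move=> rho0 fd fg.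
have r2 : 0 < rho / 2 by lra.
have cin : nrm (c - c) < rho by rewrite subrr nrm0.
have lip (e : R) : 0 < e -> exists N, forall j k z, (N <= j)%N -> (N <= k)%N ->
    nrm (z - c) < rho / 2 ->
    nrm ((f j z - f k z) - (f j c - f k c)) <= e * nrm (z - c).
  move=> e0; have e1 : 0 < e * rho / 8 by apply: divr_gt0 => //; exact: mulr_gt0.
  have [N NP] := fg _ e1; exists N => j k z Nj Nk zc.
  have -> : e = 2 * (4 * (e * rho / 8)) / rho by field; rewrite gt_eqF.
  apply: (@schwarz_weak (fun w => f j w - f k w) c rho (4 * (e * rho / 8)) rho0) => //.
  - move=> w wc; exact: (differentiableB (fd j w wc) (fd k w wc)).
  - move=> w w' wc wc'.
    have h1 := NP j w Nj wc; have h2 := NP k w Nk wc; have h3 := NP j w' Nj wc'; have h4 := NP k w' Nk wc'.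
    have -> : f j w - f k w - (f j w' - f k w') =
      ((f j w - g w) - (f k w - g w)) - ((f j w' - g w') - (f k w' - g w')) by ring.
    apply: le_trans (nrmD _ _) _; rewrite nrmN.
    have := nrmD (f j w - g w) (- (f k w - g w)); have := nrmD (f j w' - g w') (- (f k w' - g w')).
    by rewrite !nrmN; lra.
pose d k := cderiv (f k) c.
have dP k : cdiff (f k) c (d k) by apply: cderivP; exact: fd.
have lipg (e : R) : 0 < e -> exists N, forall k z, (N <= k)%N -> nrm (z - c) < rho / 2 ->
    nrm ((g z - f k z) - (g c - f k c)) <= e * nrm (z - c).
  move=> e0; have [N NP] := lip e e0; exists N => k z Nk zc.
  apply/ler_addgt0Pr => t t0; have t2 : 0 < t / 2 by lra.
  have [N' NP'] := fg _ t2; pose j := maxn N N'.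
  have zr : nrm (z - c) < rho by lra.
  have h1 := NP' j z (leq_maxr _ _) zr; have h2 := NP' j c (leq_maxr _ _) cin.
  have h3 := NP j k z (leq_maxl _ _) Nk zc.
  have -> : g z - f k z - (g c - f k c) =
    (f j z - f k z - (f j c - f k c)) - ((f j z - g z) - (f j c - g c)) by ring.
  apply: le_trans (nrmD _ _) _; rewrite nrmN.
  by have := nrmD (f j z - g z) (- (f j c - g c)); rewrite nrmN; lra.
have [N1 lip1] := lip 1 ltr01.
have dbound k : (N1 <= k)%N -> nrm (d k) <= nrm (d N1) + 1.
  move=> Nk; rewrite -lerBlDl; apply: le_trans (nrmBl _ _) _.
  apply: (cdiff_lipschitz r2 (cdiffB (dP k) (dP N1))) => z zc.
  exact: lip1.
have dF : (d k @[k --> \oo]) [set w | nrm w <= nrm (d N1) + 1].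
  by exists N1 => // k /=; exact: dbound.
have [l [_ lcl]] := @compact_disc R (nrm (d N1) + 1) (d k @[k --> \oo]) _ dF.
have cl (e : R) N : 0 < e -> exists2 k, (N <= k)%N & nrm (d k - l) < e.
  move=> e0; have A : (d k @[k --> \oo]) [set w | exists2 k, (N <= k)%N & w = d k].
    by exists N => // k Nk; exists k.
  by have [w [[k Nk ->] kl]] := lcl _ _ A (near_nrm l e0); exists k.
apply/cdiff_differentiable; exists l => e e0; have e3 : 0 < e / 3 by lra.
have [N NP] := lipg _ e3; have [k Nk kl] := cl _ N e3.
apply: (near_imply2 (dP k _ e3) (near_nrm c r2)) => z h1 zc.
have h2 := NP k z Nk zc; have zz := nrm_ge0 (z - c).
have h3 : nrm ((z - c) * (d k - l)) <= e / 3 * nrm (z - c).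
  by rewrite nrmM mulrC; apply: ler_wpM2r => //; exact: ltW.
have -> : g z - g c - (z - c) * l = (g z - f k z - (g c - f k c)) +
  (f k z - f k c - (z - c) * d k) + (z - c) * (d k - l) by ring.
apply: le_trans (nrmD _ _) _.
have := nrmD (g z - f k z - (g c - f k c)) (f k z - f k c - (z - c) * d k); lra.
Qed.

End Cauchy.

(** * The Caratheodory pseudodistance *)

Section CaratheodoryGeneral.
Variables (R : realType) (V : normedModType R[i]) (A : set V).
Local Notation C := (R[i]^o).
Implicit Types (f : V -> C) (x y z w : V).

(** The Caratheodory pseudodistance on a subset of any normed module; it covers
    the unit disc as well as domains of row vectors. *)
Definition cara z w : \bar R :=
  ereal_sup [set (poincare_dist (f z) (f w))%:E |
              f in [set f : V -> C | holomorphic_map A unit_disc f]].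

Lemma hol_disc f z : holomorphic_map A unit_disc f -> A z -> nrm (f z) < 1.
Proof. by move=> [_ h] Az; apply/unit_discE; exact: h. Qed.

Lemma cara_ubound f z w : holomorphic_map A unit_disc f ->
  ((poincare_dist (f z) (f w))%:E <= cara z w)%E.
Proof. by move=> hf; apply: ereal_sup_ubound; exists f. Qed.

Lemma cara_le z w (r : \bar R) :
  (forall f, holomorphic_map A unit_disc f -> ((poincare_dist (f z) (f w))%:E <= r)%E) ->
  (cara z w <= r)%E.
Proof. by move=> h; apply: ge_ereal_sup => _ [f hf <-]; exact: h. Qed.

Lemma hol0 : holomorphic_map A unit_disc (fun=> 0 : C).
Proof.
by split=> z _; [exact: differentiable_cst|apply/unit_discE; rewrite nrm0 ltr01].
Qed.

Lemma cara_ge0 z w : (0 <= cara z w)%E.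
Proof.
apply: le_trans (cara_ubound z w hol0).
by rewrite lee_fin poincareE artanh_ge0 // phyp_ge0 phyp_lt1 ?nrm0 ?ltr01.
Qed.

Lemma caraC z w : cara z w = cara w z.
Proof.
by rewrite /cara; congr ereal_sup; apply/seteqP; split=> _ [f hf <-]; exists f => //;
  rewrite !poincareE phypC.
Qed.

Lemma cara_self z : cara z z = 0%E.
Proof.
apply/eqP; rewrite eq_le cara_ge0 andbT; apply: cara_le => f _.
by rewrite poincareE phyp_self artanh0.
Qed.

Lemma cara_triangle x y z : A x -> A y -> A z -> (cara x z <= cara x y + cara y z)%E.
Proof.
move=> Ax Ay Az; apply: cara_le => f hf.
apply: (@le_trans _ _ ((poincare_dist (f x) (f y))%:E + (poincare_dist (f y) (f z))%:E)%E).
  by rewrite -EFinD lee_fin; apply: poincare_triangle; exact: hol_disc.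
by apply: leeD; exact: cara_ubound.
Qed.

Lemma cara_phyp f z w (r : R) : holomorphic_map A unit_disc f -> A z -> A w -> 0 <= r ->
  (cara z w < r%:E)%E -> phyp (f z) (f w) < tnh r.
Proof.
move=> hf Az Aw r0 h; apply: artanh_lt_tnh => //.
  by apply: phyp_lt1; exact: hol_disc.
by rewrite -poincareE -lte_fin; apply: le_lt_trans (cara_ubound _ _ hf) h.
Qed.

(** The Schwarz lemma on the complex line through z and w; what matters is that the
    bound is the same for all f. *)
Lemma phyp_local z w (rho : R) f : 0 < rho -> (forall y, nrm (y - z) < rho -> A y) ->
  nrm (w - z) < rho / 2 -> holomorphic_map A unit_disc f ->
  phyp (f z) (f w) <= 4 * nrm (w - z) / rho.
Proof.
move=> rho0 ballA wz hf.
have [->|neq] := eqVneq w z.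
  by rewrite phyp_self subrr nrm0 mulr0 mul0r.
have h0 : 0 < nrm (w - z) by rewrite nrm_gt0 subr_eq0.
have Az : A z by apply: ballA; rewrite subrr nrm0.
have fz1 := hol_disc hf Az.
pose rr := rho / nrm (w - z).
have rr0 : 0 < rr by rewrite divr_gt0.
pose line (t : C) : V := z + t *: (w - z).
have lineA (t : C) : nrm (t - 0) < rr -> A (line t).
  rewrite subr0 => tr; apply: ballA; rewrite /line addrAC subrr add0r nrmZ.
  by rewrite -ltr_pdivlMr.
have lined (t : C) : differentiable line t.
  have d1 : differentiable (fun t : C => t *: (w - z)) t.
    exact: (@differentiableZl _ _ _ (fun t : C => t) (w - z) t (differentiable_idfun t)).
  exact: (differentiableD (differentiable_cst z t) d1).
pose phi (t : C) : C := mobius (f z) (f (line t)).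
have phid (t : C) : nrm (t - 0) < rr -> differentiable phi t.
  move=> tr; have d1 := differentiable_comp (lined t) (hf.1 _ (lineA t tr)).
  exact: (differentiable_comp d1 (differentiable_mobius fz1 (hol_disc hf (lineA t tr)))).
have phi1 (t : C) : nrm (t - 0) < rr -> nrm (phi t) < 1.
  move=> tr; rewrite /phi nrm_mobius; apply: phyp_lt1 => //.
  exact: hol_disc hf (lineA t tr).
have := @schwarz_weak R phi 0 rr 2 rr0 phid.
have b s t : nrm (s - 0 : C) < rr -> nrm (t - 0 : C) < rr -> nrm (phi s - phi t) <= 2.
  move=> sr tr; apply: le_trans (nrmD _ _) _; rewrite nrmN.
  by have := phi1 s sr; have := phi1 t tr; lra.
move=> /(_ b 1); rewrite !subr0 nrm1 mulr1 => /(_ _) h.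
have -> : 4 * nrm (w - z) / rho = 2 * 2 / rr by rewrite /rr; field; rewrite !gt_eqF.
have phi0 : phi 0 = 0 by rewrite /phi /line scale0r addr0 /mobius subrr mul0r.
have phi11 : nrm (phi 1) = phyp (f z) (f w).
  by rewrite /phi /line scale1r nrm_mobius addrC subrK.
rewrite -phi11 -[phi 1]subr0 -phi0; apply: h.
rewrite /rr; have -> : rho / nrm (w - z) / 2 = (rho / 2) / nrm (w - z) by rewrite mulrAC.
by rewrite ltr_pdivlMr // mul1r.
Qed.

Hypothesis openA : open A.

Lemma cara_near z (e : R) : A z -> 0 < e -> \forall w \near z, (cara z w < e%:E)%E.
Proof.
move=> Az e0; have [rho rho0 ballA] := (open_nrm _).1 openA z Az.
have e2 : 0 < e / 2 by lra.
have t0 := tnh_gt0 e2.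
apply/nbhs_nrm; exists (Num.min (rho / 2) (rho * tnh (e / 2) / 4)).
  by rewrite lt_min; apply/andP; split; [lra|apply: divr_gt0 => //; exact: mulr_gt0].
move=> w; rewrite lt_min => /andP[w1 w2].
apply: (@le_lt_trans _ _ (e / 2)%:E); last by rewrite lte_fin; lra.
apply: cara_le => f hf; rewrite lee_fin poincareE; apply: ltW.
apply: lt_tnh_artanh; first exact: phyp_ge0.
apply: le_lt_trans (phyp_local rho0 ballA w1 hf) _.
by rewrite ltr_pdivrMr //; lra.
Qed.

Hypothesis connectedA : connected A.

(** Being at finite distance from z is a locally constant property. *)
Lemma cara_lty z w : A z -> A w -> (cara z w < +oo)%E.
Proof.
move=> Az Aw.
have E : (cara z z < +oo)%E = (cara z w < +oo)%E.
  apply: (locally_constant_connected (f := fun w => (cara z w < +oo)%E) connectedA) => // x Ax.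
  have n1 : \forall y \near x, (cara x y < 1%:E)%E by apply: cara_near; rewrite ?ltr01.
  apply: (near_imply n1) => y xy Ay; apply/idP/idP => h.
    apply: le_lt_trans (cara_triangle Az Ay Ax) _.
    by rewrite lte_add_pinfty // caraC; apply: lt_trans xy _; exact: ltry.
  apply: le_lt_trans (cara_triangle Az Ax Ay) _.
  by rewrite lte_add_pinfty //; apply: lt_trans xy _; exact: ltry.
by rewrite -E cara_self ltry.
Qed.

Lemma cara_fin z w : A z -> A w -> cara z w \is a fin_num.
Proof. by move=> Az Aw; rewrite ge0_fin_numE ?cara_ge0 // cara_lty. Qed.

End CaratheodoryGeneral.

Lemma cara_contract {R : realType} {V W : normedModType R[i]} (A : set V) (B : set W)
    (F : W -> V) z w : holomorphic_map B A F ->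
  (cara A (F z) (F w) <= cara B z w)%E.
Proof.
move=> [Fd FA]; apply: cara_le => f [fd f1].
apply: (@cara_ubound R W B (f \o F)); split=> x Bx; last exact: f1 (FA _ Bx).
exact: (differentiable_comp (Fd x Bx) (fd _ (FA _ Bx))).
Qed.

(** * Finite compactness and completeness *)

Section CFiniteCompact.
Variables (R : realType) (n : nat).
Local Notation C := (R[i]^o).
Local Notation V := ('rV[R[i]^o]_n).
Variable D : set V.
Hypotheses (dD : domain D) (cD : C_convex D).

(** By phyp_sqr; with a fixed, the bound keeps b away from the unit circle. *)
Lemma phyp_far (a b : C) (tau : R) : nrm a < 1 -> nrm b < 1 -> 0 <= tau ->
  phyp a b < tau -> (1 - tau ^+ 2) * (1 - nrm a) ^+ 2 <= 1 - nrm b ^+ 2.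
Proof.
move=> a1 b1 t0 ht; have a0 := nrm_ge0 a; have b0 := nrm_ge0 b; have p0 := phyp_ge0 a b.
have d0 := disc_den_gt0 a1 b1.
have dl : 1 - nrm a <= nrm (1 - conjc a * b : C).
  have := nrmBl (1 : C) (conjc a * b); rewrite nrm1 nrmM nrm_conjc.
  have : nrm a * nrm b <= nrm a by rewrite ler_piMr // ltW.
  lra.
have e := phyp_sqr a1 b1.
have h1 : 1 - tau ^+ 2 <= 1 - phyp a b ^+ 2 by nra.
have h2 : (1 - phyp a b ^+ 2) * nrm (1 - conjc a * b : C) ^+ 2 = (1 - nrm a ^+ 2) * (1 - nrm b ^+ 2).
  by rewrite e divfK // expf_neq0 // gt_eqF.
have h3 : (1 - nrm a) ^+ 2 <= nrm (1 - conjc a * b : C) ^+ 2 by rewrite ler_pXn2r ?nnegrE //; lra.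
have p1 := phyp_lt1 a1 b1.
have h4 : 0 <= 1 - phyp a b ^+ 2 by nra.
have h5 : (1 - nrm a ^+ 2) * (1 - nrm b ^+ 2) <= 1 - nrm b ^+ 2 by rewrite ler_piMl //; nra.
apply: le_trans h5; rewrite -h2.
apply: (@le_trans _ _ ((1 - phyp a b ^+ 2) * (1 - nrm a) ^+ 2)).
  by apply: ler_wpM2r => //; exact: sqr_ge0.
exact: ler_wpM2l.
Qed.

(** The Cayley transform takes the left half-plane to the disc and its point at
    infinity to the boundary point 1. *)
Definition cayley (z : C) : C := (z + 1) / (z - 1).

Lemma cayley_den (z : C) : complex.Re z < 0 -> z - 1 != 0.
Proof. by move=> z0; apply/eqP => /(congr1 (@complex.Re R)); rewrite ReD /=; lra. Qed.

Lemma cayley_disc (z : C) : complex.Re z < 0 ->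
  1 - nrm (cayley z) ^+ 2 = - 4 * complex.Re z / nrm (z - 1) ^+ 2.
Proof.
move=> z0; have d0 : 0 < nrm (z - 1) by rewrite nrm_gt0 cayley_den.
rewrite /cayley nrmM nrmV.
have -> : - 4 * complex.Re z = nrm (z - 1) ^+ 2 - nrm (z + 1) ^+ 2.
  by rewrite !nrm_sqr !ReD !ImD /=; ring.
by field; rewrite gt_eqF.
Qed.

Lemma cayley_lt1 (z : C) : complex.Re z < 0 -> nrm (cayley z) < 1.
Proof.
move=> z0; have d0 : 0 < nrm (z - 1) by rewrite nrm_gt0 cayley_den.
rewrite -(@ltr_pXn2r _ 2) ?nnegrE ?nrm_ge0 // expr1n -subr_gt0 cayley_disc //.
by apply: divr_gt0; [lra|rewrite exprn_gt0].
Qed.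

Lemma cayley_far (z : C) (del : R) : complex.Re z < 0 -> 0 < del ->
  del <= 1 - nrm (cayley z) ^+ 2 -> nrm z <= 4 / del.
Proof.
move=> z0 del0; have d0 : 0 < nrm (z - 1) by rewrite nrm_gt0 cayley_den.
have zz : nrm z <= nrm (z - 1).
  rewrite -(@ler_pXn2r _ 2) ?nnegrE ?nrm_ge0 // !nrm_sqr ReD ImD ReN ImN /= subr0.
  nra.
have rz : - complex.Re z <= nrm z by apply: le_trans (Re_le z); rewrite -normrN ler_norm.
rewrite cayley_disc // ler_pdivlMr ?exprn_gt0 // => h.
have z1 := nrm_ge0 z.
rewrite ler_pdivlMr //.
have h2 : del * nrm (z - 1) ^+ 2 <= 4 * nrm (z - 1) by apply: le_trans h _; lra.
have h3 : del * nrm (z - 1) <= 4 by rewrite -(@ler_pM2r _ (nrm (z - 1))) // -mulrA -expr2.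
by apply: le_trans h3; rewrite mulrC; apply: ler_wpM2l => //; exact: ltW.
Qed.

(** If L(D) misses a disc around q, u = rho / (2 (L - q)) is a nonvanishing
    function into the disc; the Cayley transform of log u takes D to the disc, and
    tends to 1, that is to infinity for the Poincare distance, as L does. *)
Lemma log_bounded_on_balls (L : V -> C) (q : C) (rho : R) z0 (r : R) :
  0 < rho -> holomorphic_on D L -> (forall z, D z -> rho <= nrm (L z - q)) ->
  D z0 -> 0 < r -> exists M : R, forall w, c_ball D z0 r w -> nrm (L w) <= M.
Proof.
move=> rho0 Ld Lq Dz0 r0; have [oD _ D0] := dD.
have Lq0 z : D z -> L z - q != 0.
  by move=> Dz; rewrite -nrm_gt0; exact: lt_le_trans (Lq z Dz).
pose u z : C := (rho / 2)%:C / (L z - q).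
have ud : holomorphic_on D u.
  move=> z Dz; have d1 : differentiable (fun w => (L w - q)^-1) z.
    apply: (@differentiableV _ _ (fun w => L w - q)); last exact: Lq0.
    by apply: differentiable_addc; exact: Ld.
  have -> : u = (fun w => (L w - q)^-1 * (rho / 2)%:C) by apply/funext => w; rewrite /u mulrC.
  exact: differentiable_cmul.
have r2 : 0 <= rho / 2 by lra.
have u0 z : D z -> u z != 0.
  move=> Dz; rewrite mulf_neq0 ?invr_neq0 ?Lq0 // -nrm_gt0 nrm_pos //; lra.
have uc z : D z -> u w @[w --> z] --> u z.
  by move=> Dz; exact: (differentiable_continuous (ud z Dz)).
have [Lu [Luc LuE]] := C_convex_log oD D0 cD uc u0.
have Lud := log_branch_differentiable oD Luc LuE ud.
have nu z : D z -> nrm (u z) = (rho / 2) / nrm (L z - q) by rewrite /u nrmM nrmV nrm_pos.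
have Lu0 z : D z -> complex.Re (Lu z) < 0.
  move=> Dz; rewrite -expR_lt1 -nrm_cexp LuE // nu // ltr_pdivrMr ?nrm_gt0 ?Lq0 // mul1r.
  by apply: lt_le_trans (Lq z Dz); lra.
pose F z := cayley (Lu z).
have hF : holomorphic_map D unit_disc F.
  split=> z Dz; last by apply/unit_discE; exact: cayley_lt1 (Lu0 z Dz).
  have d1 : differentiable (fun w => Lu w + 1) z by apply: differentiable_addc; exact: Lud.
  have d2 : differentiable (fun w => (Lu w - 1)^-1) z.
    apply: (@differentiableV _ _ (fun w => Lu w - 1)); last exact: cayley_den (Lu0 z Dz).
    by apply: differentiable_addc; exact: Lud.
  exact: (differentiableM d1 d2).
have F1 z : D z -> nrm (F z) < 1 by move=> Dz; exact: hol_disc hF Dz.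
pose del := (1 - tnh r ^+ 2) * (1 - nrm (F z0)) ^+ 2.
have t0 := tnh_ge0 (ltW r0); have t1 := tnh_lt1 r.
have del0 : 0 < del.
  apply: mulr_gt0; first nra.
  by rewrite exprn_gt0 // subr_gt0 F1.
pose M1 := 4 / del.
exists (nrm q + rho / 2 * expR M1) => w [Dw wr].
have hp : phyp (F z0) (F w) < tnh r by apply: (cara_phyp hF Dz0 Dw (ltW r0)).
have far := phyp_far (F1 _ Dz0) (F1 _ Dw) t0 hp.
have LM := cayley_far (Lu0 w Dw) del0 far.
have uw : expR (- M1) <= nrm (u w).
  rewrite -LuE // nrm_cexp ler_expR lerNl; apply: le_trans LM.
  by apply: le_trans (Re_le _); rewrite -normrN ler_norm.
have nq : nrm (L w - q) <= rho / 2 * expR M1.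
  have p0 : 0 < nrm (L w - q) by rewrite nrm_gt0 Lq0.
  move: uw; rewrite nu // ler_pdivlMr // expRN => h.
  by rewrite mulrC -ler_pdivrMl ?expR_gt0.
by have := nrmBl (L w) q; lra.
Qed.

Hypothesis nl : ~ contains_complex_line D.

(** On a ball the logarithms of the n independent functionals are bounded, so the
    ball is bounded. If a limit point a of the ball lay outside D, the functional
    z |-> dot z nu - dot a nu given by a supporting hyperplane would have a bounded
    logarithm on the ball too, although it tends to 0 at a. *)
Theorem C_convex_c_finite_compact : c_finite_compact D.
Proof.
move=> z0 r Dz0 r0; have [oD conD D0] := dD.
have [M [k [L [q [rho [Mu H]]]]]] := log_coordinates dD cD nl.
have MTu : M^T \in unitmx by rewrite unitmx_tr.
have [N NP] : exists N : 'I_n -> R, forall j w, c_ball D z0 r w -> nrm (L j w) <= N j.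
  have HN j : exists N : R, forall w, c_ball D z0 r w -> nrm (L j w) <= N.
    by have [_ ? ? _ ?] := H j; apply: (@log_bounded_on_balls (L j) (q j) (rho j)).
  by have [N NP] := choice HN; exists N.
have dotb j w : c_ball D z0 r w -> nrm (dot w (row j M)) <= expR (N j) + nrm (k j).
  move=> wB; have [_ _ _ h _] := H j; have Dw : D w by case: wB.
  have : nrm (dot w (row j M) - k j) <= expR (N j).
    rewrite -h // nrm_cexp ler_expR; apply: le_trans (NP j w wB).
    by apply: le_trans (Re_le _); exact: ler_norm.
  by have := nrmBl (dot w (row j M)) (k j); lra.
pose K i := \sum_j (expR (N j) + nrm (k j)) * nrm (invmx M^T j i : C).
have K0 i : 0 <= K i.
  by apply: sumr_ge0 => j _; rewrite mulr_ge0 ?nrm_ge0 // addr_ge0 ?nrm_ge0 ?expR_ge0.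
have wb w i : c_ball D z0 r w -> nrm (w 0 i : C) <= K i.
  move=> wB; rewrite -[w](mulmxK MTu) mxE.
  have tri (I : Type) (s : seq I) (f : I -> C) : nrm (\sum_(j <- s) f j) <= \sum_(j <- s) nrm (f j).
    elim/big_ind2 : _ => [|x1 x2 y1 y2 h1 h2|//]; first by rewrite nrm0.
    by apply: le_trans (nrmD _ _) _; exact: lerD.
  apply: le_trans (tri _ _ _) _; apply: ler_sum => j _.
  by rewrite nrmM dot_mulmx; apply: ler_wpM2r; [exact: nrm_ge0|exact: dotb].
pose KK := \sum_i K i + 1.
have wB w : c_ball D z0 r w -> nrm w <= KK.
  move=> wc; apply: ltW; apply: nrm_rV_lt => [|i].
    by rewrite /KK ltr_wpDl // sumr_ge0.
  apply: le_lt_trans (wb w i wc) _; rewrite /KK (bigD1 i) //= -addrA ltrDl.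
  by rewrite ltr_wpDl // sumr_ge0.
have clB w : closure (c_ball D z0 r) w -> nrm w <= KK.
  move=> cw; apply/ler_addgt0Pr => e e0.
  have [w' [wc' ww']] := cw _ (near_nrm w e0).
  by have := wB w' wc'; have := nrm_tri w w' 0; rewrite !subr0 (nrmB w w'); lra.
split; first by apply: (@compact_bounded R n _ KK); [exact: closed_closure|exact: clB].
move=> a ca; apply: contrapT => nDa.
have clDa : closure D a by apply: (closureS _ ca) => w [].
have [nu [nu0 sup]] := supporting_hyperplane oD cD clDa nDa.
have om z : D z -> dot z nu != dot a nu.
  by move=> /sup; rewrite dotBl subr_eq0.
have [La [qa [ra [ra0 Lad LaE Laq]]]] := log_omits_disc dD cD nu0 om.
have [Ma MaP] := log_bounded_on_balls ra0 Lad Laq Dz0 r0.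
have c1 : (fun w : V => dot w nu) @ a --> dot a nu.
  exact: (differentiable_continuous (differentiable_dot nu a)).
have e0 := expR_gt0 (- Ma).
have [w [wc wa]] := ca _ (cvg_lt_nrm c1 e0).
have Dw : D w by case: wc.
move: wa => /=; rewrite ltNge => /negP; apply.
rewrite -LaE // nrm_cexp ler_expR lerNl; apply: le_trans (MaP w wc).
by apply: le_trans (Re_le _); rewrite -normrN ler_norm.
Qed.

(** The coordinates of the bounded embedding, scaled, are maps to the disc. *)
Lemma caratheodory_separates x y : D x -> D y -> cara D x y = 0%E -> x = y.
Proof.
move=> Dx Dy xy.
have [M [k [L [q [rho [Mu H]]]]]] := log_coordinates dD cD nl.
have MTu : M^T \in unitmx by rewrite unitmx_tr.
have sep f : holomorphic_map D unit_disc f -> f x = f y.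
  move=> hf; have fx1 := hol_disc hf Dx; have fy1 := hol_disc hf Dy.
  apply: phyp_eq0 => //; apply/eqP; rewrite eq_le phyp_ge0 andbT leNgt; apply/negP => p0.
  have := cara_ubound x y hf; rewrite xy lee_fin poincareE leNgt => /negP; apply.
  rewrite -artanh0; apply: artanh_lt => //; exact: phyp_lt1.
suff h : x *m M^T = y *m M^T by rewrite -[x](mulmxK MTu) h mulmxK.
apply/rowP => j; rewrite !dot_mulmx.
have [_ r0 Ld LE Lq] := H j.
have Lq0 z : D z -> L j z - q j != 0.
  by move=> Dz; rewrite -nrm_gt0; exact: lt_le_trans (Lq z Dz).
have r2 : 0 <= rho j / 2 by lra.
have hf : holomorphic_map D unit_disc (fun z => (L j z - q j)^-1 * ((rho j / 2)%:C : C)).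
  split=> z Dz.
    apply: differentiable_cmul; apply: (@differentiableV _ _ (fun w => L j w - q j)); last exact: Lq0.
    by apply: differentiable_addc; exact: Ld.
  apply/unit_discE; rewrite nrmM nrmV nrm_pos // mulrC ltr_pdivrMr ?nrm_gt0 ?Lq0 // mul1r.
  by apply: lt_le_trans (Lq z Dz); lra.
have := sep _ hf => /(@mulIf _ _ _) hh.
have {hh}/invr_inj/addIr e : (L j x - q j)^-1 = (L j y - q j)^-1.
  apply: hh; apply/eqP => /(congr1 (@complex.Re R)) /=; lra.
by apply: (@addIr _ (- k j)); rewrite -!LE // e.
Qed.

(** A Cauchy sequence eventually stays in one relatively compact ball, so it has a
    cluster point in D; the Caratheodory distance being continuous for the usual
    topology, the sequence converges to it. *)
Theorem C_convex_c_complete : c_complete D.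
Proof.
have [oD conD D0] := dD.
split.
  split=> [x y Dx Dy|x y Dx Dy|x y Dx Dy|x y z Dx Dy Dz].
  - by split; [exact: cara_fin|exact: cara_ge0].
  - split=> [|->]; first exact: caratheodory_separates.
    exact: cara_self.
  - exact: caraC.
  - exact: cara_triangle.
move=> x xD cauchy.
have [N NP] := cauchy 1 ltr01.
have [cpt sub] := C_convex_c_finite_compact (xD N) (ltr01 : 0 < (1 : R)).
have ball k : (N <= k)%N -> closure (c_ball D (x N) 1) (x k).
  by move=> Nk; apply: subset_closure; split; [exact: xD|exact: NP].
have Fb : (x k @[k --> \oo]) (closure (c_ball D (x N) 1)).
  by exists N => // k /= Nk; exact: ball.
have [l [/sub Dl lcl]] := cpt (x k @[k --> \oo]) _ Fb.
exists l => // e e0; have e2 : 0 < e / 2 by lra.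
have [N' NP'] := cauchy (e / 2) e2; exists N' => k Nk.
have tail : (x k @[k --> \oo]) [set w | exists2 j, (N' <= j)%N & w = x j].
  by exists N' => // j Nj; exists j.
have [w [[j Nj ->] jl]] := lcl _ _ tail (cara_near oD Dl e2).
apply: le_lt_trans (cara_triangle (xD k) (xD j) Dl) _.
rewrite [e]splitr EFinD; apply: lteD; first exact: NP'.
by rewrite caraC.
Qed.

End CFiniteCompact.

(** * Hyperconvexity *)

Lemma cvg_real_at {R : realType} {X : topologicalType} (f : X -> R) (x : X) (l : R) :
  (forall e : R, 0 < e -> \forall y \near x, `|l - f y| < e) -> f @ x --> l.
Proof. by move=> h; apply/cvgrPdist_lt => e e0; exact: h. Qed.

Section Hyperconvexity.
Variables (R : realType) (n : nat).
Local Notation C := (R[i]^o).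
Local Notation V := ('rV[R[i]^o]_n).
Variable D : set V.
Hypotheses (openD : open D) (connD : connected D).
Variable z0 : V.
Hypothesis Dz0 : D z0.

(** The hyperbolic tangent of the Caratheodory distance to z0. *)
Definition phyp_sup z : R :=
  sup [set phyp (f z0) (f z) | f in [set f : V -> C | holomorphic_map D unit_disc f]].

Lemma phyp_sup_has z : D z ->
  has_sup [set phyp (f z0) (f z) | f in [set f : V -> C | holomorphic_map D unit_disc f]].
Proof.
move=> Dz; split; first by exists (phyp 0 0), (fun=> 0); [exact: hol0|].
exists 1 => _ [f hf <-]; apply: ltW; apply: phyp_lt1; exact: hol_disc hf _.
Qed.

Lemma phyp_sup_ub f z : D z -> holomorphic_map D unit_disc f ->
  phyp (f z0) (f z) <= phyp_sup z.
Proof. by move=> Dz hf; apply: (sup_upper_bound (phyp_sup_has Dz)); exists f. Qed.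

Lemma phyp_sup_le z (r : R) : D z ->
  (forall f, holomorphic_map D unit_disc f -> phyp (f z0) (f z) <= r) -> phyp_sup z <= r.
Proof.
move=> Dz h; apply: ge_sup; first exact: (phyp_sup_has Dz).1.
by move=> _ [f hf <-]; exact: h.
Qed.

Lemma phyp_sup_lt1 z : D z -> phyp_sup z < 1.
Proof.
move=> Dz; have fin := cara_fin openD connD Dz0 Dz.
apply: (@le_lt_trans _ _ (tnh (fine (cara D z0 z)))); last exact: tnh_lt1.
apply: phyp_sup_le => // f hf; apply: artanh_le_tnh.
- by rewrite fine_ge0 // cara_ge0.
- by apply: phyp_lt1; exact: hol_disc hf _.
- by rewrite -lee_fin fineK //; exact: cara_ubound.
Qed.

Lemma phyp_sup_cts z : D z -> phyp_sup w @[w --> z] --> phyp_sup z.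
Proof.
move=> Dz; have [rho rho0 ballA] := (open_nrm _).1 openD z Dz.
apply: cvg_real_at => e e0.
have m0 : 0 < Num.min (rho / 2) (e * rho / 8).
  by rewrite lt_min; apply/andP; split; [lra|apply: divr_gt0 => //; exact: mulr_gt0].
apply: (near_imply (near_nrm z m0)) => w; rewrite lt_min => /andP[w1 w2].
have Dw : D w by apply: ballA; lra.
have small f : holomorphic_map D unit_disc f -> phyp (f z) (f w) <= e / 2.
  move=> hf; apply: le_trans (phyp_local rho0 ballA w1 hf) _.
  by rewrite ler_pdivrMr //; lra.
apply: (@le_lt_trans _ _ (e / 2)); last by lra.
rewrite ler_norml; apply/andP; split.
  rewrite lerBrDl -lerBrDr opprK; apply: phyp_sup_le => // f hf.
  apply: le_trans (phyp_triangle_le (hol_disc hf Dz0) (hol_disc hf Dz) (hol_disc hf Dw)) _.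
  by apply: lerD; [exact: phyp_sup_ub|exact: small].
rewrite lerBlDr; apply: phyp_sup_le => // f hf.
apply: le_trans (phyp_triangle_le (hol_disc hf Dz0) (hol_disc hf Dw) (hol_disc hf Dz)) _.
by rewrite addrC; apply: lerD; [rewrite phypC; exact: small|exact: phyp_sup_ub].
Qed.

Lemma line_differentiable (a b : V) (l : C) : differentiable (fun t : C => a + t *: b) l.
Proof.
have d1 : differentiable (fun t : C => t *: b) l.
  exact: (@differentiableZl _ _ _ (fun t : C => t) b l (differentiable_idfun l)).
exact: (differentiableD (differentiable_cst a l) d1).
Qed.

(** Each competitor l |-> |mobius (f z0) (f (a + l b))| satisfies the sub-mean value
    inequality, by the mean value property of a rotate with nonnegative real
    value at the centre; hence so does the supremum. *)
Lemma phyp_sup_submean (a b : V) (c : C) (r : R) : 0 < r ->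
  (forall l : C, nrm (l - c) <= r -> D (a + l *: b)) ->
  2 * pi * phyp_sup (a + c *: b) <=
    itg 0 (2 * pi) (fun t => phyp_sup (a + (c + r%:C * cexp (t *i)) *: b)).
Proof.
move=> r0 discD; have pi0 := pi_gt0 R.
have nr t : nrm (c + r%:C * cexp (t *i) - c) = r.
  by rewrite addrAC subrr add0r nrmM nrm_cexp /= expR0 mulr1 nrm_pos // ltW.
have Dc : D (a + c *: b) by apply: discD; rewrite subrr nrm0 ltW.
have sc : continuous (fun t : R => phyp_sup (a + (c + r%:C * cexp (t *i)) *: b)).
  move=> t.
  have c1 : (fun t : R => c + r%:C * cexp (t *i) : C) @ t --> (c + r%:C * cexp (t *i) : C).
    by apply: (@circle_cts R (fun w => w) c r r0) => z _; exact: cvg_id_at.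
  have c2 := cvg_comp_at c1 (@line_cts R n a b _).
  apply: (cvg_comp_at c2); apply: phyp_sup_cts; apply: discD.
  by rewrite nr.
rewrite mulrC -ler_pdivlMr; last by lra.
apply: phyp_sup_le => // f hf; rewrite ler_pdivlMr ?mulr_gt0 // mulrC.
have fz1 := hol_disc hf Dz0.
pose phi (l : C) : C := mobius (f z0) (f (a + l *: b)).
have phid l : nrm (l - c) <= r -> differentiable phi l.
  move=> lr; have d1 := differentiable_comp (line_differentiable a b l) (hf.1 _ (discD l lr)).
  exact: (differentiable_comp d1 (differentiable_mobius fz1 (hol_disc hf (discD l lr)))).
have [al [alE nal]] := unit_rotation (phi c).
pose psi (l : C) : C := phi l * al.
have psid l : nrm (l - c) <= r -> differentiable psi l.
  by move=> lr; apply: differentiable_cmul; exact: phid.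
have := mean_value r0 psid.
have -> : complex.Re (psi c) = phyp (f z0) (f (a + c *: b)).
  by rewrite /psi mulrC alE /= /phi nrm_mobius.
move=> <-; apply: itg_le => //.
  move=> t; apply: cvg_Re; apply: (@circle_cts R psi c r r0) => z zr.
  by apply: (differentiable_continuous (psid z _)); rewrite zr.
move=> t _; apply: le_trans (ler_norm _) _; apply: le_trans (Re_le _) _.
rewrite /psi nrmM nal mulr1 /phi nrm_mobius.
by apply: phyp_sup_ub => //; apply: discD; rewrite nr.
Qed.

Lemma phyp_sup_psh : plurisubharmonic_on D (fun z => (phyp_sup z - 1)%:E).
Proof.
have usc z (e : R) : D z -> ((phyp_sup z - 1)%:E < e%:E)%E ->
    \forall w \near z, ((phyp_sup w - 1)%:E < e%:E)%E.
  move=> Dz; rewrite lte_fin ltrBlDr => h.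
  have n1 : \forall w \near z, phyp_sup w < e + 1 by exact: cvgr_lt (phyp_sup_cts Dz) _ h.
  by apply: (near_imply n1) => w; rewrite lte_fin ltrBlDr.
split=> [z Dz|z Dz e h|a b]; first exact: ltry.
  by apply: (near_imply (usc z e Dz h)) => w hw _.
split=> [l Dl|l Dl e h|c r r0 disc]; first exact: ltry.
  have n1 := near_cvg (@line_cts R n a b l) (usc _ e Dl h).
  by apply: (near_imply n1) => w hw _.
have pi0 := pi_gt0 R.
have discD l : nrm (l - c : C) <= r -> D (a + l *: b).
  by move=> h; apply: disc; rewrite /= normE lecR.
have E t : c + r%:C * (cos t +i* sin t) = c + r%:C * cexp (t *i) :> C.
  by congr (_ + _ * _); apply: complexP; rewrite /= expR0 mul1r.
have nr t : nrm (c + r%:C * cexp (t *i) - c) = r.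
  by rewrite addrAC subrr add0r nrmM nrm_cexp /= expR0 mulr1 nrm_pos // ltW.
have sc : continuous (fun t : R => phyp_sup (a + (c + r%:C * cexp (t *i)) *: b)).
  move=> t.
  have c1 : (fun t : R => c + r%:C * cexp (t *i) : C) @ t --> (c + r%:C * cexp (t *i) : C).
    by apply: (@circle_cts R (fun w => w) c r r0) => z _; exact: cvg_id_at.
  have c2 := cvg_comp_at c1 (@line_cts R n a b _).
  by apply: (cvg_comp_at c2); apply: phyp_sup_cts; apply: discD; rewrite nr.
have sc1 : continuous (fun t : R => phyp_sup (a + (c + r%:C * cexp (t *i)) *: b) - 1).
  by move=> t; apply: cvgB; [exact: sc|exact: cvg_cst].
have -> : (\int[lebesgue_measure]_(t in `[0%R, (2 * pi)%R])
    (phyp_sup (a + (c + r%:C * (cos t +i* sin t)) *: b) - 1)%:E)%E =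
  (itg 0 (2 * pi) (fun t => phyp_sup (a + (c + r%:C * cexp (t *i)) *: b) - 1))%:E.
  rewrite /itg /Rintegral fineK.
    by apply: eq_integral => t _; rewrite E.
  apply: integrable_fin_num => //; exact: (cts_integrable 0 (2 * pi) sc1).
rewrite -EFinM lee_fin itgB //; last by move=> t; exact: cvg_cst.
rewrite itg_cst; last by lra.
have h := phyp_sup_submean r0 discD.
rewrite ler_pdivlMl; last by lra.
rewrite mulrBr mulr1 subr0 mul1r; lra.
Qed.

End Hyperconvexity.

(** The exhaustion function is tanh (cara D z0 z) - 1; its sublevel sets lie in
    Caratheodory balls. *)
Theorem c_finite_compact_hyperconvex {R : realType} {n : nat} (D : set 'rV[R[i]^o]_n) :
  domain D -> c_finite_compact D -> hyperconvex D.
Proof.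
move=> [oD conD [z0 Dz0]] cfc.
exists (fun z => (phyp_sup D z0 z - 1)%:E); split.
- exact: phyp_sup_psh.
- by move=> z Dz; rewrite lte_fin subr_lt0; exact: phyp_sup_lt1.
move=> c c0; pose r := `|artanh (1 + c)| + 1.
have r0 : 0 < r by rewrite /r; have := normr_ge0 (artanh (1 + c)); lra.
have [cpt sub] := cfc z0 r Dz0 r0.
have incl : [set z | D z /\ ((phyp_sup D z0 z - 1)%:E < c%:E)%E] `<=` c_ball D z0 r.
  move=> z /= [Dz]; rewrite lte_fin => h; split=> //.
  apply: (@le_lt_trans _ _ (artanh (1 + c))%:E); last first.
    by rewrite lte_fin /r; have := ler_norm (artanh (1 + c)); lra.
  apply: cara_le => f hf; rewrite lee_fin poincareE; apply: artanh_le; first exact: phyp_ge0.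
    by lra.
  by have := phyp_sup_ub Dz0 Dz hf; lra.
split; last by apply: subset_trans sub; exact: closureS.
by apply: (subclosed_compact _ cpt); [exact: closed_closure|exact: closureS].
Qed.

(** * Tautness *)

Section UnitDisc.
Variable R : realType.
Local Notation C := (R[i]^o).

Lemma unit_disc_open : open (@unit_disc R).
Proof.
rewrite (_ : @unit_disc R = (fun z : C => nrm z) @^-1` [set x : R | x < 1]).
  by apply: open_comp (@open_lt R 1) => z _; exact: nrm_cts.
by apply/seteqP; split=> z; [move/unit_discE|move=> h; apply/unit_discE].
Qed.

Lemma unit_disc_connected : connected (@unit_disc R).
Proof.
have -> : @unit_disc R =
    \bigcup_(r in @unit_disc R) [set (t%:C * r : C) | t in [set t : R | 0 <= t <= 1]].
  apply/seteqP; split=> z.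
    by move=> z1; exists z => //; exists 1; rewrite /= ?lexx ?ler01 ?mul1r.
  move=> [r /unit_discE r1 [t /andP[t0 t1] <-]]; apply/unit_discE.
  by rewrite nrmM nrm_pos //; apply: le_lt_trans r1; rewrite ler_piMl ?nrm_ge0.
apply: bigcup_connected.
  by exists 0 => r _; exists 0; rewrite /= ?lexx ?ler01 ?mul0r.
move=> r _; apply: connected_continuous_connected; first exact: unit_interval_connected.
apply: continuous_subspaceT => t.
have c1 : (fun t : R => t%:C : C) @ t --> (t%:C : C) by exact: cvg_toC (cvg_id_at t).
exact: (cvgM c1 (cvg_cst_at r)).
Qed.

Lemma compact_in_disc (K : set C) : compact K -> K `<=` @unit_disc R ->
  exists2 s : R, s < 1 & forall z, K z -> nrm z <= s.
Proof.
move=> cK K1; have [->|K0] := eqVneq K set0; first by exists 0 => //; exact: ltr01.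
have nc : {within K, continuous (fun z : C => nrm z)}.
  by apply: continuous_subspaceT => z; exact: nrm_cts.
have [c cin cmax] := compact_EVT_max ((set0P _).1 K0) cK nc.
exists (nrm c); first by move: cin; rewrite inE => /K1/unit_discE.
by move=> z Kz; apply: cmax; rewrite inE.
Qed.

Lemma uniform_cvg_nrm {V : normedModType R[i]} (K : set C) (f : nat -> C -> V) (g : C -> V) :
  (forall e : R, 0 < e -> exists N, forall k z, (N <= k)%N -> K z -> nrm (f k z - g z) < e) ->
  {uniform K, f @ \oo --> g}.
Proof.
move=> H P /uniform_nbhs[E [entE EP]].
move: entE; rewrite -entourage_ballE => -[e /= e0 eE].
have er : e = (complex.Re e)%:C by rewrite RRe_real // gtr0_real.
have e1 : 0 < complex.Re e by rewrite -ltcR -er.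
have [N NP] := H _ e1; exists N => // k /= Nk; apply: EP => z Kz; apply: eE => /=.
by rewrite -ball_normE /ball_ /= normE er ltcR nrmB; exact: NP.
Qed.

End UnitDisc.

Section CaratheodoryBounds.
Variables (R : realType) (V : normedModType R[i]) (A : set V).
Hypotheses (openA : open A) (connA : connected A).

Lemma cara_bounded_compact z (K : set V) : A z -> compact K -> K `<=` A ->
  exists2 M : R, 0 < M & forall w, K w -> (cara A z w < M%:E)%E.
Proof.
move=> Az cK KA.
have H : \forall M \near +oo, K `<=` [set w | (cara A z w < M%:E)%E].
  apply: ((compact_near_coveringP K).1 cK R _ (fun M w => (cara A z w < M%:E)%E)) => x Kx.
  have Ax := KA x Kx; have fin := cara_fin openA connA Az Ax.
  have n1 : \forall w \near x, A w /\ (cara A x w < 1%:E)%E.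
    have n2 : \forall w \near x, A w by exact: open_nbhs_nbhs.
    have n3 := cara_near openA Ax (ltr01 : 0 < (1 : R)).
    exact: filterI n2 n3.
  have n4 : \forall M \near +oo, fine (cara A z x) + 1 < M.
    by exists (fine (cara A z x) + 1); split => //; exact: num_real.
  exists ([set w | A w /\ (cara A x w < 1%:E)%E], [set M | fine (cara A z x) + 1 < M]).
    by split.
  move=> [w M] /= [[Aw wx] hM].
  apply: le_lt_trans (cara_triangle Az Ax Aw) _.
  apply: (@lt_trans _ _ (fine (cara A z x) + 1)%:E); last by rewrite lte_fin.
  by rewrite EFinD fineK // lteD2lE // fin_numE.
have [M0 [_ HM]] := H.
exists (Num.max M0 0 + 1); first by rewrite ltr_wpDl // le_max lexx orbT.
by move=> w; apply: HM; rewrite ltr_pwDr // le_max lexx.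
Qed.

End CaratheodoryBounds.

Section Tautness.
Variables (R : realType) (n : nat).
Local Notation C := (R[i]^o).
Local Notation V := ('rV[R[i]^o]_n).
Variable D : set V.
Hypotheses (dD : domain D) (cfc : c_finite_compact D).
Variables (f : nat -> C -> V) (z0 : V).
Hypotheses (hf : forall k, holomorphic_map unit_disc D (f k)) (Dz0 : D z0).

Let oD : open D. Proof. by case: dD. Qed.
Let conD : connected D. Proof. by case: dD. Qed.

Lemma disc0 : @unit_disc R 0.
Proof. by apply/unit_discE; rewrite nrm0 ltr01. Qed.

(** Holomorphic maps do not increase the Caratheodory distance, so f_k(K) stays
    within bounded distance of f_k(0). *)
Lemma compactly_divergent :
  (forall r : R, 0 < r -> exists N, forall k, (N <= k)%N -> ~ (cara D z0 (f k 0%R) < r%:E)%E) ->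
  forall (K : set C) (L : set V), compact K -> K `<=` @unit_disc R -> compact L -> L `<=` D ->
    \forall k \near \oo, (f k @` K) `&` L = set0.
Proof.
move=> H K L cK K1 cL LD.
have [M M0 MP] := cara_bounded_compact (@unit_disc_open R) (@unit_disc_connected R) disc0 cK K1.
have [M' M'0 MP'] := cara_bounded_compact oD conD Dz0 cL LD.
have [N NP] := H (M' + M) (addr_gt0 M'0 M0).
exists N => // k /= Nk; apply/seteqP; split=> // w [[a Ka <-] Lw].
apply: (NP k Nk).
apply: le_lt_trans (cara_triangle Dz0 (LD _ Lw) ((hf k).2 _ disc0)) _.
rewrite EFinD; apply: lteD; first exact: MP'.
rewrite caraC; apply: le_lt_trans (cara_contract _ _ (hf k)) _.
exact: MP.
Qed.

Variable r : R.
Hypotheses (r0 : 0 < r).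
Let good := [set k | (cara D z0 (f k 0%R) < r%:E)%E].
Hypothesis good_often : forall N, exists2 k, (N <= k)%N & good k.

Lemma orbit_relatively_compact (s : R) : s < 1 -> exists X : set V,
  [/\ compact X, X `<=` D & forall k a, good k -> nrm a <= s -> X (f k a)].
Proof.
move=> s1.
have cK := @compact_disc R s.
have K1 : [set z : C | nrm z <= s] `<=` @unit_disc R.
  by move=> z /= zs; apply/unit_discE; exact: le_lt_trans zs s1.
have [M M0 MP] := cara_bounded_compact (@unit_disc_open R) (@unit_disc_connected R) disc0 cK K1.
have [cX XD] := cfc Dz0 (addr_gt0 r0 M0).
exists (closure (c_ball D z0 (r + M))); split=> // k a gk as_.
have a1 : @unit_disc R a by exact: K1.
apply: subset_closure; split; first exact: (hf k).2.
apply: le_lt_trans (cara_triangle Dz0 ((hf k).2 _ disc0) ((hf k).2 _ a1)) _.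
rewrite EFinD; apply: lteD; first exact: gk.
apply: le_lt_trans (cara_contract _ _ (hf k)) _; exact: MP.
Qed.

Lemma compact_nrm_bounded (X : set V) : compact X ->
  exists2 M : R, 0 <= M & forall v, X v -> nrm v <= M.
Proof.
move=> cX; have [->|X0] := eqVneq X set0; first by exists 0.
have nc : {within X, continuous (fun v : V => nrm v)}.
  by apply: continuous_subspaceT => z; exact: nrm_cts.
have [c cin cmax] := compact_EVT_max ((set0P _).1 X0) cX nc.
exists (nrm c); first exact: nrm_ge0.
by move=> z Xz; apply: cmax; rewrite inE.
Qed.

(** Orbits stay in a compact, hence bounded, set, so that the Schwarz lemma makes the
    good f_k equicontinuous. *)
Lemma equi_lipschitz (s : R) : 0 <= s < 1 -> exists (d Lam : R), [/\ 0 < d, 0 <= Lam &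
  forall k a b, good k -> nrm a <= s -> nrm (b - a) < d -> nrm (f k b - f k a) <= Lam * nrm (b - a)].
Proof.
move=> /andP[s0 s1]; pose s' := (s + 1) / 2; pose rho := s' - s.
have s'1 : s' < 1 by rewrite /s'; lra.
have rho0 : 0 < rho by rewrite /rho /s'; lra.
have [X [cX XD XP]] := orbit_relatively_compact s'1.
have [M M0 MP] := compact_nrm_bounded cX.
exists (rho / 2), (2 * (2 * M) / rho); split; first by lra.
  by apply: divr_ge0; [lra|exact: ltW].
move=> k a b gk as_ ba.
have inb z : nrm (z - a) < rho -> nrm z <= s'.
  by move=> h; have := nrm_tri z a 0; rewrite !subr0; rewrite /rho in h; lra.
have coord i : nrm (f k b 0 i - f k a 0 i : C) <= 2 * (2 * M) / rho * nrm (b - a).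
  apply: (@schwarz_weak R (fun z => f k z 0 i) a rho (2 * M) rho0) => //.
  - move=> z /inb zs; have z1 : @unit_disc R z by apply/unit_discE; exact: le_lt_trans s'1.
    exact: (differentiable_comp ((hf k).1 z z1) (differentiable_coord (f k z) 0 i)).
  - move=> z w /inb zs /inb ws; apply: le_trans (nrmD _ _) _; rewrite nrmN.
    have := nrm_coord (f k z) i; have := nrm_coord (f k w) i.
    by have := MP _ (XP k z gk zs); have := MP _ (XP k w gk ws); lra.
apply/ler_addgt0Pr => e e0; apply: ltW; apply: nrm_rV_lt.
  by rewrite ltr_wpDl // mulr_ge0 ?nrm_ge0 // divr_ge0 ?(ltW rho0) //; lra.
by move=> i; rewrite !mxE; have := coord i; lra.
Qed.

(** The indices k with f_k(0) in the ball carry a free ultrafilter, along which all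
    the relatively compact orbits k |-> f_k(a) converge at once. *)
Lemma ultralimit : exists (U : set_system nat) (g : C -> V),
  [/\ ProperFilter U, U good, (forall N, U [set k | (N <= k)%N]),
      (forall a, @unit_disc R a -> D (g a)) &
      (forall a, @unit_disc R a -> f k a @[k --> U] --> g a)].
Proof.
have FP : ProperFilter (within good \oo).
  apply: Build_ProperFilter_ex => P [N _ NP].
  have [k Nk gk] := good_often N; exists k; exact: NP Nk gk.
have [U [UU FU]] := ultraFilterLemma FP.
have Ugood : U good by apply: FU; exists 0%N.
have Utail N : U [set k | (N <= k)%N] by apply: FU; exists N.
have lim a : exists l : V, @unit_disc R a -> D l /\ f k a @[k --> U] --> l.
  have [a1|] := pselect (@unit_disc R a); last by exists 0.
  have [X [cX XD XP]] := orbit_relatively_compact ((unit_discE a).1 a1).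
  have UX : (f k a @[k --> U]) X.
    by apply: (@filterS _ U _ good _ _ Ugood) => k gk; have := XP k a gk (lexx _).
  have [l [Xl lcl]] := cX (f k a @[k --> U]) _ UX.
  exists l => _; split; first exact: XD.
  move=> B nB; have [//|nU] := in_ultra_setVsetC (f^~ a @^-1` B) UU.
  by have [w [nBw Bw]] := lcl (~` B) B nU nB.
have [g gP] := choice lim.
have PU : ProperFilter U by exact: ultra_proper.
by exists U, g; split => [//|//|//|a /gP[]|a /gP[]].
Qed.

(** Equicontinuity and compactness of discs turn pointwise into uniform convergence. *)
Lemma uniform_on_discs (U : set_system nat) (g : C -> V) (s e : R) :
  ProperFilter U -> U good -> (forall a, @unit_disc R a -> f k a @[k --> U] --> g a) ->
  s < 1 -> 0 < e -> U [set k | forall a, nrm a <= s -> nrm (f k a - g a) < e].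
Proof.
move=> PU Ug Ucv s1 e0.
have [s_lt0|s_ge0] := ltP s 0.
  by apply: filterS Ug => k _ a as_; have := nrm_ge0 a; lra.
have [d [Lam [d0 L0 lip]]] := @equi_lipschitz s (introT andP (conj s_ge0 s1)).
have K1 a : nrm a <= s -> @unit_disc R a.
  by move=> as_; apply/unit_discE; exact: le_lt_trans as_ s1.
have ucv a (t : R) : nrm a <= s -> 0 < t -> U [set k | nrm (f k a - g a) < t].
  by move=> as_ t0; exact: cvg_lt_nrm (Ucv a (K1 a as_)) t0.
have glip a b : nrm a <= s -> nrm b <= s -> nrm (b - a) < d -> nrm (g b - g a) <= Lam * nrm (b - a).
  move=> as_ bs ba; apply/ler_addgt0Pr => t t0; have t2 : 0 < t / 2 by lra.
  have [k [gk [k1 k2]]] := filter_ex (filterI Ug (filterI (ucv a _ as_ t2) (ucv b _ bs t2))).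
  move: k1 k2 => /= k1 k2.
  have h := lip k a b gk as_ ba.
  have -> : g b - g a = (f k b - f k a) - (f k b - g b) + (f k a - g a).
    by rewrite opprB addrA addrA; apply/rowP => i; rewrite !mxE; ring.
  apply: le_trans (nrmD _ _) _; have := nrmD (f k b - f k a) (- (f k b - g b)).
  by rewrite nrmN; lra.
have := (compact_near_coveringP _).1 (@compact_disc R s) nat U
  (fun k a => nrm a <= s -> nrm (f k a - g a) < e).
move=> /(_ _) H.
have {H}H : U [set k | [set z : C | nrm z <= s] `<=` [set a | nrm a <= s -> nrm (f k a - g a) < e]].
  apply: H => a /= as_.
  pose q := Num.min d (e / (4 * (Lam + 1))).
  have q0 : 0 < q by rewrite lt_min d0 divr_gt0 // mulr_gt0 //; lra.
  have e2 : 0 < e / 2 by lra.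
  exists ([set b : C | nrm (b - a) < q], [set k | good k /\ nrm (f k a - g a) < e / 2]).
    split; first exact: (@near_nrm R C a q q0).
    exact: filterI Ug (ucv a _ as_ e2).
  move=> [b k] /= [bq [gk ka]] bs.
  move: bq; rewrite lt_min => /andP[bd be].
  have h1 := lip k a b gk as_ bd; have h2 := glip a b as_ bs bd.
  have h3 : Lam * nrm (b - a) <= e / 4.
    have L1 : 0 < 4 * (Lam + 1) by lra.
    move: be; rewrite ltr_pdivlMr // => be; have := nrm_ge0 (b - a); nra.
  have -> : f k b - g b = (f k b - f k a) + (f k a - g a) - (g b - g a).
    by apply/rowP => i; rewrite !mxE; ring.
  apply: le_lt_trans (nrmD _ _) _; rewrite nrmN.
  by have := nrmD (f k b - f k a) (f k a - g a); lra.
by apply: filterS H => k h a as_; exact: h.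
Qed.

Lemma locally_uniform_subsequence : exists2 phi : nat -> nat, {homo phi : j k / (j < k)%N} &
  exists2 g, holomorphic_map (@unit_disc R) D g &
    forall K : set C, compact K -> K `<=` @unit_disc R -> {uniform K, (f \o phi) @ \oo --> g}.
Proof.
have [U [g [PU Ug Ut gD Ucv]]] := ultralimit.
pose s m : R := 1 - (m.+1%:R)^-1.
have inv0 m : 0 < (m.+1%:R)^-1 :> R by rewrite invr_gt0 ltr0Sn.
have s1 m : s m < 1 by rewrite /s gtrBl.
have pick (mN : nat * nat) : exists k, (mN.2 < k)%N /\
    forall a, nrm a <= s mN.1 -> nrm (f k a - g a) < (mN.1.+1%:R)^-1.
  have H := uniform_on_discs PU Ug Ucv (s1 mN.1) (inv0 mN.1).
  by have [k [k1 k2]] := filter_ex (filterI (Ut mN.2.+1) H); exists k.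
have [p pP] := choice pick.
pose phi := fix phi m := if m is m'.+1 then p (m, phi m') else p (0%N, 0%N).
have phiP m a : nrm a <= s m -> nrm (f (phi m) a - g a) < (m.+1%:R)^-1.
  by case: m => [|m]; [exact: (pP (0%N, 0%N)).2|exact: (pP (m.+1, phi m)).2].
have uni (t e : R) : t < 1 -> 0 < e -> exists N, forall k a, (N <= k)%N -> nrm a <= t ->
    nrm (f (phi k) a - g a) < e.
  move=> t1 e0; pose q := Num.min e (1 - t).
  have q0 : 0 < q by rewrite lt_min e0; lra.
  have [N NP] : exists N : nat, q^-1 < N%:R.
    by exists (Num.truncn q^-1).+1; exact: truncnS_gt.
  exists N => k a Nk at_.
  have kq : (k.+1%:R)^-1 < q.
    rewrite -[ltRHS]invrK ltf_pV2 ?posrE ?invr_gt0 ?ltr0Sn //.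
    by apply: lt_trans NP _; rewrite ltr_nat ltnS.
  move: (kq); rewrite lt_min => /andP[ke kt].
  apply: lt_trans ke; apply: phiP; apply: le_trans at_ _; by rewrite /s lerBrDr -lerBrDl ltW.
exists phi.
  by apply: homo_ltn => [|m]; [exact: ltn_trans|exact: (pP (m.+1, phi m)).1].
exists g.
  split=> [c c1|a a1]; last exact: gD.
  have {}c1 := (unit_discE c).1 c1.
  pose rho := (1 - nrm c) / 2; have rho0 : 0 < rho by rewrite /rho; lra.
  pose t := nrm c + rho; have t1 : t < 1 by rewrite /t /rho; lra.
  have inb z : nrm (z - c) < rho -> nrm z <= t.
    by move=> h; have := nrm_tri z c 0; rewrite !subr0 /t; lra.
  apply: differentiable_rV => i.
  apply: (@weierstrass R (fun k z => f (phi k) z 0 i) (fun z => g z 0 i) c rho rho0).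
    move=> k z /inb zt; have z1 : @unit_disc R z by apply/unit_discE; exact: le_lt_trans zt t1.
    exact: (differentiable_comp ((hf (phi k)).1 z z1) (differentiable_coord (f (phi k) z) 0 i)).
  move=> e e0; have [N NP] := uni t e t1 e0; exists N => k z Nk /inb zt.
  apply: le_lt_trans (NP k z Nk zt).
  by have := nrm_coord (f (phi k) z - g z) i; rewrite !mxE.
move=> K cK K1; have [t t1 Kt] := compact_in_disc cK K1.
apply: uniform_cvg_nrm => e e0; have [N NP] := uni t e t1 e0.
by exists N => k z Nk /Kt; exact: NP.
Qed.

End Tautness.

(** Either infinitely many f_k(0) stay in one Caratheodory ball, and a subsequence
    converges, or the whole sequence diverges compactly. *)
Theorem c_finite_compact_taut {R : realType} {n : nat} (D : set 'rV[R[i]^o]_n) :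
  domain D -> c_finite_compact D -> taut D.
Proof.
move=> dD cfc f hf; have [oD conD [z0 Dz0]] := dD.
have [[r [r0 often]]|never] := pselect (exists r : R, 0 < r /\
    forall N, exists2 k, (N <= k)%N & (cara D z0 (f k 0%R) < r%:E)%E).
  have [phi phiS H] := locally_uniform_subsequence cfc hf Dz0 r0 often.
  by exists phi => //; left.
exists id => //; right; apply: (compactly_divergent dD hf Dz0) => r r0.
apply: contrapT => h; apply: never; exists r; split => // N.
apply: contrapT => h2; apply: h; exists N => k Nk hk; apply: h2.
by exists k.
Qed.

(** * C-convex domains without complex lines *)

Theorem theorem5p5 (R : realType) (n : nat) (n_gt0 : (0 < n)%N)
    (D : set 'rV[R[i]^o]_n) (domD : domain D) (convD : C_convex D)
    (nolineD : ~ contains_complex_line D) :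
  (exists G : set 'rV[R[i]^o]_n,
     [/\ domain G, bounded_set G & biholomorphic D G]) /\
  c_finite_compact D /\
  c_complete D /\
  hyperconvex D /\
  taut D.
Proof.
have cfc : c_finite_compact D by exact: C_convex_c_finite_compact.
split; first exact: biholomorphic_bounded.
split=> //; split; first exact: C_convex_c_complete.
by split; [exact: c_finite_compact_hyperconvex|exact: c_finite_compact_taut].
Qed.
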